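(* Let $1\leq p<\infty$ and let $\mu$ be a $\sigma$-finite positive Borel measure on $(0,\infty)$. The Hausdorff operator $$\mathcal{H}_{\mu}(f)(z)=\int_{0}^{\infty}\frac{1}{t}f\left(\frac{z}{t}\right)\,d\mu(t),\qquad z\in\mathbb{U},$$ is bounded on the Bergman space $A^{p}(\mathbb{U})$ if and only if $$\int_{0}^{\infty}\frac{1}{t^{1-\frac{2}{p}}}\,d\mu(t)<\infty.$$ Moreover, in that case the operator norm is $$\|\mathcal{H}_{\mu}\|_{A^{p}(\mathbb{U})\to A^{p}(\mathbb{U})}=\int_{0}^{\infty}\frac{1}{t^{1-\frac{2}{p}}}\,d\mu(t).$$
   Context: $\mathbb{U}=\{z\in\mathbb{C}:\operatorname{Im} z>0\}$ is the upper half plane and $dA$ is area (Lebesgue) measure. For $1\le p<\infty$, the Bergman space $A^{p}(\mathbb{U})$ consists of all holomorphic functions $f$ on $\mathbb{U}$ with $$\|f\|_{A^{p}(\mathbb{U})}=\left(\frac{1}{\pi}\int_{\mathbb{U}}|f|^{p}\,dA\right)^{1/p}<\infty.$$ ''$\mathcal{H}_\mu$ is bounded on $A^{p}(\mathbb{U})$'' means that for every $f\in A^p(\mathbb{U})$ the (Lebesgue) integral defining $\mathcal{H}_\mu(f)(z)$ converges for every $z\in\mathbb{U}$, the function $\mathcal{H}_\mu(f)$ belongs to $A^p(\mathbb{U})$, and there is a constant $C$ with $\|\mathcal{H}_\mu(f)\|_{A^p(\mathbb{U})}\le C\|f\|_{A^p(\mathbb{U})}$ for all $f\in A^p(\mathbb{U})$;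 the operator norm is the least such $C$. *)

(* Defs.v *)
From mathcomp Require Import all_boot all_order all_algebra.
From mathcomp Require Export complex.
From mathcomp Require Import all_classical all_reals all_analysis.

Set Implicit Arguments.
Unset Strict Implicit.
Unset Printing Implicit Defensive.

Import Order.TTheory GRing.Theory Num.Theory.
Import numFieldNormedType.Exports.

Local Open Scope classical_set_scope.
Local Open Scope ring_scope.
Local Open Scope complex_scope.

(* The increments in [derivable] range over the scalar field [C] itself, so
   with [C] the complex numbers this is complex differentiability on [D]. *)
Definition holomorphic_on (C : numClosedFieldType) (D : set C) (f : C -> C) :=
  forall z, D z -> derivable (f : C^o -> C^o) z 1.

Section bergman.
Context {R : realType}.

Definition upper_half_plane : set R[i] := [set z | 0 < complex.Im z].

(* [`|z|] is an element of [R[i]] with zero imaginary part, hence the real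
   part.  The area measure is the product of two Lebesgue measures, and the
   norm takes values in [\bar R] so that it is defined for every function. *)
Definition bergman_norm (p : R) (f : R[i] -> R[i]) : \bar R :=
  ((pi^-1)%:E *
   \int[(@lebesgue_measure R \x @lebesgue_measure R)%E]_(w in
       [set w : measurableTypeR R * measurableTypeR R |
          upper_half_plane (w.1 +i* w.2)])
     (complex.Re `|f (w.1 +i* w.2)| `^ p)%:E) `^ p^-1.

(* Only the values of [f] on the upper half plane are relevant. *)
Definition bergman_space (p : R) : set (R[i] -> R[i]) :=
  [set f | holomorphic_on upper_half_plane f /\ (bergman_norm p f < +oo)%E].

Definition cintegrable d (T : measurableType d) (mu : {measure set T -> \bar R})
    (D : set T) (g : T -> R[i]) :=
  mu.-integrable D (fun t => (complex.Re (g t))%:E) /\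
  mu.-integrable D (fun t => (complex.Im (g t))%:E).

Definition cintegral d (T : measurableType d) (mu : {measure set T -> \bar R})
    (D : set T) (g : T -> R[i]) : R[i] :=
  Rintegral mu D (fun t => complex.Re (g t)) +i*
  Rintegral mu D (fun t => complex.Im (g t)).

Definition half_line : set (measurableTypeR R) := `]0, +oo[.

Section hausdorff.
(* A Borel measure on the half line (0, +oo) is represented by a Borel measure
   on [R] of which only the restriction to the half line is ever used. *)
Variable mu : {measure set (measurableTypeR R) -> \bar R}.

Definition hausdorff_integrand (f : R[i] -> R[i]) (z : R[i]) (t : R) : R[i] :=
  1 / t%:C * f (z / t%:C).

Definition hausdorff (f : R[i] -> R[i]) (z : R[i]) : R[i] :=
  cintegral mu half_line (hausdorff_integrand f z).

Definition hausdorff_bound (p C : R) :=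
  0 <= C /\
  forall f, bergman_space p f ->
    (bergman_norm p (hausdorff f) <= C%:E * bergman_norm p f)%E.

Definition hausdorff_bounded (p : R) :=
  [/\ forall f, bergman_space p f -> forall z, upper_half_plane z ->
        cintegrable mu half_line (hausdorff_integrand f z),
      forall f, bergman_space p f -> bergman_space p (hausdorff f)
    & exists C, hausdorff_bound p C].

Definition is_hausdorff_norm (p C : R) :=
  hausdorff_bound p C /\ forall C', hausdorff_bound p C' -> C <= C'.

End hausdorff.
End bergman.

(* Main.v *)
(* Sufficiency: an area mean value inequality bounds [|f z|] by a constant times
   [(Im z) ^ (- 2 / p)], so the integrand and its derivative in [z] are dominated by
   multiples of the weight [c(t) = t ^ (2 / p - 1)]; with [I] the integral of [c],
   Jensen's inequality gives
     [|H f z| ^ p <= I ^ (p - 1) * int c(t) t ^ (- 2) |f (z / t)| ^ p dmu(t)],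
   and Tonelli with the dilation of the area measure gives [||H f|| <= I ||f||].
   Necessity and sharpness: for [f_e z = z ^ (- 2 / p) / (z ^ e + z ^ (- e))] the
   integrand, divided by [z ^ (- 2 / p)], has argument at most [e * pi], so that
     [|H f_e z| >= cos (e * pi) ^ 2 * |f_e z| * int c(t) exp (- e |ln t|) dmu(t)];
   let [e] tend to 0. *)
Require Import Defs.
From HB Require Import structures.
From mathcomp Require Import all_boot all_order all_algebra.
From mathcomp Require Import all_classical all_reals all_analysis.
From mathcomp Require Import measurable_realfun.
From mathcomp Require Import ring lra.

Import Order.TTheory GRing.Theory Num.Theory.
Import numFieldNormedType.Exports.
Import ComplexField.Normc.

Local Open Scope classical_set_scope.
Local Open Scope ring_scope.
Local Open Scope complex_scope.
Set Implicit Arguments.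
Unset Strict Implicit.
Unset Printing Implicit Defensive.

(** * Goursat's theorem for curl-free fields *)

(** Holomorphy here is bare complex differentiability, so the mean value inequality has to rest on
    Goursat's theorem, which assumes no continuity of the derivative. Only the imaginary part of a
    contour integral is ever used: a rotation makes the value at the centre a nonnegative real.
    Squares in place of circles keep every contour integral an integral over an interval. The weight
    [c] originates in the power z ^ (- 2 / p), formally an eigenfunction of the operator with
    eigenvalue [I]. It misses the Bergman space, since |z| ^ (- 2) is integrable neither at 0 nor at
    infinity; the factor 1 / (z ^ e + z ^ (- e)) cures both ends, and for e < 1 / 2 its denominator
    has no zero on the half plane. In the necessity part [I] is not known to be finite. Convergence
    of the operator's integral on the test functions first yields finiteness of the integrals damped
    by exp (- e |ln t|), and a monotone limit then bounds [I] by any admissible constant. *)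

Section segment_integral.
Context {R : realType}.
Notation leb := (@lebesgue_measure R).
Implicit Types (f g : R -> R) (a b m k M : R).

Definition sint a b f : R := Rintegral leb `[a, b] f.

(** Two-sided continuity even at the endpoints; [curlfree_at] provides it, since it speaks of full
    neighbourhoods. *)
Definition scont a b f := forall x, a <= x <= b -> {for x, continuous f}.

Lemma scont_sub a b a' b' f : a <= a' -> b' <= b -> scont a b f -> scont a' b' f.
Proof.
move=> aa bb h x /andP[h1 h2]; apply: h; rewrite (le_trans aa h1).
by rewrite (le_trans h2 bb).
Qed.

Lemma scontB a b f g : scont a b f -> scont a b g ->
  scont a b (fun x => f x - g x).
Proof. by move=> hf hg x xab; apply: continuousB; [exact: hf|exact: hg]. Qed.

Lemma scontD a b f g : scont a b f -> scont a b g ->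
  scont a b (fun x => f x + g x).
Proof. by move=> hf hg x xab; apply: continuousD; [exact: hf|exact: hg]. Qed.

Lemma scont_cst a b k : scont a b (fun=> k).
Proof. by move=> x _; exact: cst_continuous. Qed.

Lemma scont_integrable a b f : scont a b f ->
  leb.-integrable `[a, b] (EFin \o f).
Proof.
move=> cf; apply: continuous_compact_integrable; first exact: segment_compact.
apply: continuous_in_subspaceT => x.
by rewrite inE/= in_itv/= => xab; exact: cf.
Qed.

Lemma sintB a b f g : scont a b f -> scont a b g ->
  sint a b (fun x => f x - g x) = sint a b f - sint a b g.
Proof.
move=> cf cg; rewrite /sint RintegralB//; exact: scont_integrable.
Qed.

Lemma sintD a b f g : scont a b f -> scont a b g ->
  sint a b (fun x => f x + g x) = sint a b f + sint a b g.
Proof.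
move=> cf cg; rewrite /sint RintegralD//; exact: scont_integrable.
Qed.

Lemma sint_cst a b k : a <= b -> sint a b (fun=> k) = k * (b - a).
Proof.
move=> ab; rewrite /sint Rintegral_cst//= lebesgue_measure_itv/= lte_fin.
case: ltP => //= ba.
have -> : b = a by apply/eqP; rewrite eq_le ab ba.
by rewrite subrr.
Qed.

Lemma sint_split a b m f : a <= m -> m <= b -> scont a b f ->
  sint a b f = sint a m f + sint m b f.
Proof.
move=> am mb cf.
have := @Rintegral_itvB R f (BLeft a) (BRight b) m (scont_integrable cf).
rewrite !bnd_simp => /(_ am mb).
rewrite -/(sint a b f) -/(sint a m f) => /(canRL (subrK _)) ->.
rewrite addrC; congr (_ + _); rewrite /sint [RHS]/Rintegral.
rewrite -integral_itv_obnd_cbnd//.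
have := scont_integrable (scont_sub am (lexx b) cf).
move=> /measurable_int/=; apply: measurable_funS => //.
by apply: subset_itv; rewrite // bnd_simp.
Qed.

Lemma sint_le a b f g : scont a b f -> scont a b g ->
  (forall x, a <= x <= b -> f x <= g x) -> sint a b f <= sint a b g.
Proof.
move=> cf cg fg; apply: le_Rintegral; [by []|exact: scont_integrable|exact: scont_integrable|].
by move=> x /=; rewrite in_itv/=; exact: fg.
Qed.

Lemma sint_dist_cst a b f k M : a <= b -> scont a b f ->
  (forall x, a <= x <= b -> `|f x - k| <= M) ->
  `|sint a b f - k * (b - a)| <= M * (b - a).
Proof.
move=> ab cf fM.
have ck c := @scont_cst a b c.
have : sint a b (fun=> k - M) <= sint a b f.
  by apply: sint_le => // x /fM; rewrite ler_norml => /andP[]; lra.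
have : sint a b f <= sint a b (fun=> k + M).
  by apply: sint_le => // x /fM; rewrite ler_norml => /andP[]; lra.
rewrite !sint_cst// ler_norml mulrBl mulrDl => h1 h2.
by apply/andP; split; lra.
Qed.

End segment_integral.

Section goursat.
Context {R : realType}.
Implicit Types (P Q : R -> R -> R) (a b c d e x y : R).

(** Total differentiability of the field (P, Q) at one point, with Jacobian rows (p, m) and (m, q).
    The shared entry [m] is the curl condition dP/dy = dQ/dx; nothing is asked of the Jacobian at
    nearby points. *)
Definition curlfree_at P Q x0 y0 :=
  exists p m q : R, forall e : R, 0 < e -> exists2 dl : R, 0 < dl &
  forall x y, `|x - x0| < dl -> `|y - y0| < dl ->
  `|P x y - (P x0 y0 + p * (x - x0) + m * (y - y0))|
      <= e * (`|x - x0| + `|y - y0|) /\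
  `|Q x y - (Q x0 y0 + m * (x - x0) + q * (y - y0))|
      <= e * (`|x - x0| + `|y - y0|).

(** Counterclockwise integral of P dx + Q dy along the boundary of [a, b] x [c, d], opposite sides
    paired. *)
Definition circ P Q a b c d :=
  sint a b (fun x => P x c - P x d) + sint c d (fun y => Q b y - Q a y).

Lemma linear_approx_continuous (g : R -> R) (x0 k : R) :
  (forall e : R, 0 < e -> exists2 dl : R, 0 < dl & forall x, `|x - x0| < dl ->
    `|g x - (g x0 + k * (x - x0))| <= e * `|x - x0|) -> {for x0, continuous g}.
Proof.
move=> h; apply/cvgrPdist_lt => e e0.
have [dl dl0 hdl] := h 1 ltr01.
have k0 : 0 < 1 + `|k| by rewrite ltr_pwDl.
near=> x.
have xx : `|x - x0| < dl.
  by rewrite distrC; near: x; exact: cvgr_dist_lt.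
have xe : `|x - x0| < e / (1 + `|k|).
  rewrite distrC; near: x; apply: cvgr_dist_lt; first exact: cvg_id.
  exact: divr_gt0.
have := hdl _ xx; rewrite mul1r => hx.
rewrite distrC.
have -> : g x - g x0 = (g x - (g x0 + k * (x - x0))) + k * (x - x0) by ring.
rewrite (le_lt_trans (ler_normD _ _))// normrM.
rewrite (@le_lt_trans _ _ ((1 + `|k|) * `|x - x0|))//.
  by rewrite mulrDl mul1r lerD2r.
by rewrite mulrC -ltr_pdivlMr.
Unshelve. all: by end_near. Qed.

Lemma curlfree_contPx P Q x y : curlfree_at P Q x y ->
  {for x, continuous (fun x => P x y)}.
Proof.
move=> [p [m [q h]]]; apply: (@linear_approx_continuous _ _ p) => e /h[dl dl0 hd].
exists dl => // x' xx; have /= := hd x' y xx; rewrite !subrr normr0 => /(_ dl0)[].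
by rewrite mulr0 !addr0.
Qed.

Lemma curlfree_contQy P Q x y : curlfree_at P Q x y ->
  {for y, continuous (Q x)}.
Proof.
move=> [p [m [q h]]]; apply: (@linear_approx_continuous _ _ q) => e /h[dl dl0 hd].
exists dl => // x' xx; have /= := hd x x'; rewrite !subrr normr0 => /(_ dl0 xx)[_].
by rewrite mulr0 !addr0 !add0r.
Qed.

Definition curlfree P Q a b c d :=
  forall x y, a <= x <= b -> c <= y <= d -> curlfree_at P Q x y.

Lemma curlfree_sub P Q a b c d a' b' c' d' :
  a <= a' -> b' <= b -> c <= c' -> d' <= d ->
  curlfree P Q a b c d -> curlfree P Q a' b' c' d'.
Proof.
move=> aa bb cc dd h x y /andP[? ?] /andP[? ?]; apply: h.
  by apply/andP; split; lra.
by apply/andP; split; lra.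
Qed.

Lemma curlfree_scontP P Q a b c d y : curlfree P Q a b c d -> c <= y <= d ->
  scont a b (fun x => P x y).
Proof. by move=> h yb x xa; apply: curlfree_contPx (h _ _ xa yb). Qed.

Lemma curlfree_scontQ P Q a b c d x : curlfree P Q a b c d -> a <= x <= b ->
  scont c d (Q x).
Proof. by move=> h yb y xa; apply: curlfree_contQy (h _ _ yb xa). Qed.

Lemma circ_splitx P Q a m b c d : a <= m -> m <= b -> c <= d ->
  curlfree P Q a b c d ->
  circ P Q a b c d = circ P Q a m c d + circ P Q m b c d.
Proof.
move=> am mb cd h; rewrite /circ.
have hP y : c <= y <= d -> scont a b (fun x => P x y) by exact: curlfree_scontP h.
have hQ x : a <= x <= b -> scont c d (Q x) by exact: curlfree_scontQ h.
rewrite (sint_split am mb); last first.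
  by apply: scontB; apply: hP; rewrite lexx ?andbT.
have am' : a <= a <= b by rewrite lexx (le_trans am).
have mm' : a <= m <= b by rewrite am.
have bb' : a <= b <= b by rewrite lexx (le_trans am).
rewrite !sintB; do ?[exact: hQ]; do ?[ apply: scont_sub (hP _ _) => //; by rewrite lexx ?andbT].
lra.
Qed.

Lemma circ_splity P Q a b c m d : a <= b -> c <= m -> m <= d ->
  curlfree P Q a b c d ->
  circ P Q a b c d = circ P Q a b c m + circ P Q a b m d.
Proof.
move=> ab cm md h; rewrite /circ.
have hP y : c <= y <= d -> scont a b (fun x => P x y) by exact: curlfree_scontP h.
have hQ x : a <= x <= b -> scont c d (Q x) by exact: curlfree_scontQ h.
rewrite [X in _ + X = _](sint_split cm md); last first.
  by apply: scontB; apply: hQ; rewrite lexx ?andbT.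
have am' : c <= c <= d by rewrite lexx (le_trans cm).
have mm' : c <= m <= d by rewrite cm.
have bb' : c <= d <= d by rewrite lexx (le_trans cm).
rewrite !sintB; do ?[exact: hP]; do ?[ apply: scont_sub (hQ _ _) => //; by rewrite lexx ?andbT].
lra.
Qed.

(** The affine part of the field contributes m (c - d) (b - a) on the horizontal sides and m (b - a)
    (d - c) on the vertical ones, which cancel because the Jacobian is symmetric. Only the error of
    the affine approximation survives: it is proportional to half the perimeter and is integrated
    over half the perimeter. *)
Lemma circ_small P Q x0 y0 : curlfree_at P Q x0 y0 ->
  forall e : R, 0 < e -> exists2 dl : R, 0 < dl & forall a b c d,
  a <= x0 <= b -> c <= y0 <= d -> b - a < dl -> d - c < dl ->
  curlfree P Q a b c d ->
  `|circ P Q a b c d| <= e * ((b - a) + (d - c)) ^+ 2.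
Proof.
move=> [p [m [q h]]] e e0.
(* Opposite sides are subtracted, so the approximation error enters twice. *)
have [|dl dl0 hdl] := h (e / 2); first by rewrite divr_gt0.
exists dl => // a b c d /andP[ax xb] /andP[cy yd] ba dc hc.
have ab : a <= b by lra.
have cd : c <= d by lra.
have near1 x y : a <= x <= b -> c <= y <= d ->
    [/\ `|x - x0| <= b - a, `|y - y0| <= d - c, `|x - x0| < dl & `|y - y0| < dl].
  move=> /andP[? ?] /andP[? ?].
  have h1 : `|x - x0| <= b - a by rewrite ler_distlC; apply/andP; split; lra.
  have h2 : `|y - y0| <= d - c by rewrite ler_distlC; apply/andP; split; lra.
  by split=> //; [exact: le_lt_trans h1 ba|exact: le_lt_trans h2 dc].
set s := (b - a) + (d - c).
have est x y : a <= x <= b -> c <= y <= d ->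
  `|P x y - (P x0 y0 + p * (x - x0) + m * (y - y0))| <= e / 2 * s /\
  `|Q x y - (Q x0 y0 + m * (x - x0) + q * (y - y0))| <= e / 2 * s.
  move=> hx hy; have [h1 h2 h3 h4] := near1 _ _ hx hy.
  have [hP hQ] := hdl _ _ h3 h4.
  have hs : e / 2 * (`|x - x0| + `|y - y0|) <= e / 2 * s.
    by rewrite ler_pM2l ?divr_gt0// lerD.
  by split; apply: le_trans hs.
have cc : c <= c <= d by rewrite lexx.
have dd : c <= d <= d by rewrite lexx cd.
have aa : a <= a <= b by rewrite lexx.
have bb : a <= b <= b by rewrite lexx ab.
have I1 : `|sint a b (fun x => P x c - P x d) - (m * (c - d)) * (b - a)|
    <= (e * s) * (b - a).
  apply: sint_dist_cst => //.
    by apply: scontB; [exact: curlfree_scontP hc cc | exact: curlfree_scontP hc dd].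
  move=> x hx.
  have [+ _] := est x c hx cc; have [+ _] := est x d hx dd.
  move=> E2 E1; have -> : P x c - P x d - m * (c - d) =
    (P x c - (P x0 y0 + p * (x - x0) + m * (c - y0))) -
    (P x d - (P x0 y0 + p * (x - x0) + m * (d - y0))) by ring.
  by rewrite (le_trans (ler_normB _ _))// (le_trans (lerD E1 E2))// -mulrDl -splitr.
have I2 : `|sint c d (fun y => Q b y - Q a y) - (m * (b - a)) * (d - c)|
    <= (e * s) * (d - c).
  apply: sint_dist_cst => //.
    by apply: scontB; [exact: curlfree_scontQ hc bb | exact: curlfree_scontQ hc aa].
  move=> y hy.
  have [_ +] := est b y bb hy; have [_ +] := est a y aa hy.
  move=> E2 E1; have -> : Q b y - Q a y - m * (b - a) =
    (Q b y - (Q x0 y0 + m * (b - x0) + q * (y - y0))) -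
    (Q a y - (Q x0 y0 + m * (a - x0) + q * (y - y0))) by ring.
  by rewrite (le_trans (ler_normB _ _))// (le_trans (lerD E1 E2))// -mulrDl -splitr.
have -> : circ P Q a b c d =
   (sint a b (fun x => P x c - P x d) - (m * (c - d)) * (b - a)) +
   (sint c d (fun y => Q b y - Q a y) - (m * (b - a)) * (d - c)).
  by rewrite /circ; ring.
rewrite (le_trans (ler_normD _ _))// (le_trans (lerD I1 I2))//.
by rewrite -mulrDr -/s -mulrA expr2.
Qed.

Lemma circ_quarter P Q (x1 x2 y1 y2 K : R) : x1 <= x2 -> y1 <= y2 ->
  curlfree P Q x1 x2 y1 y2 -> K <= `|circ P Q x1 x2 y1 y2| ->
  exists x1' x2' y1' y2', [/\ x1 <= x1' /\ x2' <= x2, y1 <= y1' /\ y2' <= y2,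
    x2' - x1' = (x2 - x1) / 2 /\ y2' - y1' = (y2 - y1) / 2 &
    K / 4 <= `|circ P Q x1' x2' y1' y2'|].
Proof.
move=> x12 y12 hc1 hK.
have [hx1 hx2] := midf_le x12; have [hy1 hy2] := midf_le y12.
set mx := (x1 + x2) / 2 in hx1 hx2 *; set my := (y1 + y2) / 2 in hy1 hy2 *.
have e1 : mx - x1 = (x2 - x1) / 2 by rewrite /mx; field.
have e2 : x2 - mx = (x2 - x1) / 2 by rewrite /mx; field.
have e3 : my - y1 = (y2 - y1) / 2 by rewrite /my; field.
have e4 : y2 - my = (y2 - y1) / 2 by rewrite /my; field.
have E : circ P Q x1 x2 y1 y2 =
   circ P Q x1 mx y1 my + circ P Q x1 mx my y2 +
   (circ P Q mx x2 y1 my + circ P Q mx x2 my y2).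
  rewrite (@circ_splitx _ _ x1 mx x2)//; congr (_ + _); apply: circ_splity => //.
    exact: curlfree_sub hc1.
  exact: curlfree_sub hc1.
have [|H1] := leP (K / 4) `|circ P Q x1 mx y1 my|.
  by exists x1, mx, y1, my; split.
have [|H2] := leP (K / 4) `|circ P Q x1 mx my y2|.
  by exists x1, mx, my, y2; split.
have [|H3] := leP (K / 4) `|circ P Q mx x2 y1 my|.
  by exists mx, x2, y1, my; split.
have [|H4] := leP (K / 4) `|circ P Q mx x2 my y2|.
  by exists mx, x2, my, y2; split.
exfalso; move: hK; rewrite leNgt => /negP; apply; rewrite E.
rewrite (le_lt_trans (ler_normD _ _))//.
have -> : K = (K / 4 + K / 4) + (K / 4 + K / 4) by field.
by apply: ltrD; rewrite (le_lt_trans (ler_normD _ _))// ltrD.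
Qed.

Lemma nested_point (U V : nat -> R) : {homo U : m n / (m <= n)%N >-> m <= n} ->
  {homo V : m n / (m <= n)%N >-> n <= m} -> (forall n, U n <= V n) ->
  exists z, forall n, U n <= z <= V n.
Proof.
move=> hU hV hw.
have UV m n : U m <= V n.
  rewrite (le_trans (hU _ _ (leq_maxl m n)))// (le_trans (hw _))//.
  exact: (hV _ _ (leq_maxr m n)).
have hs : has_sup [set U n | n in setT].
  by split; [exists (U 0%N); exists 0%N | exists (V 0%N) => _ [n _ <-]].
exists (sup [set U n | n in setT]) => n; apply/andP; split.
  by apply: ub_le_sup; [case: hs|exists n].
by apply: ge_sup; [case: hs| move=> _ [m _ <-]].
Qed.

(* Bisection: one quarter always carries at least a quarter of the
   circulation, while a point of differentiability makes it [o(size ^ 2)]. *)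
Lemma goursat P Q a b c d : a <= b -> c <= d -> curlfree P Q a b c d ->
  circ P Q a b c d = 0.
Proof.
move=> ab cd hcf; apply/eqP; rewrite -normr_le0 leNgt; apply/negP => J0.
set J := `|circ P Q a b c d| in J0.
pose inv (n : nat) (x1 x2 y1 y2 : R) :=
  [/\ a <= x1 /\ x2 <= b, c <= y1 /\ y2 <= d,
   x2 - x1 = (b - a) / 2 ^+ n /\ y2 - y1 = (d - c) / 2 ^+ n &
   J / 4 ^+ n <= `|circ P Q x1 x2 y1 y2|].
have step n x1 x2 y1 y2 : inv n x1 x2 y1 y2 ->
    exists x1' x2' y1' y2', inv n.+1 x1' x2' y1' y2' /\
      [/\ x1 <= x1', x2' <= x2, y1 <= y1' & y2' <= y2].
  move=> [[h1 h2] [h3 h4] [h5 h6] h7].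
  have x12 : x1 <= x2 by rewrite -subr_ge0 h5 divr_ge0// subr_ge0.
  have y12 : y1 <= y2 by rewrite -subr_ge0 h6 divr_ge0// subr_ge0.
  have hc1 : curlfree P Q x1 x2 y1 y2 by exact: curlfree_sub hcf.
  have [x1' [x2' [y1' [y2' [[k1 k2] [k3 k4] [k5 k6] k7]]]]] :=
    circ_quarter x12 y12 hc1 h7.
  exists x1', x2', y1', y2'; split=> //; split; rewrite ?k5 ?k6 ?h5 ?h6.
  - by rewrite (le_trans h1)// (le_trans k2).
  - by rewrite (le_trans h3)// (le_trans k4).
  - by rewrite exprSr invfM !mulrA.
  - by rewrite exprSr invfM mulrA.
have /choice[F hF] : forall nt : nat * (R * R * R * R), exists t',
    let: (n, (x1, x2, y1, y2)) := nt in let: (x1', x2', y1', y2') := t' in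
    inv n x1 x2 y1 y2 -> inv n.+1 x1' x2' y1' y2' /\
      [/\ x1 <= x1', x2' <= x2, y1 <= y1' & y2' <= y2].
  move=> [n [[[x1 x2] y1] y2]].
  have [/step[x1' [x2' [y1' [y2' h]]]]|nt] := pselect (inv n x1 x2 y1 y2).
    by exists (x1', x2', y1', y2').
  (* Default for tuples outside the invariant; the iteration never meets them. *)
  by exists (0, 0, 0, 0).
pose T := fix T n := if n is m.+1 then F (m, T m) else (a, b, c, d).
pose X1 n := (T n).1.1.1; pose X2 n := (T n).1.1.2.
pose Y1 n := (T n).1.2; pose Y2 n := (T n).2.
have Tnext n : inv n (X1 n) (X2 n) (Y1 n) (Y2 n) ->
    inv n.+1 (X1 n.+1) (X2 n.+1) (Y1 n.+1) (Y2 n.+1) /\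
    [/\ X1 n <= X1 n.+1, X2 n.+1 <= X2 n, Y1 n <= Y1 n.+1 & Y2 n.+1 <= Y2 n].
  have := hF (n, T n); rewrite /X1 /X2 /Y1 /Y2 /=.
  by case: (T n) (F _) => [[[? ?] ?] ?] [[[? ?] ?] ?].
have Tinv n : inv n (X1 n) (X2 n) (Y1 n) (Y2 n).
  elim: n => [|n /Tnext[]//]; split; rewrite ?expr0 ?divr1//.
have Tsub n := (Tnext n (Tinv n)).2.
have n2 n : 0 < (2 : R) ^+ n by rewrite exprn_gt0.
have X12 n : X1 n <= X2 n.
  by have [_ _ [+ _] _] := Tinv n; rewrite -subr_ge0 => ->; rewrite divr_ge0// ?subr_ge0// ltW.
have Y12 n : Y1 n <= Y2 n.
  by have [_ _ [_ +] _] := Tinv n; rewrite -subr_ge0 => ->; rewrite divr_ge0// ?subr_ge0// ltW.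
have le_tr' : forall y x z : R, y <= x -> z <= y -> z <= x by move=> y x z h1 h2; exact: le_trans h2 h1.
have [x0 hx0] : exists z, forall n, X1 n <= z <= X2 n.
  apply: nested_point => //.
    by apply: homo_leq => [x|x y z|n]; [exact: lexx|exact: le_trans|case: (Tsub n)].
  by apply: homo_leq => [x|x y z|n]; [exact: lexx|exact: le_tr'|case: (Tsub n)].
have [y0 hy0] : exists z, forall n, Y1 n <= z <= Y2 n.
  apply: nested_point => //.
    by apply: homo_leq => [x|x y z|n]; [exact: lexx|exact: le_trans|case: (Tsub n)].
  by apply: homo_leq => [x|x y z|n]; [exact: lexx|exact: le_tr'|case: (Tsub n)].
set s := (b - a) + (d - c).
have s0 : 0 <= s by rewrite addr_ge0 ?subr_ge0.
have s1 : 0 < s + 1 by rewrite ltr_wpDl.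
have cf0 : curlfree_at P Q x0 y0 by exact: hcf (hx0 0%N) (hy0 0%N).
(* This gives e s ^ 2 <= J / 2 < J; the summand 1 keeps the denominator positive for a degenerate
   rectangle. *)
pose e := J / (2 * (s + 1) ^+ 2).
have e0 : 0 < e by rewrite divr_gt0// mulr_gt0// exprn_gt0.
have [dl dl0 hdl] := circ_small cf0 e0.
have [n hn] : exists n : nat, s / 2 ^+ n < dl.
  exists (Num.bound (s / dl)); rewrite ltr_pdivrMr// mulrC -ltr_pdivrMr//.
  rewrite (@lt_trans _ _ (Num.bound (s / dl))%:R)//.
    by apply: le_lt_trans (archi_boundP _); rewrite ?divr_ge0// ltW.
  by rewrite -natrX ltr_nat ltn_expl.
have [[k1 k2] [k3 k4] [w1 w2] hJ] := Tinv n.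
have hle : `|circ P Q (X1 n) (X2 n) (Y1 n) (Y2 n)| <=
   e * ((X2 n - X1 n) + (Y2 n - Y1 n)) ^+ 2.
  apply: hdl => //.
  - by rewrite w1 (le_lt_trans _ hn)// ler_pM2r ?invr_gt0// lerDl subr_ge0.
  - by rewrite w2 (le_lt_trans _ hn)// ler_pM2r ?invr_gt0// lerDr subr_ge0.
  - exact: curlfree_sub hcf.
move: (le_trans hJ hle); rewrite w1 w2 -mulrDl -/s expr_div_n -exprM mulnC exprM.
have -> : (2 : R) ^+ 2 = 4 by rewrite expr2 -natrM.
rewrite mulrA ler_pM2r ?invr_gt0 ?exprn_gt0// leNgt => /negP; apply.
rewrite /e mulrAC ltr_pdivrMr ?mulr_gt0 ?exprn_gt0//.
rewrite ltr_pM2l// (@le_lt_trans _ _ ((s + 1) ^+ 2))//.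
  by rewrite lerXn2r ?nnegrE ?lerDl// ltW.
by rewrite ltr_pMl ?exprn_gt0// ltr1n.
Qed.

End goursat.

(** * Complex derivatives and the mean value inequality *)

Section cdiff.
Context {R : realType}.
Implicit Types (f g : R[i] -> R[i]) (z w l : R[i]).
Notation normc := (@normc R).

Lemma norm_normc z : `|z| = (normc z)%:C. Proof. by []. Qed.

Lemma normc_ge0 z : 0 <= normc z.
Proof. by case: z => a b; rewrite /= sqrtr_ge0. Qed.

Lemma normcB z w : normc (z - w) = normc (w - z).
Proof. by rewrite -(@normcN R (z - w)) opprB. Qed.

Lemma normc_gt0 z : (0 < normc z) = (z != 0).
Proof.
rewrite lt_def normc_ge0 andbT; congr (~~ _).
by apply/eqP/eqP => [/eq0_normc|->]; rewrite ?normc0.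
Qed.

Lemma normc_real (r : R) : normc r%:C = `|r|.
Proof. by rewrite /= expr0n/= addr0 sqrtr_sqr. Qed.

Lemma ler_Re_normc z : `|complex.Re z| <= normc z.
Proof. by have := normc_ge_Re z; rewrite norm_normc lecR. Qed.

Lemma ler_Im_normc z : `|complex.Im z| <= normc z.
Proof.
have := ler_Re_normc (z * 'i); rewrite ReiNIm normrN normcM.
by rewrite [normc 'i]/= expr0n expr1n/= add0r sqrtr1 mulr1.
Qed.

Lemma normc_le_ReIm z : normc z <= `|complex.Re z| + `|complex.Im z|.
Proof.
case: z => a b /=; rewrite -[leRHS]ger0_norm ?addr_ge0// -sqrtr_sqr ler_wsqrtr//.
by rewrite sqrrD !real_normK ?num_real// lerD2r lerDl mulrn_wge0 ?mulr_ge0.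
Qed.

(** Quotient-free complex derivative: all quantities are real, h = 0 is harmless, and each estimate
    compares moduli. *)
Definition cdiff f z l := forall e : R, 0 < e -> exists2 d : R, 0 < d &
  forall h, normc h < d -> normc (f (z + h) - f z - l * h) <= e * normc h.

Lemma derivable_cdiff f z :
  derivable (f : R[i]^o -> R[i]^o) z 1 -> exists l, cdiff f z l.
Proof.
move=> /cvg_ex[/= l hl]; exists l => e e0.
have ec0 : 0 < e%:C by rewrite ltcR.
have : \forall h \near (0 : R[i]^o)^', `|l - h^-1 *: (f (h%:A + z) - f z)| <= e%:C.
  exact: (@cvgrPdist_le _ _ _ _ _ _ _).1 hl _ ec0.
rewrite near_withinE => /nbhs_ballP[/= d d0 hd].
have := d0; rewrite ltcE/= => /andP[/eqP dI dR].
exists (complex.Re d) => // h hh.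
have [->|h0] := eqVneq h 0.
  by rewrite addr0 subrr mulr0 subrr normc0 mulr0.
have := hd h; rewrite /ball/= sub0r normrN norm_normc.
have dE : d = (complex.Re d)%:C by case: (d) dI => ? ? /= ->.
rewrite {1}dE ltcR => /(_ hh h0).
rewrite norm_normc lecR => H.
have -> : f (z + h) - f z - l * h = - h * (l - h^-1 *: (f (h *: 1 + z) - f z)).
  rewrite /GRing.scale/= mulr1 (addrC h z).
  by field.
by rewrite normcM normcN mulrC ler_wpM2r ?normc_ge0.
Qed.

Lemma cdiff_derivable f z l :
  cdiff f z l -> derivable (f : R[i]^o -> R[i]^o) z 1.
Proof.
move=> hf; apply/cvg_ex; exists l => /=.
apply/cvgrPdist_le => /= e e0.
have := e0; rewrite ltcE/= => /andP[/eqP eI eR].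
have eE : e = (complex.Re e)%:C by case: (e) eI => ? ? /= ->.
have [d d0 hd] := hf _ eR.
apply/nbhs_ballP; exists d%:C; first by rewrite /= ltcR.
move=> h; rewrite /ball/= sub0r normrN norm_normc ltcR => hh h0.
rewrite norm_normc eE lecR.
have hp : 0 < normc h by rewrite normc_gt0.
rewrite -(ler_pM2r hp) (le_trans _ (hd _ hh))//.
rewrite -normcM -(@normcN R) /GRing.scale/= mulr1 (addrC h z).
by have -> : - ((l - h^-1 * (f (z + h) - f z)) * h) = f (z + h) - f z - l * h by field.
Qed.

Lemma cdiff_cont f z l : cdiff f z l -> forall e : R, 0 < e -> exists2 d : R, 0 < d &
  forall h, normc h < d -> normc (f (z + h) - f z) < e.
Proof.
move=> hf e e0; have [d d0 hd] := hf 1 ltr01.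
have l0 : 0 < 1 + normc l by rewrite ltr_pwDl// normc_ge0.
exists (Num.min d (e / (1 + normc l))); first by rewrite lt_min d0 divr_gt0.
move=> h; rewrite lt_min ltr_pdivlMr// => /andP[/hd + he].
rewrite mul1r => hh.
have -> : f (z + h) - f z = (f (z + h) - f z - l * h) + l * h by ring.
rewrite (le_lt_trans (le_normcD _ _))// normcM (le_lt_trans _ he)//.
by rewrite mulrDr mulr1 lerD// mulrC.
Qed.

End cdiff.

Section center.
Context {R : realType}.
Implicit Types (f g F : R[i] -> R[i]) (z w l : R[i]) (r : R).
Notation normc := (@normc R).

(** Cauchy-Riemann: if [l] has parts al and be, the increment of Im f is be dx + al dy and that of
    Re f is al dx - be dy, so the mixed entries agree. The form P dx + Q dy is Im (f dz). *)
Lemma cdiff_curlfree f x y l : cdiff f (x +i* y) l ->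
  curlfree_at (fun x y => complex.Im (f (x +i* y))) (fun x y => complex.Re (f (x +i* y))) x y.
Proof.
move=> hf; case: l hf => al be hf; exists be, al, (- be) => e e0.
have [d d0 hd] := hf _ e0.
exists (d / 2); first by rewrite divr_gt0.
move=> x' y' hx hy.
have hn : normc ((x' - x) +i* (y' - y)) <= `|x' - x| + `|y' - y| by exact: normc_le_ReIm.
have /hd : normc ((x' - x) +i* (y' - y)) < d by rewrite (le_lt_trans hn)//; lra.
have -> : x +i* y + ((x' - x) +i* (y' - y)) = x' +i* y'.
  by apply/eqP; rewrite eq_complex/= !subrKC !eqxx.
move=> H; have {H hn}H := le_trans H (ler_wpM2l (ltW e0) hn).
move: (f (x' +i* y')) (f (x +i* y)) H => [a b] [a' b'] H /=.
split.
  apply: le_trans H; apply: le_trans (ler_Im_normc _); rewrite /=.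
  by rewrite le_eqVlt; apply/orP; left; apply/eqP; congr (`| _ |); ring.
apply: le_trans H; apply: le_trans (ler_Re_normc _); rewrite /=.
by rewrite le_eqVlt; apply/orP; left; apply/eqP; congr (`| _ |); ring.
Qed.

Definition ccirc f a b c d :=
  circ (fun x y => complex.Im (f (x +i* y))) (fun x y => complex.Re (f (x +i* y))) a b c d.

Definition in_square r z := `|complex.Re z| <= r /\ `|complex.Im z| <= r.

(** The region between the squares splits into full-width strips below and above and two blocks left
    and right. None of the four rectangles contains 0, so Goursat applies to each, and the shared
    sides cancel in the sum. *)
Lemma ccirc_annulus f (d r : R) : 0 < d <= r ->
  (forall z, in_square r z -> z != 0 -> exists l, cdiff f z l) ->
  ccirc f (- r) r (- r) r = ccirc f (- d) d (- d) d.
Proof.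
move=> /andP[d0 dr] hf.
pose P := (fun x y => complex.Im (f (x +i* y))); pose Q := (fun x y => complex.Re (f (x +i* y))).
have cf (x y : R) : - r <= x <= r -> - r <= y <= r -> (x != 0) || (y != 0) -> curlfree_at P Q x y.
  move=> hx hy h; have [||l hl] := hf (x +i* y).
  - by split; rewrite /= ler_norml.
  - by rewrite eq_complex/= negb_and.
  - exact: cdiff_curlfree hl.
have J1 : circ P Q (- r) r (- r) (- d) = 0.
  apply: goursat => [||x y hx hy]; [lra|lra|].
  by apply: cf; [lra|lra|apply/orP; right; rewrite lt_eqF//; lra].
have J2 : circ P Q (- r) r d r = 0.
  apply: goursat => [||x y hx hy]; [lra|lra|].
  by apply: cf; [lra|lra|apply/orP; right; rewrite gt_eqF//; lra].
have J3 : circ P Q (- r) (- d) (- d) d = 0.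
  apply: goursat => [||x y hx hy]; [lra|lra|].
  by apply: cf; [lra|lra|apply/orP; left; rewrite lt_eqF//; lra].
have J4 : circ P Q d r (- d) d = 0.
  apply: goursat => [||x y hx hy]; [lra|lra|].
  by apply: cf; [lra|lra|apply/orP; left; rewrite gt_eqF//; lra].
have sx y : - r <= y <= r -> y != 0 -> scont (- r) r (fun x => P x y).
  move=> hy y0 x hx; apply: (@curlfree_contPx _ P Q); apply: cf => //.
  by rewrite y0 orbT.
have sy x : - r <= x <= r -> x != 0 -> scont (- r) r (Q x).
  move=> hx x0 y hy; apply: (@curlfree_contQy _ P Q); apply: cf => //.
  by rewrite x0.
have rr : - r <= - d by lra.
have ? : - d <= d by lra.
have ? : - r <= r by lra.
have ? : - d <= r by lra.
have SP y : - r <= y <= r -> y != 0 -> sint (-r) r (fun x => P x y) =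
  sint (-r) (-d) (fun x => P x y) + sint (-d) d (fun x => P x y) + sint d r (fun x => P x y).
  move=> hy y0; rewrite (@sint_split _ (-r) r (-d) _ rr)//; last exact: (sx y hy y0).
  rewrite (@sint_split _ (-d) r d) ?addrA//; apply: scont_sub (sx y hy y0) => //.
have SQ x : - r <= x <= r -> x != 0 -> sint (-r) r (Q x) =
  sint (-r) (-d) (Q x) + sint (-d) d (Q x) + sint d r (Q x).
  move=> hy y0; rewrite (@sint_split _ (-r) r (-d) _ rr)//; last exact: (sy x hy y0).
  rewrite (@sint_split _ (-d) r d) ?addrA//; apply: scont_sub (sy x hy y0) => //.
have B1 a b u v : - r <= a -> b <= r -> - r <= u <= r -> u != 0 -> - r <= v <= r -> v != 0 ->
   sint a b (fun x => P x u - P x v) = sint a b (fun x => P x u) - sint a b (fun x => P x v).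
  by move=> ha hb hu u0 hv v0; rewrite sintB//; apply: scont_sub (sx _ _ _).
have B2 a b u v : - r <= a -> b <= r -> - r <= u <= r -> u != 0 -> - r <= v <= r -> v != 0 ->
   sint a b (fun y => Q u y - Q v y) = sint a b (Q u) - sint a b (Q v).
  by move=> ha hb hu u0 hv v0; rewrite sintB//; apply: scont_sub (sy _ _ _).
have d00 : d != 0 by rewrite gt_eqF.
have Nd0 : - d != 0 by rewrite oppr_eq0.
have r00 : r != 0 by rewrite gt_eqF// (lt_le_trans d0).
have Nr0 : - r != 0 by rewrite oppr_eq0.
have i1 : - r <= d <= r by lra.
have i2 : - r <= - d <= r by lra.
have i3 : - r <= r <= r by lra.
have i4 : - r <= - r <= r by lra.
have ? : d <= r by [].
have ? : - r <= d by lra.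
have ? : - r <= - r by [].
rewrite /ccirc -/P -/Q; move: J1 J2 J3 J4; rewrite /circ.
rewrite !B1// !B2//.
rewrite (SP (- r))// (SP r)// (SP (- d))// (SP d)// (SQ (- r))// (SQ r)//.
clear; lra.
Qed.

End center.

Section center.
Context {R : realType}.
Implicit Types (f g F : R[i] -> R[i]) (z w l : R[i]) (r : R).
Notation normc := (@normc R).

Definition cderivable f z := derivable (f : R[i]^o -> R[i]^o) z 1.

Lemma cderivable_cont f x y : cderivable f (x +i* y) ->
  {for x, continuous (fun t => normc (f (t +i* y)))} /\
  {for y, continuous (fun t => normc (f (x +i* t)))}.
Proof.
move=> /derivable_cdiff[l /cdiff_cont hl].
have H (g : R -> R[i]) (t0 : R) : (forall t, g t0 = x +i* y /\ normc (g t - g t0) = `|t - t0|) ->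
    {for t0, continuous (fun t => normc (f (g t)))}.
  move=> hg; apply/cvgrPdist_lt => e e0.
  have [d d0 hd] := hl _ e0; near=> t.
  have [g0 gt] := hg t.
  rewrite (@le_lt_trans _ _ (normc (f (g t) - f (g t0))))//.
    rewrite distrC ler_norml lerBrDr lerBlDr; apply/andP; split.
      rewrite addrC -[leRHS]opprK lerNr opprD !opprK.
      rewrite (_ : - _ + _ = - (normc (f (g t0)) - normc (f (g t) - f (g t0)))); last by ring.
      rewrite lerN2 lerBlDr normcB.
      by rewrite (le_trans _ (le_normcD _ _))// addrC subrK.
    by rewrite (le_trans _ (le_normcD _ _))// subrK.
  rewrite g0.
  have -> : g t = (x +i* y) + (g t - g t0) by rewrite g0 addrC subrK.
  apply: hd; rewrite gt distrC; near: t; apply: cvgr_dist_lt => //; exact: cvg_id.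
have ab (a b c d : R) : (a +i* b) - (c +i* d) = (a - c) +i* (b - d) by [].
split; apply: H => t; split=> //; rewrite ab subrr.
  by rewrite /= expr0n/= addr0 sqrtr_sqr.
by rewrite /= expr0n/= add0r sqrtr_sqr.
Unshelve. all: by end_near. Qed.

(** Moduli of [F] at the points with parameter [x] on the four sides of the square of half-side [r];
    integrated over [- r, r] they give the boundary integral with respect to arc length. *)
Definition sidesum F r x : R :=
  (normc (F (x +i* (- r))) + normc (F (x +i* r))) +
  (normc (F (r +i* x)) + normc (F ((- r) +i* x))).

(** A d / (t ^ 2 + d ^ 2) is the normal part of A / z on a side at distance [d] from 0; |t| <= d on
    that side bounds the denominator by 2 d ^ 2. *)
Lemma ler_inv_side (A d t : R) : 0 <= A -> 0 < d -> `|t| <= d ->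
  A / 2 / d <= A * (d / (t ^+ 2 + d ^+ 2)).
Proof.
move=> A0 d0 td; rewrite -mulrA ler_wpM2l//.
have d20 : 0 < d ^+ 2 by rewrite exprn_gt0.
have t2 : t ^+ 2 <= d ^+ 2 by rewrite -(real_normK (num_real t)) lerXn2r ?nnegrE// ltW.
have td0 : 0 < t ^+ 2 + d ^+ 2 by rewrite ltr_wpDl// sqr_ge0.
rewrite ler_pdivlMr// -invfM mulrC ler_pdivrMr ?mulr_gt0//.
by rewrite mulrCA -expr2 mulr_natl mulr2n lerD2r.
Qed.

(** The sign [s] selects one side of each opposite pair. The main term A / z is handled by
    [ler_inv_side]; the perturbation [e] costs at most eta / d, as |z| >= d on the boundary. *)
Lemma side_lower (A eta d t s : R) (e : R[i]) : 0 <= A -> 0 < d ->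
  `|t| <= d -> s ^+ 2 = 1 -> normc e <= eta ->
  (A / 2 - eta) / d <= - s * complex.Im ((A%:C + e) / (t +i* (s * d))) /\
  (A / 2 - eta) / d <= s * complex.Re ((A%:C + e) / ((s * d) +i* t)).
Proof.
move=> A0 d0 td s2 he.
have s1 : `|s| = 1.
  by apply/eqP; rewrite -(@eqrXn2 _ 2)// ?normr_ge0 ?real_normK ?num_real// expr1n s2.
have sd : `|s * d| = d by rewrite normrM s1 mul1r gtr0_norm.
have GE x y : (A%:C + e) / (x +i* y) =
    (A * (x / (x ^+ 2 + y ^+ 2))) +i* (- (A * (y / (x ^+ 2 + y ^+ 2)))) + e / (x +i* y).
  rewrite mulrDl; congr (_ + _).
  by apply/eqP; rewrite eq_complex/= !mul0r subr0 addr0 mulrN !eqxx.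
have ez z : d <= normc z -> normc (e / z) <= eta / d.
  move=> h; rewrite normcM normcV ler_pM ?normc_ge0 ?invr_ge0 ?normc_ge0//.
  by rewrite lef_pV2// posrE// (lt_le_trans d0).
have sK k : s * (A * (s * d * k)) = A * (d * k).
  by rewrite -[RHS]mul1r -s2; ring.
rewrite !GE exprMn s2 mul1r; split.
  have : normc (e / (t +i* (s * d))) <= eta / d.
    by apply: ez; rewrite -[leLHS]sd; exact: (ler_Im_normc (t +i* (s * d))).
  have := ler_Im_normc (e / (t +i* (s * d))).
  case: (e / _) => a b /= hb hn.
  rewrite mulNr mulrDr mulrN opprD opprK mulrBl sK.
  apply: lerD; first exact: ler_inv_side.
  by rewrite lerN2 (le_trans (ler_norm _))// normrM s1 mul1r (le_trans hb).
have : normc (e / ((s * d) +i* t)) <= eta / d.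
  by apply: ez; rewrite -[leLHS]sd; exact: (ler_Re_normc ((s * d) +i* t)).
have := ler_Re_normc (e / ((s * d) +i* t)).
case: (e / _) => a b /= hb hn.
rewrite mulrDr mulrBl sK (addrC (d ^+ 2)).
apply: lerD; first exact: ler_inv_side.
by rewrite lerNl (le_trans (ler_norm _))// normrN normrM s1 mul1r (le_trans hb).
Qed.

(** Turns the modulus of an integral or of an increment into a real part, so that real-valued
    estimates apply. *)
Lemma unit_rot (A0 : R[i]) : exists2 u, normc u = 1 & u * A0 = (normc A0)%:C.
Proof.
have [->|A0n] := eqVneq A0 0; first by exists 1; rewrite ?normc1// normc0 mulr0.
exists ((normc A0)%:C / A0); last by rewrite divfK.
by rewrite normcM normcV normc_real ger0_norm ?normc_ge0// divff// gt_eqF// normc_gt0.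
Qed.

(* A Cauchy formula at the centre: [ccirc (F / z)] is the imaginary part of
   the integral of [F z dz / z], the same for all squares around the centre, and
   for small squares at least [4 * |A0|]. *)
Lemma center_bound F (A0 : R[i]) r : 0 < r ->
  (forall z, in_square r z -> z != 0 -> cderivable F z) ->
  (forall e : R, 0 < e -> exists2 d : R, 0 < d &
     forall z, normc z < d -> z != 0 -> normc (F z - A0) <= e) ->
  4 * r * normc A0 <= sint (- r) r (sidesum F r).
Proof.
move=> r0 hF hA.
have [u u1 uA] := unit_rot A0.
set A := normc A0 in uA *.
(* Near 0 this is close to A / z, whose circulation is exactly 2 pi A; the weaker constant 4 needs
   no evaluation of that integral. *)
pose G z := u * F z * z^-1.
have dG z : in_square r z -> z != 0 -> cderivable G z.
  move=> zr z0; apply: (@derivableM R[i] R[i]^o (fun z => u * F z) (fun z => z^-1) z 1).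
    by apply: (@derivableM R[i] R[i]^o (fun=> u) F z 1); [exact: derivable_cst|exact: hF].
  by apply: derivableV => //; exact: derivable_id.
have cG z : in_square r z -> z != 0 -> exists l, cdiff G z l.
  by move=> zr z0; apply: derivable_cdiff; exact: dG.
have n1 (a b : R) : a != 0 -> a +i* b != 0 by move=> h; rewrite eq_complex/= negb_and h.
have n2 (a b : R) : b != 0 -> a +i* b != 0 by move=> h; rewrite eq_complex/= negb_and h orbT.
have Nr : - r <= r by rewrite ge0_cp// ltW.
have ab (d x : R) : - d <= x <= d -> `|x| <= d by rewrite ler_norml.
have nr (d : R) : 0 < d -> `|d| = d by move=> ?; rewrite gtr0_norm.
have nNr (d : R) : 0 < d -> `|- d| = d by move=> ?; rewrite normrN gtr0_norm.
have contP (d s : R) : 0 < d <= r -> s = d \/ s = - d ->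
    scont (- d) d (fun x => complex.Im (G (x +i* s))) /\
    scont (- d) d (fun y => complex.Re (G (s +i* y))).
  move=> /andP[d0 dr] hs.
  have sd : `|s| = d by case: hs => ->; [exact: nr|exact: nNr].
  have s0 : s != 0 by rewrite -normr_gt0 sd.
  split=> x /ab hx.
    have [||l hl] := cG (x +i* s); [|exact: n2|exact: curlfree_contPx (cdiff_curlfree hl)].
    by split; rewrite /= ?sd// (le_trans hx).
  have [||l hl] := cG (s +i* x); [|exact: n1|exact: curlfree_contQy (cdiff_curlfree hl)].
  by split; rewrite /= ?sd// (le_trans hx).
(* Four sides of length 2 d, on each of which the integrand is at least (A / 2 - eta) / d. *)
have low (eta : R) : 0 < eta -> 4 * A - 8 * eta <= ccirc G (- r) r (- r) r.
  move=> eta0; have [d0 d00 hd0] := hA _ eta0.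
  (* Points of the square of half-side [d] have modulus at most 2 d < d0. *)
  pose d := Num.min (d0 / 3) r.
  have dd : 0 < d by rewrite lt_min r0 divr_gt0.
  have dr : d <= r by rewrite ge_min lexx orbT.
  have dd0 : 2 * d < d0.
    rewrite (@le_lt_trans _ _ (2 * (d0 / 3)))//; last lra.
    by rewrite ler_pM2l// ge_min lexx.
  have ddr : 0 < d <= r by rewrite dd.
  rewrite (@ccirc_annulus _ G d r)//.
  have A00 : 0 <= A by rewrite normc_ge0.
  have [cPd cQd] := contP d d ddr (or_introl erefl).
  have [cPN cQN] := contP d (- d) ddr (or_intror erefl).
  have side x y : `|x| <= d -> `|y| <= d -> x +i* y != 0 ->
    exists2 e, normc e <= eta & G (x +i* y) = (A%:C + e) / (x +i* y).
    move=> hx hy z0; exists (u * (F (x +i* y) - A0)).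
      rewrite normcM u1 mul1r hd0//.
      by rewrite (le_lt_trans (normc_le_ReIm _))//= (le_lt_trans _ dd0)// mulr_natl mulr2n lerD.
    by rewrite /G mulrBr uA addrC subrK.
  have d00' : d != 0 by rewrite gt_eqF.
  have Nd00' : - d != 0 by rewrite oppr_eq0.
  have L0 : (4 * A - 8 * eta) = ((A / 2 - eta) / d + (A / 2 - eta) / d) * (d - (- d)) +
     ((A / 2 - eta) / d + (A / 2 - eta) / d) * (d - (- d)) by field.
  have Nd : - d <= d by rewrite ge0_cp// ltW.
  have dn := nr d dd; have dN := nNr d dd.
  rewrite L0 /ccirc /circ lerD//.
    rewrite -sint_cst//; apply: sint_le => //; [exact: scont_cst|exact: scontB|].
    move=> x /ab hx; apply: lerD.
      have [|||e he ->] := side x (- d) => //; [by rewrite dN|exact: n2|].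
      have [+ _] := side_lower A00 dd hx (etrans (sqrrN 1) (expr1n _ 2)) he.
      by rewrite mulN1r opprK mul1r.
    have [|||e he ->] := side x d => //; [by rewrite dn|exact: n2|].
    have [+ _] := side_lower A00 dd hx (expr1n _ 2) he.
    by rewrite mulN1r mul1r.
  rewrite -sint_cst//; apply: sint_le => //; [exact: scont_cst|exact: scontB|].
  move=> x /ab hx; apply: lerD.
    have [|||e he ->] := side d x => //; [by rewrite dn|exact: n1|].
    have [_] := side_lower A00 dd hx (expr1n _ 2) he.
    by rewrite !mul1r.
  have [|||e he ->] := side (- d) x => //; [by rewrite dN|exact: n1|].
  have [_] := side_lower A00 dd hx (etrans (sqrrN 1) (expr1n _ 2)) he.
  by rewrite !mulN1r.
(* On the large square |z| >= r, hence r |G| <= |F|. *)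
have up : r * ccirc G (- r) r (- r) r <= sint (- r) r (sidesum F r).
  have rr : 0 < r <= r by rewrite r0 lexx.
  have [cPd cQd] := contP r r rr (or_introl erefl).
  have [cPN cQN] := contP r (- r) rr (or_intror erefl).
  have r00 : r != 0 by rewrite gt_eqF.
  have Nr00 : - r != 0 by rewrite oppr_eq0.
  have cF (s : R) : s = r \/ s = - r ->
      scont (- r) r (fun x => normc (F (x +i* s))) /\ scont (- r) r (fun x => normc (F (s +i* x))).
    move=> hs; have sr : `|s| <= r by case: hs => ->; rewrite ?(nr _ r0) ?(nNr _ r0).
    have s0 : s != 0 by case: hs => ->.
    split=> x /ab hx.
      by have [] := @cderivable_cont F x s (hF (x +i* s) (conj hx sr) (n2 _ _ s0)).
    by have [] := @cderivable_cont F s x (hF (s +i* x) (conj sr hx) (n1 _ _ s0)).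
  have [cF1 cF2] := cF r (or_introl erefl).
  have [cF3 cF4] := cF (- r) (or_intror erefl).
  have GF z : `|complex.Re z| = r \/ `|complex.Im z| = r -> r * normc (G z) <= normc (F z).
    move=> hz; have nz : r <= normc z by case: hz => <-; [exact: ler_Re_normc|exact: ler_Im_normc].
    rewrite /G !normcM u1 mul1r normcV mulrCA ler_piMr ?normc_ge0//.
    by rewrite ler_pdivrMr ?mul1r// (lt_le_trans r0).
  have rn := nr r r0; have rN := nNr r r0.
  rewrite /sidesum sintD//; [|exact: scontD|exact: scontD].
  rewrite /ccirc /circ mulrDr; apply: lerD.
    rewrite /sint -RintegralZl//; last by apply: scont_integrable; exact: scontB.
    apply: sint_le => //; [| exact: scontD|].
      move=> x hx; apply: cvgMr; exact: (scontB cPN cPd hx).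
    move=> x hx; rewrite mulrBr; apply: lerD.
      apply: le_trans (GF (x +i* - r) _); last by right.
      by rewrite ler_pM2l// (le_trans (ler_norm _))// ler_Im_normc.
    apply: le_trans (GF (x +i* r) _); last by right.
    by rewrite -mulrN ler_pM2l// (le_trans (ler_norm _))// normrN ler_Im_normc.
  rewrite /sint -RintegralZl//; last by apply: scont_integrable; exact: scontB.
  apply: sint_le => //; [| exact: scontD|].
    move=> x hx; apply: cvgMr; exact: (scontB cQd cQN hx).
  move=> x hx; rewrite mulrBr; apply: lerD.
    apply: le_trans (GF (r +i* x) _); last by left.
    by rewrite ler_pM2l// (le_trans (ler_norm _))// ler_Re_normc.
  apply: le_trans (GF (- r +i* x) _); last by left.
  by rewrite -mulrN ler_pM2l// (le_trans (ler_norm _))// normrN ler_Re_normc.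
rewrite (le_trans _ up)// mulrAC mulrC ler_pM2l//.
apply/ler_addgt0Pr => e e0.
have e8 : 0 < e / 8 by rewrite divr_gt0.
by have := low _ e8; rewrite mulrCA divff// mulr1 lerBlDr.
Qed.

End center.

(** * Measures on the plane and the half line *)

Section plane_measure.
Context {R : realType}.
Notation mR := (measurableTypeR R).
Notation leb := (@lebesgue_measure R).
Notation normc := (@normc R).

(** Every point of [A] lies in a box with rational centre and radius 1 / (n + 1) contained in [A],
    so [A] is a countable union of such boxes; [F] replaces the boxes that leave [A] by the empty
    set. *)
Lemma box_open_measurable (A : set (mR * mR)) :
  (forall w, A w -> exists2 d : R, 0 < d & forall w' : mR * mR,
     `|w'.1 - w.1| < d -> `|w'.2 - w.2| < d -> A w') -> measurable A.
Proof.
move=> hA.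
pose I (q : rat) (n : nat) : set mR := `](ratr q - n.+1%:R^-1), (ratr q + n.+1%:R^-1)[%classic.
pose B (i : rat * rat * nat) : set (mR * mR) := I i.1.1 i.2 `*` I i.1.2 i.2.
pose F (i : rat * rat * nat) : set (mR * mR) := if `[< B i `<=` A >] then B i else set0.
have -> : A = \bigcup_i F i.
  apply/seteqP; split=> [w Aw|w [i _]]; last first.
    by rewrite /F; case: asboolP => // h /h.
  have [d d0 hd] := hA _ Aw.
  have [n nd] : exists n : nat, n.+1%:R^-1 < d / 2 :> R.
    have [|n] := @ltr_add_invr R 0 (d / 2); first exact: divr_gt0.
    by rewrite add0r => hn; exists n.
  have n0 : 0 < n.+1%:R^-1 :> R by rewrite invr_gt0.
  have rat_near (x : R) : exists q : rat, `|x - ratr q| < n.+1%:R^-1 :> R.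
    have [|q] := @rat_in_itvoo R (x - n.+1%:R^-1) (x + n.+1%:R^-1).
      by rewrite ltrBlDr -addrA ltrDl addr_gt0.
    by rewrite in_itv/= => h; exists q; rewrite distrC ltr_distl.
  have [q1 h1] := rat_near w.1; have [q2 h2] := rat_near w.2.
  exists (q1, q2, n) => //; rewrite /F; case: asboolP => [_|].
    by split; rewrite /I/= in_itv/= -ltr_distl.
  case=> w' [/=]; rewrite /I/= !in_itv/= -!ltr_distl => h1' h2'.
  have tri (a b q : R) : `|a - q| < n.+1%:R^-1 -> `|b - q| < n.+1%:R^-1 -> `|b - a| < d.
    move=> ha hb; rewrite (le_lt_trans (ler_distD q _ _))// (splitr d).
    by apply: ltrD; [exact: lt_trans hb nd|rewrite distrC; exact: lt_trans ha nd].
  by apply: hd; [exact: tri h1 h1'|exact: tri h2 h2'].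
apply: countable_bigcupT_measurable; first exact: countableP.
move=> i; rewrite /F; case: asboolP => // _.
by apply: measurableX; exact: measurable_itv.
Qed.

Definition half_plane2 : set (mR * mR) := [set w | upper_half_plane (w.1 +i* w.2)].

Lemma measurable_half_plane2 : measurable half_plane2.
Proof.
apply: box_open_measurable => w; rewrite /half_plane2/upper_half_plane/= => w2.
exists w.2 => // w' _ h; rewrite ltr_norml in h; lra.
Qed.

Definition continuous_on_uhp (g : R[i] -> R) := forall z, upper_half_plane z ->
  forall e : R, 0 < e -> exists2 d : R, 0 < d & forall h, normc h < d -> `|g (z + h) - g z| < e.

Lemma continuous_on_uhp_measurable (g : R[i] -> R) : continuous_on_uhp g ->
  measurable_fun half_plane2 (fun w : mR * mR => g (w.1 +i* w.2)).
Proof.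
move=> cg mU; apply: (measurability _ (RGenOInfty.measurableE R)) => // _ [_ [a ->] <-].
apply: box_open_measurable => w [] Uw /=; rewrite in_itv/= andbT => aw.
have [d d0 hd] := cg _ Uw _ (etrans (subr_gt0 _ _) aw).
have w20 : 0 < w.2 by [].
exists (Num.min (d / 2) w.2); first by rewrite lt_min w20 divr_gt0.
move=> w'; rewrite !lt_min => /andP[h1 _] /andP[h2 h3]; split.
  by rewrite /half_plane2/upper_half_plane/=; rewrite ltr_norml in h3; lra.
rewrite /= in_itv/= andbT.
have /hd : normc ((w'.1 - w.1) +i* (w'.2 - w.2)) < d.
  by rewrite (le_lt_trans (normc_le_ReIm _))//= (splitr d) ltrD.
have -> : w.1 +i* w.2 + ((w'.1 - w.1) +i* (w'.2 - w.2)) = w'.1 +i* w'.2.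
  by apply/eqP; rewrite eq_complex/= !subrKC !eqxx.
rewrite ltr_norml; lra.
Qed.

Lemma holomorphic_continuous f : holomorphic_on (@upper_half_plane R) f ->
  [/\ continuous_on_uhp (fun z => normc (f z)),
      continuous_on_uhp (fun z => complex.Re (f z)) &
      continuous_on_uhp (fun z => complex.Im (f z))].
Proof.
move=> hf; have H z : upper_half_plane z -> forall e : R, 0 < e -> exists2 d : R, 0 < d &
    forall h, normc h < d -> normc (f (z + h) - f z) < e.
  by move=> /hf/derivable_cdiff[l /cdiff_cont].
split=> z /H hz e /hz[d d0 hd]; exists d => // h /hd; apply: le_lt_trans.
- rewrite ler_norml lerBrDr lerBlDr; apply/andP; split; last first.
    by rewrite (le_trans _ (le_normcD _ _))// subrK.
  by rewrite addrC lerBlDr normcB (le_trans _ (le_normcD _ _))// addrC subrK.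
- by case: (f (z + h)) (f z) => [a b] [a' b']; exact: (ler_Re_normc ((a - a') +i* (b - b'))).
- by case: (f (z + h)) (f z) => [a b] [a' b']; exact: (ler_Im_normc ((a - a') +i* (b - b'))).
Qed.

Lemma integral_mrestr (d : measure_display) (T : measurableType d)
  (mu : {measure set T -> \bar R}) (D : set T) (mD : measurable D) (f : T -> \bar R) :
  (\int[mrestr mu mD]_x ((f \_ D) x) = \int[mu]_(x in D) f x)%E.
Proof.
rewrite -integral_mkcond; apply: eq_measure_integral => A mA AD.
by rewrite /= /mrestr setIidl.
Qed.

(** Lebesgue measure is |a| times its image under x -> x a + b, by uniqueness from the values on
    half-open intervals. *)
Lemma lebesgue_affine (a b : R) (h : mR -> \bar R) : a != 0 ->
  measurable_fun [set: mR] h -> (forall x, (0 <= h x)%E) ->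
  (\int[leb]_x h (x * a + b)%R = (`|a|^-1)%:E * \int[leb]_x h x)%E.
Proof.
move=> a0 mh h0.
pose phi (x : mR) : mR := x * a + b.
have mphi : measurable_fun [set: mR] phi.
  by apply: measurable_funD => //; exact: measurable_funM.
have an : 0 <= `|a| by [].
pose m2 : {measure set mR -> \bar R} := mscale (NngNum an) (pushforward leb phi).
pose m3 := m2 mphi.
have E (A : set mR) : measurable A -> leb A = m3 A.
  move=> mA; apply: lebesgue_measure_unique => // X [[c d] /= _ <-].
  rewrite /m3 /m2 /mscale /pushforward /=.
  rewrite /pushforward lebesgue_measure_itv/= lte_fin.
  have [ap|an'|aE] := ltrgtP a 0; last by rewrite aE eqxx in a0.
    (* A negative slope exchanges the closed and the open end; the length is insensitive to this. *)
    have -> : phi @^-1` `]c, d] = `[((d - b) / a), ((c - b) / a)[%classic.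
      apply/seteqP; split=> x /=; rewrite !in_itv/= /phi.
        by rewrite ler_ndivrMr// ltr_ndivlMr// lerBrDr ltrBlDr andbC.
      by rewrite ler_ndivrMr// ltr_ndivlMr// lerBrDr ltrBlDr andbC.
    rewrite lebesgue_measure_itv/= lte_fin ltr_nM2r ?invr_lt0// ltrBDr subrK.
    case: ifPn => _; last by rewrite mule0.
    by rewrite -!EFinD -EFinM ltr0_norm//; congr (_%:E); field.
  have -> : phi @^-1` `]c, d] = `]((c - b) / a), ((d - b) / a)]%classic.
    apply/seteqP; split=> x /=; rewrite !in_itv/= /phi.
      by rewrite ler_pdivlMr// ltr_pdivrMr// lerBrDr ltrBlDr.
    by rewrite ler_pdivlMr// ltr_pdivrMr// lerBrDr ltrBlDr.
  rewrite lebesgue_measure_itv/= lte_fin ltr_pM2r ?invr_gt0// ltrBDr subrK.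
  case: ifPn => _; last by rewrite mule0.
  by rewrite -!EFinD -EFinM gtr0_norm//; congr (_%:E); field.
transitivity ((`|a|^-1)%:E * \int[m3]_x h x)%E; last first.
  by congr (_ * _)%E; apply: eq_measure_integral => A mA _; exact/esym/E.
rewrite ge0_integral_mscale// ge0_integral_pushforward//=.
by rewrite muleA -EFinM mulVf ?mul1e ?normr_eq0.
Qed.

Lemma lebesgue_dilation (t : R) (h : mR -> \bar R) : 0 < t ->
  measurable_fun [set: mR] h -> (forall x, (0 <= h x)%E) ->
  (\int[leb]_x h (x / t)%R = t%:E * \int[leb]_x h x)%E.
Proof.
move=> t0 mh h0.
transitivity (\int[leb]_x h (x * t^-1 + 0)%R)%E.
  by apply: eq_integral => x _; rewrite addr0.
rewrite lebesgue_affine ?invr_eq0 ?gt_eqF//.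
by rewrite gtr0_norm ?invr_gt0// invrK.
Qed.

Lemma lebesgue_shift (b : R) (h : mR -> \bar R) :
  measurable_fun [set: mR] h -> (forall x, (0 <= h x)%E) ->
  (\int[leb]_x h (b + x)%R = \int[leb]_x h x)%E.
Proof.
move=> mh h0.
transitivity (\int[leb]_x h (x * 1 + b)%R)%E.
  by apply: eq_integral => x _; rewrite mulr1 addrC.
by rewrite lebesgue_affine ?oner_eq0// normr1 invr1 mul1e.
Qed.

Lemma lebesgue_reflection (h : mR -> \bar R) :
  measurable_fun [set: mR] h -> (forall x, (0 <= h x)%E) ->
  (\int[leb]_x h (- x)%R = \int[leb]_x h x)%E.
Proof.
move=> mh h0.
transitivity (\int[leb]_x h (x * (-1) + 0)%R)%E.
  by apply: eq_integral => x _; rewrite addr0 mulrN1.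
by rewrite lebesgue_affine ?oppr_eq0 ?oner_eq0// normrN normr1 invr1 mul1e.
Qed.

Notation area := ((leb \x leb)%E).

Lemma area_dilation (t : R) (h : mR * mR -> \bar R) : 0 < t ->
  measurable_fun [set: mR * mR] h -> (forall x, (0 <= h x)%E) ->
  (\int[area]_w h (w.1 / t, w.2 / t)%R = (t ^+ 2)%:E * \int[area]_w h w)%E.
Proof.
move=> t0 mh h0.
have md : measurable_fun [set: mR] (fun x : mR => x / t : mR) by exact: measurable_funM.
have mhd : measurable_fun [set: mR * mR] (fun w : mR * mR => h (w.1 / t, w.2 / t)).
  apply: (measurableT_comp mh); apply: measurable_fun_pair.
    exact: (measurableT_comp md measurable_fst).
  exact: (measurableT_comp md measurable_snd).
have hx x : measurable_fun [set: mR] (fun y => h (x, y)) by exact: measurable_fun_pair2.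
rewrite fubini_tonelli1//.
transitivity (\int[leb]_x (t%:E * fubini_F leb h (x / t)%R))%E.
  apply: eq_integral => x _; rewrite /fubini_F/=.
  exact: (@lebesgue_dilation t (fun y => h (x / t, y))).
have mF : measurable_fun [set: mR] (fubini_F leb h) by exact: measurable_fun_fubini_tonelli_F.
have F0 x : (0 <= fubini_F leb h x)%E by apply: integral_ge0.
rewrite ge0_integralZl//; last 2 first.
- exact: measurableT_comp mF md.
- by rewrite lee_fin ltW.
by rewrite lebesgue_dilation// fubini_tonelli1// muleA -EFinM expr2.
Qed.

Lemma area_sigma_finite : sigma_finite [set: mR * mR] area.
Proof.
pose I (n : nat) : set mR := `[- n%:R, n%:R]%classic.
have mI n : measurable (I n) by exact: measurable_itv.
exists (fun n => I n `*` I n).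
  apply/seteqP; split=> // w _.
  have [n1 n2] := (archi_boundP (normr_ge0 w.1), archi_boundP (normr_ge0 w.2)).
  exists (maxn (Num.bound `|w.1|) (Num.bound `|w.2|)) => //.
  split; rewrite /I/= in_itv/= -ler_norml.
    by rewrite (le_trans (ltW n1))// ler_nat leq_maxl.
  by rewrite (le_trans (ltW n2))// ler_nat leq_maxr.
move=> n; split; first exact: measurableX.
have Ioo : (leb (I n) < +oo)%E.
  by rewrite /I lebesgue_measure_itv/=; case: ifPn => _; rewrite ?ltry// -EFinD ltry.
rewrite product_measure1E// lte_mul_pinfty//.
by rewrite ge0_fin_numE.
Qed.

(* An alias of the plane measure that carries its sigma-finiteness. *)
Definition area2 : set (mR * mR)%type -> \bar R := area.
HB.instance Definition _ := Measure.copy area2 (area : set (mR * mR)%type -> \bar R).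
HB.instance Definition _ :=
  Measure_isSigmaFinite.Build _ _ _ area2 area_sigma_finite.

(** Tonelli asks for a sigma-finite measure on the whole line, while [mu] is controlled on the half
    line only. The restriction of [mu] qualifies, and the indicator moves the domain into the
    integrand. *)
Lemma half_line_sigma_finite (mu : {measure set mR -> \bar R}) :
  sigma_finite (@half_line R) mu ->
  exists m' : {sigma_finite_measure set mR -> \bar R}, forall g : mR -> \bar R,
    (\int[mu]_(t in half_line) g t = \int[m']_t (g t * (\1_(@half_line R) t)%:E))%E.
Proof.
move=> hmu; have mD : measurable (@half_line R) by exact: measurable_itv.
have sf : sigma_finite setT (mrestr mu mD).
  (* The complement of the half line is null for the restriction and can be added to every set of
     the exhaustion. *)
  case: hmu => E EU hE; exists (fun n => E n `|` ~` half_line).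
    apply/seteqP; split=> // x _; have [hx|nx] := pselect (half_line x).
      by move: (hx); rewrite EU => -[n _ Enx]; exists n => //; left.
    by exists 0%N => //; right.
  move=> n; have [mE Eoo] := hE n; split; first by apply: measurableU => //; exact: measurableC.
  rewrite /mrestr setIUl setICl setU0 (le_lt_trans _ Eoo)// le_measure ?inE//.
  exact: measurableI.
pose m' : {sigma_finite_measure set mR -> \bar R} :=
  HB.pack (mrestr mu mD) (Measure_isSigmaFinite.Build _ _ _ (mrestr mu mD) sf).
exists m' => g.
rewrite -(@integral_mrestr _ _ mu _ mD); apply: eq_integral => t _.
by rewrite patchE indicE; case: ifPn => /= _; rewrite ?mule1 ?mule0.
Qed.

Section half_line_tonelli.
Variables (mu : {measure set mR -> \bar R}) (F : (mR * mR) * mR -> \bar R).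
Hypothesis hmu : sigma_finite (@half_line R) mu.
Hypotheses (mF : measurable_fun [set: (mR * mR) * mR] F) (F0 : forall x, (0 <= F x)%E).

Let G (x : (mR * mR) * mR) : \bar R := (F x * (\1_(@half_line R) x.2)%:E)%E.

Let mG : measurable_fun [set: (mR * mR) * mR] G.
Proof.
apply: emeasurable_funM => //; apply/measurable_EFinP.
apply: (measurableT_comp _ measurable_snd); apply: measurable_indic; exact: measurable_itv.
Qed.

Let G0 x : (0 <= G x)%E.
Proof. by rewrite mule_ge0// lee_fin. Qed.

Lemma measurable_half_line_integral :
  measurable_fun [set: mR * mR] (fun w => \int[mu]_(t in half_line) F (w, t))%E.
Proof.
have [m' hm] := half_line_sigma_finite hmu.
rewrite (_ : (fun w => _) = fubini_F m' G); first exact: measurable_fun_fubini_tonelli_F.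
by apply/funext => w; rewrite hm.
Qed.

Lemma half_line_tonelli :
  (\int[area]_w \int[mu]_(t in half_line) F (w, t) =
   \int[mu]_(t in half_line) \int[area]_w F (w, t))%E.
Proof.
have [m' hm] := half_line_sigma_finite hmu.
under eq_integral do rewrite hm.
rewrite (fubini_tonelli (m1 := area2) (m2 := m') G mG G0) hm.
apply: eq_integral => t _; rewrite /G/= indicE.
case: (_ \in _) => /=; last by rewrite mule0; apply: integral0_eq => w _; rewrite mule0.
by rewrite mule1; apply: eq_integral => w _; rewrite mule1.
Qed.

End half_line_tonelli.

End plane_measure.

(** * Value at the centre, Cauchy estimate, Lipschitz bound on segments *)

Section consequences.
Context {R : realType}.
Implicit Types (f : R[i] -> R[i]) (w z l : R[i]).
Notation normc := (@normc R).

Lemma cdiff_shift f w z l : cdiff f (w + z) l -> cdiff (fun x => f (w + x)) z l.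
Proof. by move=> hf e /hf[d d0 hd]; exists d => // h /hd; rewrite addrA. Qed.

Lemma cderivable_shift f w z : cderivable f (w + z) -> cderivable (fun x => f (w + x)) z.
Proof. by move=> /derivable_cdiff[l /cdiff_shift]; exact: cdiff_derivable. Qed.

Lemma scont_sidesum f (r : R) : 0 < r ->
  (forall z, in_square r z -> z != 0 -> cderivable f z) -> scont (- r) r (sidesum f r).
Proof.
move=> r0 hf.
have ab (x : R) : - r <= x <= r -> `|x| <= r by rewrite ler_norml.
have rr : `|r| <= r by rewrite gtr0_norm.
have rN : `|- r| <= r by rewrite normrN.
have r00 : r != 0 by rewrite gt_eqF.
have Nr00 : - r != 0 by rewrite oppr_eq0.
have n1 (a b : R) : a != 0 -> a +i* b != 0 by move=> h; rewrite eq_complex/= negb_and h.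
have n2 (a b : R) : b != 0 -> a +i* b != 0 by move=> h; rewrite eq_complex/= negb_and h orbT.
have c1 (s : R) : `|s| <= r -> s != 0 -> scont (- r) r (fun x => normc (f (x +i* s))).
  move=> hs s0 x /ab hx.
  by have [] := @cderivable_cont _ f x s (hf (x +i* s) (conj hx hs) (n2 _ _ s0)).
have c2 (s : R) : `|s| <= r -> s != 0 -> scont (- r) r (fun x => normc (f (s +i* x))).
  move=> hs s0 x /ab hx.
  by have [] := @cderivable_cont _ f s x (hf (s +i* x) (conj hs hx) (n1 _ _ s0)).
by apply: scontD; apply: scontD; [exact: c1|exact: c1|exact: c2|exact: c2].
Qed.

Lemma center_value f w (r : R) : 0 < r ->
  (forall z, in_square r z -> cderivable f (w + z)) ->
  4 * r * normc (f w) <= sint (- r) r (sidesum (fun z => f (w + z)) r).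
Proof.
move=> r0 hf; apply: center_bound => // [z hz _|e e0].
  exact/cderivable_shift/hf.
have [|l hl] := derivable_cdiff (hf 0 _); first by split; rewrite /= normr0 ltW.
have [d d0 hd] := cdiff_cont hl e0; exists d => // z zd _.
by have := hd _ zd; rewrite addr0 => /ltW.
Qed.

(** [center_bound] is applied to the difference quotient (f (w + z) - f w) / z, which has limit [l]
    at 0; this is why that lemma allows a puncture. On the boundary, of length 8 r, the quotient is
    at most 2 M / r. *)
Lemma cdiff_bound f w (r M : R) l : 0 < r ->
  (forall z, in_square r z -> cderivable f (w + z)) ->
  (forall z, in_square r z -> normc (f (w + z)) <= M) ->
  cdiff f w l -> normc l <= 4 * M / r.
Proof.
move=> r0 hf hM hl.
pose F z := (f (w + z) - f w) * z^-1.
have dF z : in_square r z -> z != 0 -> cderivable F z.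
  move=> zr z0; apply: (@derivableM R[i] R[i]^o (fun z => f (w + z) - f w) (fun z => z^-1) z 1).
    apply: (@derivableB R[i] R[i]^o R[i]^o (fun z => f (w + z)) (fun=> f w) z 1).
      exact/cderivable_shift/hf.
    exact: derivable_cst.
  by apply: derivableV => //; exact: derivable_id.
have H : 4 * r * normc l <= sint (- r) r (sidesum F r).
  apply: center_bound => // e e0; have [d d0 hd] := hl _ e0.
  exists d => // z zd z0.
  have zp : 0 < normc z by rewrite normc_gt0.
  rewrite -(ler_pM2r zp) (le_trans _ (hd _ zd))// -normcM.
  by rewrite /F mulrBl divfK.
have M2 z : r <= normc z -> in_square r z -> normc (F z) <= 2 * M / r.
  move=> rz zr; rewrite /F normcM normcV ler_pM ?normc_ge0 ?invr_ge0 ?normc_ge0//.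
    rewrite (le_trans (le_normcD _ _))// normcN mulr_natl mulr2n lerD ?hM//.
    by rewrite -[w]addr0 hM//; split; rewrite /= normr0 ltW.
  by rewrite lef_pV2// posrE// (lt_le_trans r0).
have sq (x y : R) : `|x| <= r -> `|y| = r -> normc (F (x +i* y)) <= 2 * M / r /\ normc (F (y +i* x)) <= 2 * M / r.
  move=> hx hy; split; apply: M2.
  - by rewrite -hy; exact: (ler_Im_normc (x +i* y)).
  - by split; rewrite /= ?hy.
  - by rewrite -hy; exact: (ler_Re_normc (y +i* x)).
  - by split; rewrite /= ?hy.
have rr : `|r| = r by rewrite gtr0_norm.
have rN : `|- r| = r by rewrite normrN.
have : sint (- r) r (sidesum F r) <= sint (- r) r (fun=> 4 * (2 * M / r)).
  apply: sint_le; [exact: scont_sidesum|exact: scont_cst|].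
  move=> x; rewrite -ler_norml => hx; rewrite /sidesum.
  have [a1 a2] := sq _ _ hx rr; have [a3 a4] := sq _ _ hx rN.
  have -> : 4 * (2 * M / r) = (2 * M / r + 2 * M / r) + (2 * M / r + 2 * M / r) by ring.
  by apply: lerD; apply: lerD.
rewrite sint_cst; last by rewrite ge0_cp// ltW.
move=> /(le_trans H).
have -> : 4 * (2 * M / r) * (r - - r) = 4 * r * (4 * M / r) by field; rewrite gt_eqF.
by rewrite ler_pM2l// mulr_gt0.
Qed.

Lemma lin_is_derive (g : R -> R) (s D : R) :
  (forall e : R, 0 < e -> exists2 d : R, 0 < d &
     forall k, `|k| < d -> `|g (s + k) - g s - D * k| <= e * `|k|) ->
  is_derive s 1 g D.
Proof.
move=> hg.
have H : h^-1 *: (g (h *: 1 + s) - g s) @[h --> (0 : R)^'] --> D.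
  apply/cvgrPdist_le => e e0; have [d d0 hd] := hg _ e0.
  near=> h.
  have h0 : h != 0 by near: h; exact: nbhs_dnbhs_neq.
  have hh : `|h| < d by near: h; exact: dnbhs0_lt.
  have hp : 0 < `|h| by rewrite normr_gt0.
  rewrite -(ler_pM2r hp) (le_trans _ (hd _ hh))// -normrM -normrN /GRing.scale/= mulr1 (addrC h s).
  by have -> : - ((D - h^-1 * (g (s + h) - g s)) * h) = g (s + h) - g s - D * h by field.
apply: DeriveDef; first by apply/cvg_ex; exists D.
exact: cvg_lim.
Unshelve. all: by end_near. Qed.

(** Complex-valued functions satisfy no mean value equality. A rotation makes the increment a
    nonnegative real, and the real mean value theorem applies to the real part of the rotated
    function along the segment. *)
Lemma segment_lipschitz f z h (B : R) :
  (forall s : R, 0 <= s <= 1 -> exists2 l, cdiff f (z + s%:C * h) l & normc l <= B) ->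
  normc (f (z + h) - f z) <= B * normc h.
Proof.
move=> hf.
have [u u1 uE] := unit_rot (f (z + h) - f z).
pose g (s : R) : R := complex.Re (u * f (z + s%:C * h)).
have /choice[L hL] : forall s : R, exists l,
    0 <= s <= 1 -> cdiff f (z + s%:C * h) l /\ normc l <= B.
  move=> s; have [hs|ns] := boolP (0 <= s <= 1); last by exists 0 => /negP.
  by have [l h1 h2] := hf s hs; exists l.
have dg (s : R) : 0 <= s <= 1 -> is_derive s 1 g (complex.Re (u * (L s * h))).
  move=> hs; apply: lin_is_derive => e e0.
  have [hl _] := hL s hs.
  have h1 : 0 < 1 + normc h by rewrite ltr_pwDl// normc_ge0.
  have [d d0 hd] := hl _ (divr_gt0 e0 h1).
  exists (d / (1 + normc h)); first exact: divr_gt0.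
  move=> k kd.
  have kh : normc (k%:C * h) < d.
    rewrite normcM normc_real; move: kd; rewrite ltr_pdivlMr//.
    by apply: le_lt_trans; rewrite ler_wpM2l// lerDr.
  have := hd _ kh.
  have -> : z + s%:C * h + k%:C * h = z + (s + k)%:C * h by rewrite rmorphD mulrDl addrA.
  move=> H.
  have -> : g (s + k) - g s - complex.Re (u * (L s * h)) * k =
     complex.Re (u * (f (z + (s + k)%:C * h) - f (z + s%:C * h) - L s * (k%:C * h))).
    rewrite /g; case: (f _) => ? ?; case: (f _) => ? ?; case: (L s) => ? ?; case: (u) => ? ?; case: (h) => ? ? /=; ring.
  rewrite (le_trans (ler_Re_normc _))// normcM u1 mul1r (le_trans H)//.
  rewrite normcM normc_real mulrAC -mulrA -mulrA ler_wpM2l ?(ltW e0)//.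
  by rewrite ler_piMr// ler_pdivrMr// mul1r lerDr.
have [||c c01 E] := @MVT R g (fun s => complex.Re (u * (L s * h))) 0 1 ltr01.
- by move=> x; rewrite in_itv/= => /andP[x0 x1]; apply: dg; rewrite !ltW.
- apply: derivable_within_continuous => x; rewrite in_itv/= => hx.
  by have [] := dg x hx.
have : complex.Re (u * (f (z + h) - f z)) = normc (f (z + h) - f z) by rewrite uE.
have -> : complex.Re (u * (f (z + h) - f z)) = g 1 - g 0.
  rewrite /g mul1r mul0r addr0; case: (f _) => ? ?; case: (f _) => ? ?; case: (u) => ? ? /=; ring.
rewrite E subr0 mulr1 => <-.
rewrite (le_trans (ler_norm _))// (le_trans (ler_Re_normc _))//.
rewrite !normcM u1 mul1r ler_wpM2r ?normc_ge0//.
by have [] := hL c (subset_itv_oo_cc c01).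
Qed.

End consequences.

(** * Growth of Bergman functions *)

Section growth.
Context {R : realType}.
Implicit Types (f : R[i] -> R[i]) (z l : R[i]).
Notation normc := (@normc R).
Notation mR := (measurableTypeR R).
Notation leb := (@lebesgue_measure R).
Notation area := ((leb \x leb)%E).
Variable p : R.
Hypothesis p1 : 1 <= p.

Definition bergman_int f : \bar R :=
  (\int[area]_(w in half_plane2) (normc (f (w.1 +i* w.2)) `^ p)%:E)%E.

Lemma bergman_normE f : bergman_norm p f = (((pi^-1)%:E * bergman_int f) `^ p^-1)%E.
Proof. by []. Qed.

Lemma bergman_int_ge0 f : (0 <= bergman_int f)%E.
Proof. by apply: integral_ge0 => w _; rewrite lee_fin powR_ge0. Qed.

Lemma bergman_norm_lty f : (bergman_norm p f < +oo)%E <-> (bergman_int f < +oo)%E.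
Proof.
have p0 : 0 < p^-1 by rewrite invr_gt0 (lt_le_trans ltr01).
have pi0 : 0 < (pi : R)^-1 by rewrite invr_gt0 pi_gt0.
rewrite bergman_normE; have := bergman_int_ge0 f.
case: (bergman_int f) => [r| |] r0 //; split=> // h; rewrite ?ltry//.
by move: h; rewrite gt0_muley ?lte_fin// poweRyr// gt_eqF.
Qed.

(** Extension by 0 off the half plane, so that translates and dilates can be integrated over the
    whole plane. *)
Definition absext f (w : mR * mR) : R := ((fun w : mR * mR => normc (f (w.1 +i* w.2))) \_ half_plane2) w.

Lemma absext_ge0 f (w : mR * mR) : 0 <= absext f w.
Proof. by rewrite /absext patchE; case: ifP => // _; exact: normc_ge0. Qed.

Lemma measurable_absext f : holomorphic_on (@upper_half_plane R) f ->
  measurable_fun [set: mR * mR] (absext f).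
Proof.
move=> /holomorphic_continuous[/continuous_on_uhp_measurable cf _ _].
apply: (measurable_restrictT _ _).1; [exact: measurable_half_plane2|exact: cf].
Qed.

Lemma bergman_int_absext f :
  bergman_int f = (\int[area]_w (absext f w `^ p)%:E)%E.
Proof.
rewrite /bergman_int integral_mkcond; apply: eq_integral => w _.
rewrite /absext !patchE; case: ifP => // _.
by rewrite powR0// gt_eqF// (lt_le_trans ltr01).
Qed.

Definition box (r : R) (w : mR * mR) : bool := (`|w.1| <= r) && (`|w.2| <= r).

Lemma measurable_box (r : R) : measurable [set w | box r w].
Proof.
rewrite (_ : [set w | _] = `[- r, r] `*` `[- r, r]); last first.
  by apply/seteqP; split=> x /=; rewrite /box !in_itv/= !ler_norml => /andP.
by apply: measurableX; exact: measurable_itv.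
Qed.

Lemma ge0_integralD4 (h1 h2 h3 h4 : mR -> \bar R) :
  (forall x, (0 <= h1 x)%E) -> (forall x, (0 <= h2 x)%E) ->
  (forall x, (0 <= h3 x)%E) -> (forall x, (0 <= h4 x)%E) ->
  measurable_fun [set: mR] h1 -> measurable_fun [set: mR] h2 ->
  measurable_fun [set: mR] h3 -> measurable_fun [set: mR] h4 ->
  (\int[leb]_x ((h1 x + h2 x) + (h3 x + h4 x)) =
   (\int[leb]_x h1 x + \int[leb]_x h2 x) + (\int[leb]_x h3 x + \int[leb]_x h4 x))%E.
Proof.
move=> p1' p2 p3 p4 m1 m2 m3 m4.
have s1 x : (0 <= h1 x + h2 x)%E by exact: adde_ge0.
have s2 x : (0 <= h3 x + h4 x)%E by exact: adde_ge0.
have t1 : measurable_fun [set: mR] (fun x => h1 x + h2 x)%E by exact: emeasurable_funD.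
have t2 : measurable_fun [set: mR] (fun x => h3 x + h4 x)%E by exact: emeasurable_funD.
by rewrite ge0_integralD//; congr (_ + _)%E; exact: ge0_integralD.
Qed.

Lemma area_box (r : R) : 0 < r -> area [set w | box r w] = (4 * r ^+ 2)%:E.
Proof.
move=> r0; rewrite (_ : [set w | _] = `[- r, r] `*` `[- r, r]); last first.
  by apply/seteqP; split=> x /=; rewrite /box !in_itv/= !ler_norml => /andP.
rewrite product_measure1E//= lebesgue_measure_itv/= lte_fin gt0_cp//.
by rewrite -EFinD -EFinM; congr (_%:E); ring.
Qed.

(** The hypothesis is integrated in [r] over an interval of length rho / 2. Each of the four side
    terms, swept over all [r], contributes the whole plane integral of [k], by Tonelli and the
    reflection r -> - r. *)
Lemma average_sides (k : mR * mR -> \bar R) (c rho : R) : 0 <= c -> 0 < rho ->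
  measurable_fun [set: mR * mR] k -> (forall w, (0 <= k w)%E) ->
  (forall r : R, rho / 2 <= r <= rho -> (c%:E <=
    \int[leb]_x ((k (x, (- r)%R) + k (x, r)) + (k (r, x) + k ((- r)%R, x))))%E) ->
  ((c * (rho / 2))%:E <= 4%:E * \int[leb]_x \int[leb]_y k (x, y))%E.
Proof.
move=> c0 r0 mk k0 hk.
have mkx y : measurable_fun [set: mR] (fun x => k (x, y)) by exact: measurable_fun_pair1.
have mky x : measurable_fun [set: mR] (fun y => k (x, y)) by exact: measurable_fun_pair2.
have mH : measurable_fun [set: mR] (fubini_G leb k) by exact: measurable_fun_fubini_tonelli_G.
have mV : measurable_fun [set: mR] (fubini_F leb k) by exact: measurable_fun_fubini_tonelli_F.
have H0 y : (0 <= fubini_G leb k y)%E by apply: integral_ge0.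
have V0 x : (0 <= fubini_F leb k x)%E by apply: integral_ge0.
have HV : (\int[leb]_y (fubini_G leb k y) = \int[leb]_x fubini_F leb k x)%E.
  exact/esym/(fubini_tonelli k mk k0).
have key r : rho / 2 <= r <= rho -> (c%:E <=
    (fubini_G leb k (- r)%R + fubini_G leb k r) + (fubini_F leb k r + fubini_F leb k (- r)%R))%E.
  by move=> /hk; rewrite ge0_integralD4.
rewrite -[X in (_ <= _ * X)%E]/(\int[leb]_x fubini_F leb k x)%E.
(* From here on [k] enters only through its integrals [H] along horizontal and [V] along vertical
   lines. *)
move: (fubini_G leb k) (fubini_F leb k) mH mV H0 V0 HV key => H V mH mV H0 V0 HV key.
clear -c0 r0 mH mV H0 V0 HV key.
have mopp : measurable_fun [set: mR] (fun x : mR => - x : mR) by exact: oppr_measurable.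
have mHN : measurable_fun [set: mR] (fun y : mR => H (- y)) by exact: measurableT_comp mH mopp.
have mVN : measurable_fun [set: mR] (fun y : mR => V (- y)) by exact: measurableT_comp mV mopp.
pose S r := ((H (- r)%R + H r) + (V r + V (- r)%R))%E.
have mS : measurable_fun [set: mR] S.
  by apply: emeasurable_funD; apply: emeasurable_funD.
have S0 r : (0 <= S r)%E by rewrite /S !adde_ge0.
have SE : (\int[leb]_r S r = 4%:E * \int[leb]_x V x)%E.
  rewrite ge0_integralD4// !lebesgue_reflection// HV.
  have : (0 <= \int[leb]_x V x)%E by apply: integral_ge0.
  case: (\int[leb]_x V x)%E => [s| |]// _.
    by rewrite -!EFinD -EFinM; congr (_%:E); ring.
  by rewrite gt0_muley// lte_fin.
rewrite -SE.
apply: (@le_trans _ _ (\int[leb]_(r in `[(rho / 2)%R, rho]) S r)%E); last first.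
  by apply: ge0_subset_integral.
apply: (@le_trans _ _ (\int[leb]_(r in `[(rho / 2)%R, rho]) c%:E)%E); last first.
  apply: ge0_le_integral => //.
  exact: measurable_funTS.
rewrite integral_cst//= lebesgue_measure_itv/= lte_fin.
have -> : rho / 2 < rho by lra.
by rewrite -EFinD -EFinM lee_fin le_eqVlt; apply/orP; left; apply/eqP; field.
Qed.

(** The cut-off to the square of half-side [rho] keeps integrals over full lines and over the plane
    local to the point. *)
Definition localized f (a b rho : R) (w : mR * mR) : R :=
  absext f (a + w.1, b + w.2) * \1_[set w | box rho w] w.

Lemma localized_ge0 f a b rho w : 0 <= localized f a b rho w.
Proof. by rewrite mulr_ge0// absext_ge0. Qed.

Lemma measurable_localized f a b rho : holomorphic_on (@upper_half_plane R) f ->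
  measurable_fun [set: mR * mR] (localized f a b rho).
Proof.
move=> hf; apply: measurable_funM; last by apply: measurable_indic; exact: measurable_box.
apply: (measurableT_comp (measurable_absext hf)); apply: measurable_fun_pair.
  by apply: measurable_funD => //; exact: measurable_fst.
by apply: measurable_funD => //; exact: measurable_snd.
Qed.

Lemma sides_value f (a b r rho : R) : 0 < r -> r <= rho -> rho < b ->
  holomorphic_on (@upper_half_plane R) f ->
  forall k : mR * mR -> \bar R, (forall w, k w = (localized f a b rho w)%:E) ->
  ((4 * r * normc (f (a +i* b)))%:E <=
    \int[leb]_x ((k (x, (- r)%R) + k (x, r)) + (k (r, x) + k ((- r)%R, x))))%E.
Proof.
move=> r0 rr rb hf k kd.
have dom z : in_square r z -> upper_half_plane (a +i* b + z).
  move=> [_]; case: z => z1 z2 /=; rewrite ler_norml /upper_half_plane/= => h; lra.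
have hfr z : in_square r z -> cderivable f (a +i* b + z) by move=> /dom/hf.
have hfr' z : in_square r z -> z != 0 -> cderivable (fun z => f (a +i* b + z)) z.
  by move=> /hfr/cderivable_shift.
have := center_value r0 hfr; rewrite -lee_fin => /le_trans; apply.
have ci := scont_integrable (scont_sidesum r0 hfr').
rewrite /sint /Rintegral fineK; last exact: integrable_fin_num.
have rn : `|r| <= r by rewrite gtr0_norm.
have rN : `|- r| <= r by rewrite normrN.
have kE u v : `|u| <= r -> `|v| <= r -> k (u, v) = (normc (f (a +i* b + (u +i* v))))%:E.
  move=> hu hv.
  have hb : [set w | box rho w] (u, v) by rewrite /box/= (le_trans hu rr) (le_trans hv rr).
  have hd : half_plane2 ((a + u, b + v) : mR * mR) by exact: (dom (u +i* v) (conj hu hv)).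
  by rewrite kd /localized /absext patchE (mem_set hd) indicE (mem_set hb) mulr1.
have k0 w : (0 <= k w)%E by rewrite kd lee_fin localized_ge0.
have mk : measurable_fun [set: mR * mR] k.
  rewrite (_ : k = EFin \o localized f a b rho); last exact/funext.
  by apply/measurable_EFinP; exact: measurable_localized.
have mkx y : measurable_fun [set: mR] (fun x => k (x, y)) by exact: measurable_fun_pair1.
have mky x : measurable_fun [set: mR] (fun y => k (x, y)) by exact: measurable_fun_pair2.
pose S (x : mR) := ((k (x, (- r)%R) + k (x, r)) + (k (r, x) + k ((- r)%R, x)))%E.
apply: (@le_trans _ _ (\int[leb]_(x in `[(- r)%R, r]) S x)%E).
  rewrite le_eqVlt; apply/orP; left; apply/eqP; apply: eq_integral => x.
  rewrite inE/= in_itv/= -ler_norml => xr.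
  by rewrite /S !kE// /sidesum !EFinD.
have mS : measurable_fun [set: mR] S.
  by apply: emeasurable_funD; apply: emeasurable_funD.
have S0 x : (0 <= S x)%E by rewrite /S !adde_ge0.
by apply: ge0_subset_integral.
Qed.

(* The inequality [center_value] for the squares of half-side [r] is averaged
   over [r] between [rho / 2] and [rho]. *)
Lemma area_mean_value f (a b rho : R) : 0 < rho < b ->
  holomorphic_on (@upper_half_plane R) f ->
  ((rho ^+ 2 * normc (f (a +i* b)))%:E <=
   4%:E * \int[leb]_x \int[leb]_y (localized f a b rho (x, y))%:E)%E.
Proof.
move=> /andP[r0 rb] hf.
have -> : rho ^+ 2 * normc (f (a +i* b)) = (2 * rho * normc (f (a +i* b))) * (rho / 2) by field.
apply: (average_sides (k := fun w => (localized f a b rho w)%:E)) => //.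
- by rewrite mulr_ge0 ?normc_ge0// mulr_ge0// ltW.
- by apply/measurable_EFinP; exact: measurable_localized.
- by move=> w; rewrite lee_fin localized_ge0.
move=> r /andP[r1 r2].
have rp : 0 < r by rewrite (lt_le_trans _ r1)// divr_gt0.
have h24 : 2 * rho <= 4 * r by lra.
apply: (@le_trans _ _ ((4 * r * normc (f (a +i* b)))%:E)).
  by rewrite lee_fin ler_wpM2r ?normc_ge0.
exact (@sides_value f a b r rho rp r2 rb hf (fun w => (localized f a b rho w)%:E) (fun w => erefl)).
Qed.

(** Stands in for Hoelder's inequality: either t <= lam, or t = t ^ (1 - p) t ^ p with t ^ (1 - p)
    <= lam ^ (1 - p). The threshold [lam] is free. *)
Lemma le_powR_mix (t lam : R) : 0 < lam -> 0 <= t -> t <= lam + lam `^ (1 - p) * t `^ p.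
Proof.
move=> l0 t0; have [tl|lt] := leP t lam.
  by rewrite (le_trans tl)// lerDl mulr_ge0 ?powR_ge0.
have tp : 0 < t by rewrite (lt_trans l0).
rewrite (@le_trans _ _ (lam `^ (1 - p) * t `^ p))//; last by rewrite lerDr ltW.
rewrite -[leLHS](powRr1 t0) -[X in t `^ X](subrK p 1) powRD; last by rewrite (gt_eqF tp) implybT.
rewrite ler_wpM2r ?powR_ge0//.
rewrite -[1 - p]opprB !powRN lef_pV2 ?posrE ?powR_gt0//.
by apply: ge0_ler_powR; rewrite ?nnegrE ?subr_ge0// ltW.
Qed.

(** The choice lam = rho ^ (- 2 / p) gives lam ^ (1 - p) = lam rho ^ 2, so both terms of
    [le_powR_mix], integrated over the square of area 4 rho ^ 2, scale as lam rho ^ 2. The factor 4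
    of the mean value inequality turns 4 + N into 16 + 4 N. The bound is not homogeneous in [f]; for
    the growth only the power of [rho] matters. *)
Lemma bergman_pointwise f (a b rho N : R) : 0 < rho < b ->
  holomorphic_on (@upper_half_plane R) f -> bergman_int f = N%:E ->
  normc (f (a +i* b)) <= (16 + 4 * N) * rho `^ (- (2 / p)).
Proof.
move=> hrho hf hN; have /andP[r0 rb] := hrho.
have p0 : 0 < p by rewrite (lt_le_trans ltr01).
pose lam := rho `^ (- (2 / p)).
have l0 : 0 < lam by rewrite powR_gt0.
have lE : lam `^ (1 - p) = lam * rho ^+ 2.
  rewrite /lam -powRrM -(powR_mulrn 2 (ltW r0)) -powRD ?(gt_eqF r0) ?implybT//.
  by congr (_ `^ _); field; rewrite gt_eqF.
pose g (w : mR * mR) : \bar R := (absext f w `^ p)%:E.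
have mg : measurable_fun [set: mR * mR] g.
  by apply/measurable_EFinP; apply: (measurableT_comp (measurable_powR p)); exact: measurable_absext.
have g0 (w : mR * mR) : (0 <= g w)%E by rewrite lee_fin powR_ge0.
have mB : measurable_fun [set: mR * mR] (fun w : mR * mR => (\1_[set w | box rho w] w)%:E : \bar R).
  by apply/measurable_EFinP; apply: measurable_indic; exact: measurable_box.
have B0 (w : mR * mR) : (0 <= (\1_[set w | box rho w] w)%:E :> \bar R)%E by rewrite lee_fin.
have mgs : measurable_fun [set: mR * mR] (fun w : mR * mR => g (a + w.1, b + w.2)).
  apply: (measurableT_comp mg); apply: measurable_fun_pair.
    by apply: measurable_funD => //; exact: measurable_fst.
  by apply: measurable_funD => //; exact: measurable_snd.
have /le_trans := area_mean_value a hrho hf.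
move/(_ (4%:E * (lam%:E * (4 * rho ^+ 2)%:E + (lam `^ (1 - p))%:E * N%:E))%E).
have EX : (4%:E * (lam%:E * (4 * rho ^+ 2)%:E + (lam `^ (1 - p))%:E * N%:E))%E =
   (rho ^+ 2 * ((16 + 4 * N) * lam))%:E.
  change ((4 * (lam * (4 * rho ^+ 2) + lam `^ (1 - p) * N))%:E = (rho ^+ 2 * ((16 + 4 * N) * lam))%:E).
  by rewrite lE; congr (_%:E); ring.
rewrite {2}EX lee_fin ler_pM2l ?exprn_gt0//; apply.
rewrite lee_pmul2l ?lte_fin//.
pose S (w : mR * mR) : \bar R := (lam%:E * (\1_[set w | box rho w] w)%:E +
   (lam `^ (1 - p))%:E * g (a + w.1, b + w.2)%R)%E.
have mS : measurable_fun [set: mR * mR] S.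
  by apply: emeasurable_funD; apply: emeasurable_funM.
have S0 (w : mR * mR) : (0 <= S w)%E by rewrite adde_ge0// mule_ge0// lee_fin ?powR_ge0// ltW.
apply: (@le_trans _ _ (\int[leb]_x \int[leb]_y S (x, y))%E).
  have mK : measurable_fun [set: mR * mR] (fun w => (localized f a b rho w)%:E).
    by apply/measurable_EFinP; exact: measurable_localized.
  have K0 (w : mR * mR) : (0 <= (localized f a b rho w)%:E)%E by rewrite lee_fin localized_ge0.
  rewrite -(fubini_tonelli1 _ mS S0) -(fubini_tonelli1 _ mK K0).
  apply: ge0_le_integral => //.
  move=> w _; rewrite /S /g -!EFinM -EFinD lee_fin /localized indicE.
  case: (_ \in _); rewrite ?mulr1 ?mulr0 ?add0r.
    by apply: le_powR_mix => //; exact: absext_ge0.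
  by rewrite mulr_ge0 ?powR_ge0.
rewrite -(fubini_tonelli1 _ mS S0) ge0_integralD//; last 4 first.
- by move=> w _; rewrite mule_ge0// lee_fin ltW.
- exact: emeasurable_funM.
- by move=> w _; rewrite mule_ge0// lee_fin powR_ge0.
- exact: emeasurable_funM.
rewrite !ge0_integralZl// ?lee_fin ?powR_ge0 ?(ltW l0)//.
apply: leeD; rewrite lee_pmul2l ?lte_fin ?powR_gt0//.
  rewrite integral_indic ?setIT//; last exact: measurable_box.
  by rewrite le_eqVlt; apply/orP; left; apply/eqP; exact: area_box.
rewrite -hN bergman_int_absext -/g.
have gs0 (w : mR * mR) : (0 <= g (a + w.1, b + w.2)%R)%E by exact: g0.
rewrite le_eqVlt; apply/orP; left; apply/eqP.
have E1 := fubini_tonelli1 (m1 := leb) (m2 := leb) _ mgs gs0.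
have E2 := fubini_tonelli1 (m1 := leb) (m2 := leb) _ mg g0.
have mF : measurable_fun [set: mR] (fubini_F leb g) by exact: measurable_fun_fubini_tonelli_F.
have F0 x : (0 <= fubini_F leb g x)%E by apply: integral_ge0.
transitivity (\int[leb]_x fubini_F leb g (a + x)%R)%E.
  apply: etrans E1 _; apply: eq_integral => x _; rewrite /fubini_F/=.
  by apply: (@lebesgue_shift _ b (fun y => g (a + x, y))) => //; exact: measurable_fun_pair2.
by rewrite lebesgue_shift//; exact: esym E2.
Qed.

(** The value comes from [bergman_pointwise] with [rho] half the height, the derivative from
    [cdiff_bound] on the square of half-side Im w / 2, which stays above height Im w / 2. The
    derivative costs one power of the height. *)
Lemma bergman_growth f : bergman_space p f -> exists2 K : R, 0 <= K &
  forall w, upper_half_plane w ->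
    normc (f w) <= K * complex.Im w `^ (- (2 / p)) /\
    forall l, cdiff f w l -> normc l <= K * complex.Im w `^ (- (2 / p) - 1).
Proof.
move=> [hf /bergman_norm_lty hN].
have p0 : 0 < p by rewrite (lt_le_trans ltr01).
have [N N0 NE] : exists2 N : R, 0 <= N & bergman_int f = N%:E.
  have := bergman_int_ge0 f; case: (bergman_int f) hN => // r _ r0; by exists r.
pose e := - (2 / p).
pose A := 16 + 4 * N.
have A0 : 0 <= A by rewrite addr_ge0// mulr_ge0.
have q0 : 0 <= (4^-1 : R) `^ e by rewrite powR_ge0.
have val w : upper_half_plane w -> normc (f w) <= A * 2^-1 `^ e * complex.Im w `^ e.
  case: w => a b; rewrite /upper_half_plane/= => b0.
  have hr : 0 < b / 2 < b by lra.
  have := bergman_pointwise a hr hf NE.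
  by rewrite -/e -/A powRM ?invr_ge0 ?(ltW b0)// [b `^ e * _]mulrC mulrA.
(* The first summand serves the derivative, its 8 being 4 / (1 / 2); the second serves the value. *)
pose K := A * 2^-1 `^ e * 2^-1 `^ e * 8 + A * 2^-1 `^ e.
have K0 : 0 <= K by rewrite addr_ge0 ?mulr_ge0 ?powR_ge0.
exists K => // w hw; split.
  rewrite (le_trans (val _ hw))// ler_wpM2r ?powR_ge0// lerDr !mulr_ge0 ?powR_ge0//.
move=> l hl; set y := complex.Im w.
have y0 : 0 < y by [].
have hsq z : in_square (y / 2) z -> y / 2 <= complex.Im (w + z).
  move=> [_]; rewrite ler_norml; move: y0; rewrite /y; case: (w) => ? ?; case: z => ? ? /=; lra.
have hU z : in_square (y / 2) z -> upper_half_plane (w + z).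
  by move=> /hsq; apply: lt_le_trans; rewrite divr_gt0.
have y20 : 0 < y / 2 by rewrite divr_gt0.
have := @cdiff_bound _ f w (y / 2) (A * 2^-1 `^ e * (2^-1 `^ e * y `^ e)) l y20.
move=> H; rewrite (le_trans (H _ _ hl))//.
- by move=> z /hU/hf.
- move=> z hz; rewrite (le_trans (val _ (hU _ hz)))// ler_wpM2l ?mulr_ge0 ?powR_ge0//.
  rewrite -powRM ?(ltW y0)// mulrC /e !powRN lef_pV2 ?posrE ?powR_gt0 ?(lt_le_trans y20 (hsq _ hz))//.
  have h2p : 0 <= 2 / p by rewrite divr_ge0// ltW.
  by apply: ge0_ler_powR => //; rewrite ?nnegrE ?(ltW y20)//; [rewrite (le_trans (ltW y20))//|]; exact: hsq.
- rewrite powRB ?(gt_eqF y0) ?implybT// powRr1 ?(ltW y0)//.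
  rewrite -/e [X in _ <= X]mulrA ler_pdivlMr//.
  rewrite (_ : _ / _ * y = (A * 2^-1 `^ e * 2^-1 `^ e * 8) * y `^ e); last by field; rewrite gt_eqF.
  by rewrite ler_wpM2r ?powR_ge0// lerDl !mulr_ge0 ?powR_ge0.
Qed.

End growth.

(** * Sufficiency *)

Section hausdorff_integrand.
Context {R : realType}.
Implicit Types (f : R[i] -> R[i]) (z l : R[i]).
Notation normc := (@normc R).
Notation mR := (measurableTypeR R).
Notation leb := (@lebesgue_measure R).
Notation area := ((leb \x leb)%E).

Lemma div_realC z (t : R) : z / t%:C = (complex.Re z / t) +i* (complex.Im z / t).
Proof.
rewrite -fmorphV; case: z => a b.
by apply/eqP; rewrite eq_complex/= !mulr0 subr0 add0r !eqxx.
Qed.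

Lemma half_line_gt0 (t : R) : half_line t -> 0 < t.
Proof. by rewrite /half_line/= in_itv/= andbT. Qed.

Lemma measurable_half_line : measurable (@half_line R).
Proof. exact: measurable_itv. Qed.

Lemma uhp_div z (t : R) : upper_half_plane z -> half_line t -> upper_half_plane (z / t%:C).
Proof. by move=> hz /half_line_gt0 t0; rewrite div_realC /upper_half_plane/= divr_gt0. Qed.

Lemma integrandE f z (t : R) : hausdorff_integrand f z t = (t^-1)%:C * f (z / t%:C).
Proof. by rewrite /hausdorff_integrand mul1r fmorphV. Qed.

Lemma Re_realM (r : R) z : complex.Re (r%:C * z) = r * complex.Re z.
Proof. by case: z => a b /=; rewrite mul0r subr0. Qed.

Lemma Im_realM (r : R) z : complex.Im (r%:C * z) = r * complex.Im z.
Proof. by case: z => a b /=; rewrite mul0r addr0. Qed.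

Lemma normc_realM (r : R) z : 0 <= r -> normc (r%:C * z) = r * normc z.
Proof. by move=> r0; rewrite normcM normc_real ger0_norm. Qed.

Lemma measurable_inv_half_line : measurable_fun (@half_line R) (fun t : mR => t^-1 : mR).
Proof.
apply: (eq_measurable_fun (fun t : mR => t `^ (-1) : mR)); last first.
  exact: measurable_funTS (measurable_powR _).
by move=> t /[!inE] /half_line_gt0/ltW t0; rewrite powR_inv1.
Qed.

Lemma measurable_dilate (g : R[i] -> R) z : continuous_on_uhp g -> upper_half_plane z ->
  measurable_fun (@half_line R) (fun t : mR => g (z / t%:C)).
Proof.
move=> /continuous_on_uhp_measurable mg hz.
pose phi (t : mR) : mR * mR := (complex.Re z * t `^ (-1), complex.Im z * t `^ (-1)).
have mphi : measurable_fun (@half_line R) phi.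
  apply: measurable_funTS; apply: measurable_fun_pair;
    by apply: measurable_funM => //; exact: measurable_powR.
have := measurable_comp measurable_half_plane2 _ mg mphi.
have E t : half_line t -> (complex.Re z * t `^ (-1)) +i* (complex.Im z * t `^ (-1)) = z / t%:C.
  by move=> /half_line_gt0/ltW t0; rewrite powR_inv1// div_realC.
move=> H; apply: (eq_measurable_fun (fun t : mR => g ((phi t).1 +i* (phi t).2))) => [t|].
  by rewrite inE => ht /=; rewrite E.
by apply: H => _ [t ht <-]; rewrite /half_plane2/phi/= E//; exact: uhp_div.
Qed.

Section cintegral.
Variables (d : measure_display) (T : measurableType d) (mu : {measure set T -> \bar R}).
Variables (D : set T) (mD : measurable D).

(** The real and imaginary parts of a product u g have this form, with (a, b) equal to (Re u, - Im
    u) and (Im u, Re u). *)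
Lemma cintegrable_linear (g : T -> R[i]) (a b : R) : cintegrable mu D g ->
  mu.-integrable D (fun t => (a * complex.Re (g t) + b * complex.Im (g t))%:E) /\
  Rintegral mu D (fun t => a * complex.Re (g t) + b * complex.Im (g t)) =
  a * complex.Re (cintegral mu D g) + b * complex.Im (cintegral mu D g).
Proof.
move=> [h1 h2].
have h1' : mu.-integrable D (EFin \o (fun t => a * complex.Re (g t))) by exact: (integrableZl mD a h1).
have h2' : mu.-integrable D (EFin \o (fun t => b * complex.Im (g t))) by exact: (integrableZl mD b h2).
split; first exact: (integrableD mD h1' h2').
by rewrite RintegralD// !RintegralZl.
Qed.

(** The shape of a remainder F (z + h) - F z - l h, as it occurs in differentiation under the
    integral. *)
Lemma cintegralB_scale (g1 g2 g3 : T -> R[i]) (h : R[i]) :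
  cintegrable mu D g1 -> cintegrable mu D g2 -> cintegrable mu D g3 ->
  cintegrable mu D (fun t => g1 t - g2 t - g3 t * h) /\
  cintegral mu D (fun t => g1 t - g2 t - g3 t * h) =
  cintegral mu D g1 - cintegral mu D g2 - cintegral mu D g3 * h.
Proof.
move=> h1 h2 h3.
have [k1 e1] := cintegrable_linear (complex.Re h) (- complex.Im h) h3.
have [k2 e2] := cintegrable_linear (complex.Im h) (complex.Re h) h3.
case: h1 h2 => [r1 i1] [r2 i2].
have R12 := integrableB mD r1 r2; have I12 := integrableB mD i1 i2.
have RE : (fun t => complex.Re (g1 t - g2 t - g3 t * h)) = (fun t =>
   (complex.Re (g1 t) - complex.Re (g2 t)) - (complex.Re h * complex.Re (g3 t) + - complex.Im h * complex.Im (g3 t))).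
  apply/funext => t; case: (g1 t) => ? ?; case: (g2 t) => ? ?; case: (g3 t) => ? ?; case: (h) => ? ? /=; ring.
have IE : (fun t => complex.Im (g1 t - g2 t - g3 t * h)) = (fun t =>
   (complex.Im (g1 t) - complex.Im (g2 t)) - (complex.Im h * complex.Re (g3 t) + complex.Re h * complex.Im (g3 t))).
  apply/funext => t; case: (g1 t) => ? ?; case: (g2 t) => ? ?; case: (g3 t) => ? ?; case: (h) => ? ? /=; ring.
split.
  split.
    rewrite (_ : (fun t => _) = EFin \o (fun t => complex.Re (g1 t - g2 t - g3 t * h)))// RE.
    exact: (integrableB mD R12 k1).
  rewrite (_ : (fun t => _) = EFin \o (fun t => complex.Im (g1 t - g2 t - g3 t * h)))// IE.
  exact: (integrableB mD I12 k2).
rewrite {1}/cintegral RE IE.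
rewrite !RintegralB// e1 e2.
by apply/eqP; rewrite eq_complex; apply/andP; split; apply/eqP => /=; case: (h) => ? ? /=; ring.
Qed.

(** After a rotation the modulus of the integral is the integral of a real part, which [k] bounds
    pointwise. *)
Lemma normc_cintegral (g : T -> R[i]) (k : T -> R) : cintegrable mu D g ->
  mu.-integrable D (EFin \o k) -> (forall t, D t -> normc (g t) <= k t) ->
  normc (cintegral mu D g) <= Rintegral mu D k.
Proof.
move=> hg hk gk.
have [u u1 uE] := unit_rot (cintegral mu D g).
have [k1 e1] := cintegrable_linear (complex.Re u) (- complex.Im u) hg.
have <- : complex.Re (u * cintegral mu D g) = normc (cintegral mu D g) by rewrite uE.
have -> : complex.Re (u * cintegral mu D g) =
   Rintegral mu D (fun t => complex.Re u * complex.Re (g t) + - complex.Im u * complex.Im (g t)).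
  by rewrite e1; case: (u) (cintegral mu D g) => ? ? [? ?] /=; ring.
apply: le_Rintegral => // t Dt.
rewrite (le_trans _ (gk _ Dt))//.
rewrite (_ : _ + _ = complex.Re (u * g t)); last first.
  by case: (u) (g t) => ? ? [? ?] /=; ring.
by rewrite (le_trans (ler_norm _))// (le_trans (ler_Re_normc _))// normcM u1 mul1r.
Qed.

End cintegral.

End hausdorff_integrand.

Section sufficiency.
Context {R : realType}.
Implicit Types (f : R[i] -> R[i]) (z l : R[i]).
Notation normc := (@normc R).
Notation mR := (measurableTypeR R).
Notation leb := (@lebesgue_measure R).
Notation area := ((leb \x leb)%E).
Variables (p : R) (p1 : 1 <= p).
Variable mu : {measure set mR -> \bar R}.
Hypothesis hmu : sigma_finite (@half_line R) mu.

Let p0 : 0 < p. Proof. exact: lt_le_trans p1. Qed.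

Definition hweight (t : R) : R := 1 / t `^ (1 - 2 / p).

Lemma hweight_ge0 t : 0 <= hweight t.
Proof. by rewrite divr_ge0// powR_ge0. Qed.

Lemma hweightE t : 0 < t -> hweight t = t^-1 * t `^ (2 / p).
Proof.
move=> t0; rewrite /hweight mul1r -powRN opprB powRD; last by rewrite (gt_eqF t0) implybT.
by rewrite mulrC powRN powRr1// ltW.
Qed.

Lemma measurable_hweight (D : set mR) : measurable_fun D (hweight : mR -> mR).
Proof.
rewrite (_ : hweight = fun t => t `^ (- (1 - 2 / p))); first exact: measurable_funTS (measurable_powR _).
by apply/funext => t; rewrite /hweight mul1r powRN.
Qed.

Hypothesis hI : (\int[mu]_(t in half_line) (hweight t)%:E < +oo)%E.

Lemma hweight_integrable : mu.-integrable half_line (EFin \o hweight).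
Proof.
apply/integrableP; split; first by apply/measurable_EFinP; exact: measurable_hweight.
rewrite (le_lt_trans _ hI)// ge0_le_integral//.
- exact: measurable_half_line.
- by apply/measurable_EFinP; apply: measurableT_comp => //; exact: measurable_hweight.
- by apply/measurable_EFinP; exact: measurable_hweight.
- by move=> t _ /=; rewrite ger0_norm// hweight_ge0.
Qed.

Lemma dominated_cintegrable (g : mR -> R[i]) (K : R) :
  measurable_fun half_line (fun t => complex.Re (g t)) ->
  measurable_fun half_line (fun t => complex.Im (g t)) ->
  (forall t, half_line t -> normc (g t) <= K * hweight t) ->
  cintegrable mu half_line g.
Proof.
move=> mr mi hg.
have hK := integrableZl measurable_half_line K hweight_integrable.
have H (k : mR -> R) : measurable_fun half_line k ->
    (forall t, half_line t -> `|k t| <= normc (g t)) -> mu.-integrable half_line (fun t => (k t)%:E).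
  move=> mk kg; apply: (le_integrable measurable_half_line _ _ hK).
    exact/measurable_EFinP.
  move=> t Dt /=; rewrite lee_fin (le_trans (kg _ Dt))// (le_trans (hg _ Dt))//.
  exact: ler_norm.
by split; apply: H => // t _; [exact: ler_Re_normc|exact: ler_Im_normc].
Qed.

(** The power of [t] released by Im (z / t) ^ (- 2 / p) turns the factor 1 / t of the integrand into
    the weight. *)
Lemma integrand_bound f z (K e : R) (t : R) : half_line t -> upper_half_plane z ->
  (forall w, upper_half_plane w -> normc (f w) <= K * complex.Im w `^ (- (2 / p))) ->
  normc (hausdorff_integrand f z t) <= K * complex.Im z `^ (- (2 / p)) * hweight t.
Proof.
move=> Dt hz hK; have t0 := half_line_gt0 Dt.
rewrite integrandE normc_realM ?invr_ge0 ?(ltW t0)//.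
rewrite hweightE// mulrCA ler_pM2l ?invr_gt0//.
rewrite (le_trans (hK _ (uhp_div hz Dt)))// div_realC/=.
rewrite powRM ?invr_ge0 ?(ltW t0)//; last by rewrite ltW.
by rewrite mulrA (_ : _^-1 `^ _ = t `^ (2 / p))// -powR_inv1 ?(ltW t0)// -powRrM mulN1r opprK.
Qed.

Lemma integrand_cintegrable f z : bergman_space p f -> upper_half_plane z ->
  cintegrable mu half_line (hausdorff_integrand f z).
Proof.
move=> hf hz; have [K K0 hK] := bergman_growth p1 hf.
have [_ cr ci] := holomorphic_continuous hf.1.
apply: (@dominated_cintegrable _ (K * complex.Im z `^ (- (2 / p)))).
- rewrite (_ : (fun t => _) = fun t : mR => t^-1 * complex.Re (f (z / t%:C))); last first.
    by apply/funext => t; rewrite integrandE Re_realM.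
  by apply: measurable_funM; [exact: measurable_inv_half_line|exact: (measurable_dilate cr)].
- rewrite (_ : (fun t => _) = fun t : mR => t^-1 * complex.Im (f (z / t%:C))); last first.
    by apply/funext => t; rewrite integrandE Im_realM.
  by apply: measurable_funM; [exact: measurable_inv_half_line|exact: (measurable_dilate ci)].
- by move=> t Dt; apply: integrand_bound => // w /hK[].
Qed.

End sufficiency.

(** Dominated convergence in the form that refutes a sequence of counterexamples: one index with a
    small integral is enough. *)
Lemma dominated_small (R : realType) (d : measure_display) (T : measurableType d)
    (mu : {measure set T -> \bar R}) (D : set T) (k : nat -> T -> R) (g : T -> R) :
  measurable D -> (forall n, measurable_fun D (k n)) ->
  mu.-integrable D (EFin \o g) -> (forall n t, D t -> `|k n t| <= g t) ->
  (forall t, D t -> k n t @[n --> \oo] --> (0 : R)) ->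
  forall e : R, 0 < e ->
  exists2 n, mu.-integrable D (EFin \o k n) & Rintegral mu D (k n) < e.
Proof.
move=> mD mk ig kg kcvg e e0.
have ik n : mu.-integrable D (EFin \o k n).
  apply: (le_integrable mD _ _ ig); first exact/measurable_EFinP.
  by move=> t Dt /=; rewrite lee_fin (le_trans (kg n t Dt))// ler_norm.
have kE t : D t -> (k n t)%:E @[n --> \oo] --> (0 : \bar R).
  by move=> Dt; apply: cvg_EFin; [exact: nearW|exact: kcvg].
have := @dominated_cvg _ _ _ mu D mD (fun n => EFin \o k n) (fun=> 0%E) (EFin \o g)
  (fun n => (measurable_EFinP _ _).2 (mk n)) kE (fun=> fun=> isT) ig kg.
rewrite integral0 => /fine_cvg/cvgrPdist_lt/(_ _ e0)[N _ /(_ N (leqnn N))] /=.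
rewrite sub0r normrN => h; exists N => //.
exact: le_lt_trans (ler_norm _) h.
Qed.

(** * Holomorphy of the transform *)

Section holomorphy.
Context {R : realType}.
Implicit Types (f : R[i] -> R[i]) (z l : R[i]).
Notation normc := (@normc R).
Notation mR := (measurableTypeR R).
Variables (p : R) (p1 : 1 <= p).
Variable mu : {measure set mR -> \bar R}.
Hypothesis hI : (\int[mu]_(t in half_line) (hweight p t)%:E < +oo)%E.

Let p0 : 0 < p. Proof. exact: lt_le_trans p1. Qed.

Let hweight_integrable := (hweight_integrable hI).

(** Differentiating f (z / t) / t in [z] yields a second factor 1 / t, exactly offset by the extra
    power of the height in the derivative bound; so the same weight dominates the derivative. *)
Lemma hweight_deriv (t y : R) : 0 < t -> 0 < y ->
  t^-1 * (y / t) `^ (- (2 / p) - 1) * t^-1 = y `^ (- (2 / p) - 1) * hweight p t.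
Proof.
move=> t0 y0; rewrite powRM ?(ltW y0) ?invr_ge0 ?(ltW t0)// hweightE//.
have -> : t^-1 `^ (- (2 / p) - 1) = t `^ (2 / p) * t.
  rewrite -powR_inv1 ?(ltW t0)// -powRrM mulN1r opprB powRD; last by rewrite (gt_eqF t0) implybT.
  by rewrite opprK mulrC powRr1// ltW.
by field; rewrite gt_eqF.
Qed.

(** The bound on [h] keeps the segment from z / t to (z + h) / t above height Im z / (2 t), where
    the derivative bound is uniform. *)
Lemma difference_bound f z h (K t : R) : half_line t -> upper_half_plane z ->
  normc h < complex.Im z / 2 -> holomorphic_on (@upper_half_plane R) f ->
  (forall w, upper_half_plane w -> forall l, cdiff f w l ->
     normc l <= K * complex.Im w `^ (- (2 / p) - 1)) -> 0 <= K ->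
  normc (hausdorff_integrand f (z + h) t - hausdorff_integrand f z t) <=
  K * (complex.Im z / 2) `^ (- (2 / p) - 1) * hweight p t * normc h.
Proof.
move=> Dt hz hh hf hK K0; have t0 := half_line_gt0 Dt.
have y0 : 0 < complex.Im z by [].
rewrite !integrandE -mulrBr normc_realM ?invr_ge0 ?(ltW t0)// mulrDl.
have h1 (s : R) : 0 <= s <= 1 -> complex.Im z / 2 / t <= complex.Im (z / t%:C + s%:C * (h / t%:C)).
  move=> /andP[s0 s1].
  have := ler_Im_normc h; rewrite ler_norml => /andP[hl _].
  rewrite !div_realC /= mul0r addr0 mulrA -mulrDl ler_pM2r ?invr_gt0//.
  have : s * complex.Im h >= - normc h.
    rewrite (@le_trans _ _ (s * (- normc h)))//; last by rewrite ler_wpM2l.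
    by rewrite mulrN lerN2 ler_piMl// normc_ge0.
  lra.
have := @segment_lipschitz _ f (z / t%:C) (h / t%:C) (K * (complex.Im z / 2 / t) `^ (- (2 / p) - 1)).
move=> H.
rewrite (@le_trans _ _ (t^-1 * (K * (complex.Im z / 2 / t) `^ (- (2 / p) - 1) * normc (h / t%:C))))//.
  rewrite ler_pM2l ?invr_gt0//; apply: H => s hs.
  have hU : upper_half_plane (z / t%:C + s%:C * (h / t%:C)).
    by rewrite /upper_half_plane/= (lt_le_trans _ (h1 _ hs))// !divr_gt0.
  have [l hl] := derivable_cdiff (hf _ hU).
  exists l => //; rewrite (le_trans (hK _ hU _ hl))// ler_wpM2l//.
  have e0 : 0 <= 2 / p + 1 by rewrite addr_ge0// divr_ge0// ltW.
  rewrite -opprD !powRN lef_pV2 ?posrE ?powR_gt0 ?divr_gt0//.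
  by apply: ge0_ler_powR; rewrite ?nnegrE ?divr_ge0 ?(ltW t0) ?(ltW y0) ?h1// ltW.
rewrite -fmorphV (mulrC h) normc_realM ?invr_ge0 ?(ltW t0)//.
have y20 : 0 < complex.Im z / 2 by rewrite divr_gt0.
rewrite le_eqVlt; apply/orP; left; apply/eqP.
transitivity (K * ((complex.Im z / 2) `^ (- (2 / p) - 1) * hweight p t) * normc h).
  by rewrite -(hweight_deriv t0 y20); ring.
by rewrite !mulrA.
Qed.

(** Differentiation under the integral sign; the candidate derivative is the integral of [G], that
    is of f'(z / t) / t ^ 2. If it fails for some [e], increments h_n -> 0 violate the estimate. The
    normalised remainders have a common majorant and tend to 0 pointwise, so their integrals cannot
    all stay above [e]. *)
Lemma hausdorff_holomorphic f : bergman_space p f ->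
  holomorphic_on (@upper_half_plane R) (hausdorff mu f).
Proof.
move=> hf z hz; have [hol _] := hf.
have y0 : 0 < complex.Im z by [].
have [K K0 hK] := bergman_growth p1 hf.
have hK2 w (hw : upper_half_plane w) := (hK w hw).2.
have [_ cr ci] := holomorphic_continuous hol.
(* [L] is a choice of derivative of [f], unconstrained off the half plane. *)
have /choice[L hL] : forall w, exists l, upper_half_plane w -> cdiff f w l.
  move=> w; have [hw|nw] := pselect (upper_half_plane w); last by exists 0.
  by have [l hl] := derivable_cdiff (hol _ hw); exists l.
pose G (t : mR) : R[i] := (t^-1 * t^-1)%:C * L (z / t%:C).
pose e1 := - (2 / p) - 1.
have Gb t : half_line t -> normc (G t) <= K * complex.Im z `^ e1 * hweight p t.
  move=> Dt; have t0 := half_line_gt0 Dt; have hU := uhp_div hz Dt.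
  rewrite /G normc_realM ?mulr_ge0 ?invr_ge0 ?(ltW t0)//.
  rewrite (@le_trans _ _ (t^-1 * t^-1 * (K * complex.Im (z / t%:C) `^ e1)))//.
    by rewrite ler_wpM2l ?mulr_ge0 ?invr_ge0 ?(ltW t0)//; apply: hK2 => //; exact: hL.
  rewrite div_realC/= -[leRHS]mulrA -(hweight_deriv t0 y0) le_eqVlt; apply/orP; left; apply/eqP; rewrite /e1; ring.
pose s (n : nat) : R := n.+1%:R^-1.
have s0 n : 0 < s n by rewrite invr_gt0.
have zs n : upper_half_plane (z + (s n)%:C).
  by move: hz; rewrite /upper_half_plane; case: (z) => a b /=; rewrite addr0.
(* The chosen derivative is not visibly measurable; [G] becomes so as the limit of difference
   quotients with increments 1 / (n + 1). *)
have Lcvg (t : R) : half_line t -> forall e : R, 0 < e -> exists N : nat, forall n, (N <= n)%N ->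
   normc ((n.+1%:R * t^-1)%:C * (f ((z + (s n)%:C) / t%:C) - f (z / t%:C)) - G t) <= e.
  move=> Dt e e0; have t0 := half_line_gt0 Dt.
  have [d d0 hd] := hL _ (uhp_div hz Dt) _ (mulr_gt0 (mulr_gt0 e0 t0) t0).
  have [N hN] : exists N : nat, s N < d * t.
    have [|N] := @ltr_add_invr R 0 (d * t); first exact: mulr_gt0.
    by rewrite add0r => hN; exists N.
  exists N => n Nn.
  have sn : s n < d * t by rewrite (le_lt_trans _ hN)// lef_pV2 ?posrE// ler_nat ltnS.
  have hn : normc ((s n)%:C / t%:C) < d.
    rewrite -fmorphV -rmorphM normc_real ger0_norm; last by rewrite mulr_ge0 ?(ltW (s0 n))// invr_ge0 ltW.
    by rewrite ltr_pdivrMr.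
  have := hd _ hn; rewrite mulrDl.
  set A := f _; set B := f _; set Lz := L _.
  rewrite -fmorphV -rmorphM => H.
  have m0 : n.+1%:R != 0 :> R by rewrite pnatr_eq0.
  have tn0 : t != 0 by rewrite gt_eqF.
  have -> : (n.+1%:R * t^-1)%:C * (A - B) - G t =
      (n.+1%:R * t^-1)%:C * (A - B - Lz * (s n / t)%:C).
    have EX : (t^-1 * t^-1)%:C = (n.+1%:R * t^-1)%:C * (s n / t)%:C.
      rewrite -rmorphM; congr (_%:C); rewrite /s; move: (n.+1%:R : R) m0 => m m0.
      by field; rewrite m0 tn0.
    by rewrite /G -/Lz EX; ring.
  have np : 0 < n.+1%:R * t^-1 by rewrite mulr_gt0// invr_gt0.
  rewrite normc_realM ?(ltW np)//.
  rewrite -ler_pdivlMl// (le_trans H)// normc_real ger0_norm ?divr_ge0 ?(ltW t0) ?(ltW (s0 n))//.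
  rewrite le_eqVlt; apply/orP; left; apply/eqP; rewrite /s; move: (n.+1%:R : R) m0 => m m0.
  by field; rewrite m0 tn0.
have part_cvg (P : R[i] -> R) (g : nat -> mR -> R[i]) :
    (forall w w', `|P w - P w'| <= normc (w - w')) ->
    (forall t : mR, half_line t -> forall e : R, 0 < e -> exists N : nat, forall n, (N <= n)%N ->
       normc (g n t - G t) <= e) ->
    (forall n, measurable_fun half_line (fun t : mR => P (g n t) : mR)) ->
    measurable_fun half_line (fun t : mR => P (G t) : mR).
  move=> hP hg mg; apply: (@measurable_fun_cvg _ _ _ _ (fun n t => P (g n t))) => // t Dt.
  apply/cvgrPdist_le => e e0; have [N hN] := hg t Dt _ e0.
  exists N => // n /= Nn; rewrite distrC (le_trans (hP _ _))//; exact: hN.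
have PRe w w' : `|complex.Re w - complex.Re w'| <= normc (w - w').
  by case: w w' => a b [a' b']; exact: (ler_Re_normc ((a - a') +i* (b - b'))).
have PIm w w' : `|complex.Im w - complex.Im w'| <= normc (w - w').
  by case: w w' => a b [a' b']; exact: (ler_Im_normc ((a - a') +i* (b - b'))).
have cG : cintegrable mu half_line G.
  apply: (dominated_cintegrable hI _ _ Gb).
    apply: (part_cvg _ _ PRe Lcvg) => n.
    rewrite (_ : (fun t => _) = fun t : mR => (n.+1%:R * t^-1) *
       (complex.Re (f ((z + (s n)%:C) / t%:C)) - complex.Re (f (z / t%:C)))); last first.
      by apply/funext => t; rewrite Re_realM; congr (_ * _); case: (f _) (f _) => ? ? [].
    apply: measurable_funM; first by apply: measurable_funM => //; exact: measurable_inv_half_line.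
    by apply: measurable_funB; exact: (measurable_dilate cr).
  apply: (part_cvg _ _ PIm Lcvg) => n.
  rewrite (_ : (fun t => _) = fun t : mR => (n.+1%:R * t^-1) *
     (complex.Im (f ((z + (s n)%:C) / t%:C)) - complex.Im (f (z / t%:C)))); last first.
    by apply/funext => t; rewrite Im_realM; congr (_ * _); case: (f _) (f _) => ? ? [].
  apply: measurable_funM; first by apply: measurable_funM => //; exact: measurable_inv_half_line.
  by apply: measurable_funB; exact: (measurable_dilate ci).
apply: (@cdiff_derivable _ _ _ (cintegral mu half_line G)) => e e0.
apply: contrapT => /forallPNP hno.
pose y := complex.Im z.
have /choice[h hh] : forall n : nat, exists h : R[i],
   [/\ normc h < Num.min (y / 2) (s n) & e * normc h <
     normc (hausdorff mu f (z + h) - hausdorff mu f z - cintegral mu half_line G * h)].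
  move=> n; have dn : 0 < Num.min (y / 2) (s n) by rewrite lt_min s0 divr_gt0.
  have /existsNP[h /not_implyP[h1 /negP]] := hno _ dn.
  by rewrite -ltNge => h2; exists h.
have hU n : upper_half_plane (z + h n).
  have [+ _] := hh n; rewrite lt_min => /andP[+ _].
  have := ler_Im_normc (h n); rewrite /y /upper_half_plane ler_norml => /andP[+ _] /=.
  by case: (z) y0 (h n) => a b /= b0 [a' b'] /=; lra.
have h0 n : 0 < normc (h n).
  have [_] := hh n; rewrite normc_gt0; apply: contraTneq => ->.
  by rewrite normc0 !mulr0 addr0 subrr subr0 normc0 ltxx.
pose N n (t : mR) := hausdorff_integrand f (z + h n) t - hausdorff_integrand f z t - G t * h n.
have cN n := cintegralB_scale measurable_half_line (h n) (integrand_cintegrable p1 hI hf (hU n))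
  (integrand_cintegrable p1 hI hf hz) cG.
(* The sum of the absolute values of the two parts is measurable, dominates the modulus and is at
   most twice it. *)
pose k n (t : mR) := (normc (h n))^-1 * (`|complex.Re (N n t)| + `|complex.Im (N n t)|).
pose C := K * (y / 2) `^ e1 + K * y `^ e1.
have Nb n t : half_line t -> normc (N n t) <= C * hweight p t * normc (h n).
  move=> Dt; rewrite /N (le_trans (le_normcD _ _))// normcN normcM /C !mulrDl lerD//.
    apply: difference_bound => //.
    by have [+ _] := hh n; rewrite lt_min => /andP[].
  by rewrite ler_wpM2r ?normc_ge0// Gb.
have kb n t : half_line t -> `|k n t| <= (C + C) * hweight p t.
  move=> Dt; rewrite ger0_norm ?mulr_ge0 ?invr_ge0 ?normc_ge0 ?addr_ge0//.
  rewrite /k mulrC ler_pdivrMr// [leRHS]mulrAC -mulrA.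
  rewrite mulrDl (_ : C * _ = C * hweight p t * normc (h n)); last by ring.
  by rewrite lerD// (le_trans _ (Nb n _ Dt))// ?ler_Re_normc ?ler_Im_normc.
have mN n : measurable_fun half_line (fun t => complex.Re (N n t) : mR) /\
            measurable_fun half_line (fun t => complex.Im (N n t) : mR).
  have [[/measurable_int/measurable_EFinP ? /measurable_int/measurable_EFinP ?] _] := cN n.
  by split.
have mk n : measurable_fun half_line (fun t => k n t : mR).
  have [mr mi] := mN n; apply: measurable_funM => //.
  by apply: measurable_funD; apply: measurableT_comp.
have kcvg (t : mR) : half_line t -> k n t @[n --> \oo] --> (0 : R).
  move=> Dt; apply/cvgrPdist_le => eps eps0; have t0 := half_line_gt0 Dt.
  have eps' : 0 < eps / 2 * (t * t) by rewrite !mulr_gt0.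
  have [d d0 hd] := hL _ (uhp_div hz Dt) _ eps'.
  have [M hM] : exists M : nat, s M < d * t.
    have [|M] := @ltr_add_invr R 0 (d * t); first exact: mulr_gt0.
    by rewrite add0r => hM; exists M.
  exists M => // n /= Mn; rewrite sub0r normrN.
  have hn : normc (h n / t%:C) < d.
    rewrite -fmorphV (mulrC (h n)) normc_realM ?invr_ge0 ?(ltW t0)// mulrC ltr_pdivrMr//.
    have [+ _] := hh n; rewrite lt_min => /andP[_ hs].
    by rewrite (lt_trans hs)// (le_lt_trans _ hM)// lef_pV2 ?posrE// ler_nat ltnS.
  have Nn : normc (N n t) <= eps / 2 * normc (h n).
    have := hd _ hn; rewrite -mulrDl => H.
    have -> : N n t = (t^-1)%:C * (f ((z + h n) / t%:C) - f (z / t%:C) - L (z / t%:C) * (h n / t%:C)).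
      rewrite /N !integrandE /G -fmorphV rmorphM; ring.
    rewrite normc_realM ?invr_ge0 ?(ltW t0)// mulrC ler_pdivrMr// (le_trans H)//.
    rewrite -fmorphV (mulrC (h n)) normc_realM ?invr_ge0 ?(ltW t0)//.
    by rewrite le_eqVlt; apply/orP; left; apply/eqP; field; rewrite gt_eqF.
  rewrite ger0_norm ?mulr_ge0 ?invr_ge0 ?normc_ge0 ?addr_ge0//.
  rewrite /k mulrC ler_pdivrMr// (splitr eps) mulrDl lerD//.
    exact: le_trans (ler_Re_normc _) Nn.
  exact: le_trans (ler_Im_normc _) Nn.
have hg : mu.-integrable half_line (EFin \o (fun t => (C + C) * hweight p t)).
  exact: (integrableZl measurable_half_line (C + C) hweight_integrable).
have [n ik kn] := dominated_small measurable_half_line mk hg kb kcvg e0.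
have [cNn cNE] := cN n; have [_] := hh n.
rewrite /hausdorff -cNE ltNge => /negP; apply.
have iN : mu.-integrable half_line (EFin \o (fun t => normc (h n) * k n t)).
  exact: (integrableZl measurable_half_line (normc (h n)) ik).
rewrite (le_trans (normc_cintegral measurable_half_line cNn iN _))//.
  by move=> t _; rewrite /k mulVKf ?gt_eqF//; exact: normc_le_ReIm.
rewrite RintegralZl//; last exact: measurable_half_line.
by rewrite mulrC ler_wpM2r ?normc_ge0// ltW.
Qed.

End holomorphy.

(** * Jensen's inequality and the norm bound *)

Section jensen.
Context {R : realType}.
Variables (p : R) (p1 : 1 <= p).

(** Convexity: the graph of x ^ p lies above its tangent at [a]. It is Young's inequality for x and
    a ^ (p - 1) with exponents p and p / (p - 1), whence the separate case p = 1. *)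
Lemma powR_tangent (a x : R) : 0 <= a -> 0 <= x ->
  p * a `^ (p - 1) * x <= x `^ p + (p - 1) * a `^ p.
Proof.
move=> a0 x0; have p0 : 0 < p by rewrite (lt_le_trans ltr01).
have [->|pn1] := eqVneq p 1.
  by rewrite subrr mul0r addr0 powRr0 powRr1// !mul1r.
have pp : 0 < p - 1 by rewrite subr_gt0 lt_neqAle eq_sym pn1.
have q0 : 0 < p / (p - 1) by rewrite divr_gt0.
have := @conjugate_powR _ x (a `^ (p - 1)) p (p / (p - 1)) x0 (powR_ge0 _ _) p0 q0.
rewrite -powRrM mulrCA divff ?gt_eqF// mulr1 => H.
have : x * a `^ (p - 1) <= x `^ p / p + a `^ p / (p / (p - 1)).
  by apply: H; field; rewrite gt_eqF//= gt_eqF.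
rewrite -(ler_pM2l p0) => /le_trans -/(_ (x `^ p + (p - 1) * a `^ p)).
rewrite mulrA mulrAC; apply.
by rewrite le_eqVlt; apply/orP; left; apply/eqP; field; rewrite gt_eqF//= gt_eqF.
Qed.

(** The tangent inequality at the weighted mean a = M / I is integrated against [c]; the integral on
    the right may be infinite. If I = 0 there is no mean, but then M = 0 and the left side
    vanishes. *)
Lemma weighted_jensen (d : measure_display) (T : measurableType d)
    (mu : {measure set T -> \bar R}) (D : set T) (c X : T -> R) (I M : R) :
  measurable D -> measurable_fun D c -> measurable_fun D X ->
  (forall t, 0 <= c t) -> (forall t, 0 <= X t) ->
  (\int[mu]_(t in D) (c t)%:E)%E = I%:E ->
  (\int[mu]_(t in D) (c t * X t)%:E)%E = M%:E -> (I = 0 -> M = 0) ->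
  ((M `^ p)%:E <= (I `^ (p - 1))%:E * \int[mu]_(t in D) (c t * X t `^ p)%:E)%E.
Proof.
move=> mD mc mX c0 X0 cI cM IM.
have p0 : 0 < p by rewrite (lt_le_trans ltr01).
have S0 : (0 <= \int[mu]_(t in D) (c t * X t `^ p)%:E)%E.
  by apply: integral_ge0 => t _; rewrite lee_fin mulr_ge0// powR_ge0.
have I0 : 0 <= I by rewrite -lee_fin -cI; apply: integral_ge0 => t _; rewrite lee_fin.
have [M0|Mn] := eqVneq M 0.
  by rewrite M0 powR0 ?gt_eqF// mule_ge0// lee_fin powR_ge0.
have M0 : 0 < M.
  rewrite lt_neqAle eq_sym Mn -lee_fin -cM; apply: integral_ge0 => t _.
  by rewrite lee_fin mulr_ge0.
have Ip : 0 < I by rewrite lt_neqAle I0 andbT; apply: contra Mn => /eqP/esym/IM ->.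
pose a := M / I.
have a0 : 0 < a by rewrite divr_gt0.
have mXp : measurable_fun D (fun t => X t `^ p) by exact: (measurableT_comp (measurable_powR p) mX).
have H : (\int[mu]_(t in D) ((p * a `^ (p - 1))%:E * (c t * X t)%:E) <=
   \int[mu]_(t in D) ((c t * X t `^ p)%:E + ((p - 1) * a `^ p)%:E * (c t)%:E))%E.
  apply: ge0_le_integral => //.
  - by move=> t _; rewrite -EFinM lee_fin !mulr_ge0 ?powR_ge0// ltW.
  - apply: emeasurable_funM; first exact: measurable_cst.
    by apply/measurable_EFinP; exact: measurable_funM.
  - apply: emeasurable_funD; first by apply/measurable_EFinP; exact: measurable_funM.
    by apply: emeasurable_funM; [exact: measurable_cst|exact/measurable_EFinP].
  - move=> t _; rewrite -!EFinM -EFinD lee_fin.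
    have := ler_wpM2l (c0 t) (powR_tangent (ltW a0) (X0 t)).
    have -> : p * a `^ (p - 1) * (c t * X t) = c t * (p * a `^ (p - 1) * X t) by ring.
    by rewrite [c t * (_ + _)]mulrDr [c t * ((p - 1) * _)]mulrC.
move: H; rewrite ge0_integralZl//; last 3 first.
- by apply/measurable_EFinP; exact: measurable_funM.
- by move=> t _; rewrite lee_fin mulr_ge0.
- by rewrite lee_fin mulr_ge0 ?powR_ge0// ltW.
rewrite cM ge0_integralD//; last 4 first.
- by move=> t _; rewrite lee_fin mulr_ge0// powR_ge0.
- by apply/measurable_EFinP; exact: measurable_funM.
- by move=> t _; rewrite -EFinM lee_fin !mulr_ge0 ?powR_ge0// subr_ge0.
- by apply: emeasurable_funM; [exact: measurable_cst|exact/measurable_EFinP].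
rewrite ge0_integralZl//; last 3 first.
- exact/measurable_EFinP.
- by move=> t _; rewrite lee_fin.
- by rewrite lee_fin mulr_ge0 ?powR_ge0// subr_ge0.
rewrite cI.
case: (\int[mu]_(t in D) (c t * X t `^ p)%:E)%E S0 => [r| |]// r0; last first.
  by move=> _; rewrite gt0_muley ?leey// lte_fin powR_gt0.
rewrite -!EFinM -EFinD !lee_fin => H.
have ME : M = a * I by rewrite /a divfK// gt_eqF.
have Er : a `^ p * I <= r.
  have aE : a `^ (p - 1) * a = a `^ p by rewrite mulrC mulr_powRB1// ltW.
  move: H; rewrite ME -mulrA [X in p * X]mulrA aE; lra.
rewrite ME powRM ?(ltW a0)// -(mulr_powRB1 I0 p0).
have -> : a `^ p * (I * I `^ (p - 1)) = I `^ (p - 1) * (a `^ p * I) by ring.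
by rewrite ler_wpM2l ?powR_ge0.
Qed.

End jensen.

Section dilated.
Context {R : realType}.
Implicit Types (f : R[i] -> R[i]).
Notation mR := (measurableTypeR R).
Notation leb := (@lebesgue_measure R).
Notation area := ((leb \x leb)%E).
Variables (p : R) (p1 : 1 <= p).

(** Integrand of the double integral to which Tonelli is applied, with [f] extended by 0. Writing 1
    / t as a real power makes measurability on the full product space immediate. *)
Definition dilated f (x : (mR * mR) * mR) : \bar R :=
  (hweight p x.2 * (absext f (x.1.1 * x.2 `^ (-1), x.1.2 * x.2 `^ (-1)) `^ p * (x.2 `^ (-1)) ^+ 2))%:E.

Lemma dilated_ge0 f x : (0 <= dilated f x)%E.
Proof. by rewrite /dilated lee_fin mulr_ge0 ?hweight_ge0// mulr_ge0 ?powR_ge0// exprn_ge0// powR_ge0. Qed.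

Lemma measurable_dilated f : holomorphic_on (@upper_half_plane R) f ->
  measurable_fun [set: (mR * mR) * mR] (dilated f).
Proof.
move=> hf; apply/measurable_EFinP; apply: measurable_funM.
  by apply: measurableT_comp measurable_snd; exact: measurable_hweight.
have mV : measurable_fun [set: (mR * mR) * mR] (fun x : (mR * mR) * mR => x.2 `^ (-1) : mR).
  by apply: (measurableT_comp (measurable_powR (-1)) measurable_snd).
apply: measurable_funM; last exact: measurable_funX.
apply: (measurableT_comp (measurable_powR p)).
apply: (measurableT_comp (measurable_absext hf)); apply: measurable_fun_pair.
  by apply: measurable_funM => //; exact: (measurableT_comp measurable_fst measurable_fst).
by apply: measurable_funM => //; exact: (measurableT_comp measurable_snd measurable_fst).
Qed.

(** The Jacobian t ^ 2 of the dilation cancels the factor t ^ (- 2) and leaves the weight alone. *)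
Lemma dilated_area f (t : R) : half_line t -> holomorphic_on (@upper_half_plane R) f ->
  (\int[area]_w dilated f (w, t) = (hweight p t)%:E * bergman_int p f)%E.
Proof.
move=> Dt hf; have t0 := half_line_gt0 Dt.
pose g (w : mR * mR) : \bar R := (absext f w `^ p)%:E.
have mg : measurable_fun [set: mR * mR] g.
  by apply/measurable_EFinP; apply: (measurableT_comp (measurable_powR p)); exact: measurable_absext.
have g0 w : (0 <= g w)%E by rewrite lee_fin powR_ge0.
have md : measurable_fun [set: mR] (fun x : mR => x / t : mR) by exact: measurable_funM.
have mgt : measurable_fun [set: mR * mR] (fun w : mR * mR => g (w.1 / t, w.2 / t)).
  apply: (measurableT_comp mg); apply: measurable_fun_pair.
    exact: (measurableT_comp md measurable_fst).
  exact: (measurableT_comp md measurable_snd).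
transitivity (\int[area]_w ((hweight p t * t ^- 2)%:E * g (w.1 / t, w.2 / t)%R))%E.
  apply: eq_integral => w _; rewrite /dilated /g/= -EFinM powR_inv1 ?(ltW t0)//.
  by rewrite exprVn; congr (_%:E); ring.
have gt0 w : (0 <= g (w.1 / t, w.2 / t)%R)%E by exact: g0.
have k0 : (0 <= (hweight p t * t ^- 2)%:E :> \bar R)%E.
  by rewrite lee_fin mulr_ge0 ?hweight_ge0// invr_ge0 exprn_ge0// ltW.
have t2 : t ^+ 2 != 0 by rewrite expf_neq0// gt_eqF.
rewrite (ge0_integralZl area measurableT mgt (fun w _ => gt0 w) k0).
rewrite (area_dilation t0 mg g0) muleA -EFinM -mulrA (mulVf t2) mulr1.
by rewrite (bergman_int_absext p1).
Qed.

End dilated.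

Section norm_bound.
Context {R : realType}.
Implicit Types (f : R[i] -> R[i]) (z l : R[i]).
Notation normc := (@normc R).
Notation mR := (measurableTypeR R).
Notation leb := (@lebesgue_measure R).
Notation area := ((leb \x leb)%E).
Variables (p : R) (p1 : 1 <= p).
Variable mu : {measure set mR -> \bar R}.
Hypothesis hmu : sigma_finite (@half_line R) mu.
Variable I : R.
Hypothesis hI : (\int[mu]_(t in half_line) (hweight p t)%:E)%E = I%:E.

Let p0 : 0 < p. Proof. exact: lt_le_trans p1. Qed.

Let hI' : (\int[mu]_(t in half_line) (hweight p t)%:E < +oo)%E.
Proof. by rewrite hI ltry. Qed.

Let I0 : 0 <= I.
Proof. by rewrite -lee_fin -hI; apply: integral_ge0 => t _; rewrite lee_fin hweight_ge0. Qed.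

(** The modulus of the integrand is the weight times X t = |f (z / t)| t ^ (- 2 / p), and X ^ p
    carries the factor t ^ (- 2) that matches the dilation of area. *)
Lemma hausdorff_pointwise f (a b : R) : bergman_space p f -> 0 < b ->
  ((normc (hausdorff mu f (a +i* b)) `^ p)%:E <=
   (I `^ (p - 1))%:E * \int[mu]_(t in half_line) dilated p f ((a, b), t))%E.
Proof.
move=> hf b0.
have hz : upper_half_plane (a +i* b) by [].
have [K K0 hK] := bergman_growth p1 hf.
have [cn _ _] := holomorphic_continuous hf.1.
pose X (t : mR) : R := normc (f ((a +i* b) / t%:C)) * t `^ (- (2 / p)).
have cint := integrand_cintegrable p1 hI' hf hz.
have nE (t : mR) : half_line t -> normc (hausdorff_integrand f (a +i* b) t) = hweight p t * X t.
  move=> Dt; have t0 := half_line_gt0 Dt.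
  rewrite integrandE normc_realM ?invr_ge0 ?(ltW t0)// hweightE// /X.
  rewrite -mulrA; congr (_ * _); rewrite mulrCA -powRD ?subrr ?powRr0 ?mulr1//.
  by rewrite (gt_eqF t0) implybT.
have mX : measurable_fun half_line X.
  apply: measurable_funM; first exact: (measurable_dilate cn).
  exact: measurable_funTS (measurable_powR _).
have mh : measurable_fun (@half_line R) (hweight p : mR -> mR) by exact: measurable_hweight.
have X0 t : 0 <= X t by rewrite mulr_ge0 ?powR_ge0 ?normc_ge0.
have h0 t : 0 <= hweight p t by exact: hweight_ge0.
have hX0 t : 0 <= hweight p t * X t by exact: mulr_ge0.
have bnd t : half_line t -> hweight p t * X t <= K * b `^ (- (2 / p)) * hweight p t.
  by move=> Dt; rewrite -nE//; apply: integrand_bound => // w /hK[].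
have ihX : mu.-integrable half_line (EFin \o (fun t => hweight p t * X t)).
  apply: (le_integrable measurable_half_line _ _ (integrableZl measurable_half_line (K * b `^ (- (2 / p))) (hweight_integrable hI'))).
    by apply/measurable_EFinP; exact: measurable_funM.
  move=> t Dt /=; rewrite lee_fin (ger0_norm (hX0 t)).
  by rewrite (le_trans (bnd _ Dt))// ler_norm.
pose M := Rintegral mu half_line (fun t => hweight p t * X t).
have ME : (\int[mu]_(t in half_line) (hweight p t * X t)%:E)%E = M%:E.
  by rewrite /M /Rintegral fineK//; exact: (integrable_fin_num measurable_half_line ihX).
have M0 : 0 <= M by apply: Rintegral_ge0 => t _; rewrite mulr_ge0.
have IM : I = 0 -> M = 0.
  move=> Iz; apply/eqP; rewrite eq_le M0 andbT -lee_fin -ME.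
  apply: (@le_trans _ _ (\int[mu]_(t in half_line) ((K * b `^ (- (2 / p)))%:E * (hweight p t)%:E))%E).
    apply: ge0_le_integral => //.
    - exact: measurable_half_line.
    - by move=> t _; rewrite lee_fin mulr_ge0.
    - by apply/measurable_EFinP; exact: measurable_funM.
    - by apply: emeasurable_funM; [exact: measurable_cst|exact/measurable_EFinP].
  rewrite ge0_integralZl//; last 3 first.
  - exact/measurable_EFinP.
  - by move=> t _; rewrite lee_fin.
  - by rewrite lee_fin mulr_ge0// powR_ge0.
  - by rewrite hI Iz mule0.
  - exact: measurable_half_line.
have le_M : normc (hausdorff mu f (a +i* b)) <= M.
  apply: (normc_cintegral measurable_half_line cint ihX) => t Dt.
  by rewrite nE.
rewrite (@le_trans _ _ (M `^ p)%:E)//.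
  by rewrite lee_fin; apply: ge0_ler_powR; rewrite ?nnegrE ?normc_ge0// ltW.
rewrite (le_trans (weighted_jensen p1 measurable_half_line mh mX h0 X0 hI ME IM))//.
rewrite lee_wpmul2l ?lee_fin ?powR_ge0// le_eqVlt; apply/orP; left; apply/eqP.
apply: eq_integral => t; rewrite inE => Dt; have t0 := half_line_gt0 Dt.
rewrite /dilated/= powR_inv1 ?(ltW t0)//; congr (_ * _)%:E.
rewrite /X powRM ?normc_ge0 ?powR_ge0//; congr (_ * _).
  by rewrite /absext patchE mem_set ?div_realC// /half_plane2/upper_half_plane/= divr_gt0.
rewrite -powRrM mulNr divfK ?gt_eqF// powRN (powR_mulrn 2) ?(ltW t0)//.
by rewrite exprVn.
Qed.

Lemma hausdorff_int_bound f : bergman_space p f ->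
  (bergman_int p (hausdorff mu f) <= (I `^ p)%:E * bergman_int p f)%E.
Proof.
move=> hf; have hol := hf.1.
have [cn _ _] := holomorphic_continuous (hausdorff_holomorphic p1 hI' hf).
have mJ := measurable_half_line_integral hmu (measurable_dilated p hol) (dilated_ge0 p f).
have J0 (w : mR * mR) : (0 <= \int[mu]_(t in half_line) dilated p f (w, t))%E.
  by apply: integral_ge0 => t _; exact: dilated_ge0.
have Ip0 : (0 <= (I `^ (p - 1))%:E :> \bar R)%E by rewrite lee_fin powR_ge0.
apply: (@le_trans _ _ (\int[area]_(w in half_plane2)
    ((I `^ (p - 1))%:E * \int[mu]_(t in half_line) dilated p f (w, t)))%E).
  apply: ge0_le_integral.
  - exact: measurable_half_plane2.
  - by move=> w _; rewrite lee_fin powR_ge0.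
  - apply/measurable_EFinP; apply: (measurableT_comp (measurable_powR p)).
    exact: (continuous_on_uhp_measurable cn).
  - by apply: measurable_funTS; apply: emeasurable_funM.
  - by move=> [a b] hw; exact: hausdorff_pointwise.
apply: (@le_trans _ _ (\int[area]_w
    ((I `^ (p - 1))%:E * \int[mu]_(t in half_line) dilated p f (w, t)))%E).
  apply: ge0_subset_integral => //; first exact: measurable_half_plane2.
    by apply: emeasurable_funM.
  by move=> w _; rewrite mule_ge0.
rewrite ge0_integralZl// half_line_tonelli//; [|exact: measurable_dilated|exact: dilated_ge0].
rewrite -(mulr_powRB1 I0 p0) mulrC EFinM -muleA lee_wpmul2l// le_eqVlt; apply/orP; left; apply/eqP.
transitivity (\int[mu]_(t in half_line) ((hweight p t)%:E * bergman_int p f))%E.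
  by apply: eq_integral => t; rewrite inE => Dt; exact: (dilated_area p1).
rewrite ge0_integralZr ?hI//.
- exact: measurable_half_line.
- by apply/measurable_EFinP; exact: measurable_hweight.
- by move=> t _; rewrite lee_fin hweight_ge0.
- exact: bergman_int_ge0.
Qed.

Lemma hausdorff_norm_bound f : bergman_space p f ->
  (bergman_norm p (hausdorff mu f) <= I%:E * bergman_norm p f)%E.
Proof.
move=> hf; rewrite !bergman_normE.
have pV : 0 < p^-1 by rewrite invr_gt0.
have pi0 : (0 <= (pi^-1)%:E :> \bar R)%E by rewrite lee_fin invr_ge0 pi_ge0.
have B0 := bergman_int_ge0 p f.
have -> : I%:E = ((I `^ p)%:E `^ p^-1)%E.
  by rewrite poweR_EFin -powRrM divff ?gt_eqF// powRr1.
rewrite -poweRM ?mule_ge0 ?lee_fin ?powR_ge0//.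
apply: gt0_ler_poweR; rewrite ?(ltW pV)//.
- by rewrite in_itv/= leey andbT; apply: mule_ge0; [exact: pi0|exact: bergman_int_ge0].
- by rewrite in_itv/= leey andbT; apply: mule_ge0; [rewrite lee_fin powR_ge0|exact: mule_ge0].
by rewrite muleCA lee_wpmul2l// hausdorff_int_bound.
Qed.

Lemma hausdorff_bounded_integral : hausdorff_bounded mu p.
Proof.
split.
- by move=> f hf z hz; exact: (integrand_cintegrable p1 hI' hf hz).
- move=> f hf; split; first exact: (hausdorff_holomorphic p1 hI' hf).
  rewrite (le_lt_trans (hausdorff_norm_bound hf))//.
  have [_ Boo] := hf.
  by rewrite lte_mul_pinfty ?lee_fin.
- by exists I; split=> // f hf; exact: hausdorff_norm_bound.
Qed.

End norm_bound.

(** * The complex exponential and logarithm *)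

Section complex_exp_log.
Context {R : realType}.
Implicit Types (f : R[i] -> R[i]) (z w l h : R[i]).
Notation normc := (@normc R).

Lemma is_derive_eps (f : R -> R) (x l : R) : is_derive x 1 f l ->
  forall e : R, 0 < e -> exists2 d : R, 0 < d &
    forall k, `|k| < d -> `|f (x + k) - f x - l * k| <= e * `|k|.
Proof.
move=> [df fl] e e0.
have : \forall h \near (0 : R)^', `|l - h^-1 *: (f (h *: 1 + x) - f x)| <= e.
  by move: df => /cvgrPdist_le; rewrite -/(derive f x 1) fl; apply.
rewrite near_withinE => /nbhs_ballP[/= d d0 hd]; exists d => // k kd.
have [->|k0] := eqVneq k 0; first by rewrite addr0 subrr mulr0 subrr normr0 mulr0.
have := hd k; rewrite /ball/= sub0r normrN => /(_ kd k0) H.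
have -> : f (x + k) - f x - l * k = - k * (l - k^-1 *: (f (k *: 1 + x) - f x)).
  by rewrite /GRing.scale/= mulr1 (addrC k x); field.
by rewrite normrM normrN mulrC ler_wpM2r.
Qed.

Definition cexp w : R[i] :=
  (expR (complex.Re w) * cos (complex.Im w)) +i* (expR (complex.Re w) * sin (complex.Im w)).

Lemma cexpD w z : cexp (w + z) = cexp w * cexp z.
Proof.
case: w z => a b [c d]; apply/eqP; rewrite eq_complex /cexp/= expRD cosD sinD.
by apply/andP; split; apply/eqP; ring.
Qed.

Lemma cexp0 : cexp 0 = 1.
Proof. by rewrite /cexp/= expR0 cos0 sin0 mulr0 mulr1. Qed.

Lemma normc_cexp w : normc (cexp w) = expR (complex.Re w).
Proof.
rewrite /cexp/= !exprMn -mulrDr cos2Dsin2 mulr1 sqrtr_sqr ger0_norm//.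
Qed.

Lemma cexp_neq0 w : cexp w != 0.
Proof. by rewrite -normc_gt0 normc_cexp expR_gt0. Qed.

Lemma sqrt_sqrD_le (a b : R) : Num.sqrt (a ^+ 2 + b ^+ 2) <= `|a| + `|b|.
Proof. exact: (normc_le_ReIm (a +i* b)). Qed.

(** With tolerance [e1] in the expansions of exp, cos and sin at 0, the real part is off by at most
    3 e1 |h| and the imaginary part by at most 5 e1 |h|, hence the requirement 8 e1 <= e. *)
Lemma cdiff_cexp0 : cdiff cexp 0 1.
Proof.
move=> e e0.
have [e1 [e10 e1e e11]] : exists e1 : R, [/\ 0 < e1, 8 * e1 <= e & e1 <= 1].
  exists (Num.min (e / 8) 1); split; first by rewrite lt_min ltr01 divr_gt0.
    by rewrite mulrC -ler_pdivlMr// ge_min lexx.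
  by rewrite ge_min lexx orbT.
have [d1 d10 h1] := is_derive_eps (is_derive_expR (0 : R)) e10.
have [d2 d20 h2] := is_derive_eps (is_derive_cos (0 : R)) e10.
have [d3 d30 h3] := is_derive_eps (is_derive_sin (0 : R)) e10.
exists (Num.min (Num.min d1 d2) (Num.min d3 e1)); first by rewrite !lt_min d10 d20 d30 e10.
move=> h; rewrite !lt_min => /andP[/andP[n1 n2] /andP[n3 n4]].
rewrite add0r cexp0 mul1r.
have := ler_Re_normc h; have := ler_Im_normc h.
move: (normc h) n1 n2 n3 n4 => n n1 n2 n3 n4.
case: h => a b /= hb ha.
have := h1 a (le_lt_trans ha n1); have := h2 b (le_lt_trans hb n2); have := h3 b (le_lt_trans hb n3).
rewrite !add0r expR0 cos0 sin0 oppr0 mul0r !oppr0 !addr0 !mul1r => Hs Hc He.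
have n0 : 0 <= n := le_trans (normr_ge0 a) ha.
apply: (le_trans (sqrt_sqrD_le _ _)).
have R1 : `|expR a * cos b - 1 - a| <= 3 * e1 * n.
  have -> : expR a * cos b - 1 - a = (expR a - 1 - a) * cos b + (1 + a) * (cos b - 1) by ring.
  have c1 : `|cos b| <= 1 by rewrite ler_norml cos_geN1 cos_le1.
  have a2 : `|1 + a| <= 2.
    rewrite (le_trans (ler_normD _ _))// normr1 [leRHS](_ : 2 = 1 + 1)// lerD2l.
    by rewrite (le_trans ha)// (le_trans (ltW n4)).
  have H1 : `|(expR a - 1 - a) * cos b| <= e1 * n.
    rewrite normrM (le_trans (ler_wpM2l (normr_ge0 _) c1))// mulr1 (le_trans He)//.
    by rewrite ler_wpM2l// ltW.
  have H2 : `|(1 + a) * (cos b - 1)| <= 2 * (e1 * n).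
    rewrite normrM ler_pM// (le_trans Hc)// ler_wpM2l// ltW//.
  by rewrite (le_trans (ler_normD _ _))// (le_trans (lerD H1 H2))//; lra.
have R2 : `|expR a * sin b - b| <= 5 * e1 * n.
  have -> : expR a * sin b - b = (sin b - b) + (expR a - 1) * sin b by ring.
  have H1 : `|sin b - b| <= e1 * n by rewrite (le_trans Hs)// ler_wpM2l// ltW.
  have S2 : `|sin b| <= 2 * n.
    have -> : sin b = (sin b - b) + b by ring.
    rewrite (le_trans (ler_normD _ _))// mulr_natl mulr2n lerD//.
    by rewrite (le_trans H1)// ler_piMl.
  have E2 : `|expR a - 1| <= 2 * e1.
    have -> : expR a - 1 = (expR a - 1 - a) + a by ring.
    rewrite (le_trans (ler_normD _ _))// mulr_natl mulr2n lerD//; last first.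
      by rewrite (le_trans ha)// ltW.
    rewrite (le_trans He)// ler_piMr ?(ltW e10)// (le_trans ha)// (le_trans (ltW n4))//.
  have H2 : `|(expR a - 1) * sin b| <= (2 * e1) * (2 * n) by rewrite normrM ler_pM.
  by rewrite (le_trans (ler_normD _ _))// (le_trans (lerD H1 H2))//; lra.
rewrite (le_trans (lerD R1 R2))// -mulrDl ler_wpM2r//.
by rewrite (le_trans _ e1e)//; lra.
Qed.

Lemma cdiff_cexp w : cdiff cexp w (cexp w).
Proof.
move=> e e0; have n0 : 0 < normc (cexp w) by rewrite normc_gt0 cexp_neq0.
have [d d0 hd] := cdiff_cexp0 (divr_gt0 e0 n0).
exists d => // h /hd; rewrite add0r cexp0 mul1r => H.
have -> : cexp (w + h) - cexp w - cexp w * h = cexp w * (cexp h - 1 - h).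
  by rewrite cexpD; ring.
by rewrite normcM -ler_pdivlMl// mulrC mulrAC.
Qed.

(* The branch of the logarithm with imaginary part in (0, pi): for [Im z > 0],
   [pi / 2 - atan (Re z / Im z)] is the argument of [z]. *)
Definition clog z : R[i] :=
  ln (normc z) +i* (pi / 2 - atan (complex.Re z / complex.Im z)).

Lemma uhp_neq0 z : upper_half_plane z -> z != 0.
Proof. by rewrite /upper_half_plane/=; apply: contraTneq => ->; rewrite /= ltxx. Qed.

(** Polar form: with n = |z|, the angle atan (x / y) has cosine y / n and sine x / n, and the
    complement to pi / 2 exchanges them. *)
Lemma clogK z : upper_half_plane z -> cexp (clog z) = z.
Proof.
move=> hz; have n0 : 0 < normc z by rewrite normc_gt0 uhp_neq0.
rewrite /cexp/= lnK ?posrE//.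
move: hz n0; rewrite /upper_half_plane; case: z => x y /= y0; set n := Num.sqrt _ => n0.
have yn : y != 0 by rewrite gt_eqF.
have nn : n != 0 by rewrite gt_eqF.
have nE : Num.sqrt (1 + (x / y) ^+ 2) = n / y.
  rewrite -[RHS]ger0_norm; last by rewrite divr_ge0// ltW.
  rewrite -sqrtr_sqr; congr (Num.sqrt _).
  rewrite !expr_div_n sqr_sqrtr ?addr_ge0 ?sqr_ge0//.
  by field; rewrite yn.
have c1 : cos (atan (x / y)) = y / n by rewrite cos_atan nE invf_div.
have s1 : sin (atan (x / y)) = x / n.
  have := atanK (x / y); rewrite /tan c1 => /(congr1 (fun u => u * (y / n))).
  rewrite divfK; last by rewrite mulf_neq0// invr_eq0.
  by move=> ->; field; rewrite yn nn.
rewrite cosB sinB cos_pihalf sin_pihalf c1 s1.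
by apply/eqP; rewrite eq_complex/=; apply/andP; split; apply/eqP; field; rewrite nn.
Qed.

Lemma Im_clog z : 0 < complex.Im (clog z) < pi.
Proof.
rewrite /clog/=; have := atan_gtNpi2 (complex.Re z / complex.Im z).
have := atan_ltpi2 (complex.Re z / complex.Im z).
move: (atan _) => t h1 h2; apply/andP; split; lra.
Qed.

Lemma clog_div z (t : R) : upper_half_plane z -> 0 < t ->
  clog (z / t%:C) = clog z - (ln t)%:C.
Proof.
move=> hz t0; have n0 : 0 < normc z by rewrite normc_gt0 uhp_neq0.
have y0 : complex.Im z != 0 by rewrite gt_eqF.
rewrite /clog normcM -fmorphV normc_real ger0_norm ?invr_ge0 ?(ltW t0)//.
rewrite lnM ?posrE ?invr_gt0// lnV ?posrE//.
rewrite fmorphV div_realC/=; apply/eqP; rewrite eq_complex/= eqxx/= subr0.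
apply/eqP; congr (_ - atan _); field.
by rewrite y0 gt_eqF.
Qed.

Lemma clog_continuous z : upper_half_plane z -> forall e : R, 0 < e ->
  exists2 d : R, 0 < d & forall h, normc h < d -> upper_half_plane (z + h) /\ normc (clog (z + h) - clog z) <= e.
Proof.
move=> hz e e0; have n0 : 0 < normc z by rewrite normc_gt0 uhp_neq0.
have y0 : 0 < complex.Im z by [].
have e2 : 0 < e / 2 by rewrite divr_gt0.
have [d1 /= d10 h1] : exists2 d : R, 0 < d & forall s, `|s - normc z| < d -> `|ln s - ln (normc z)| < e / 2.
  have := continuous_ln n0; move/cvgrPdist_lt/(_ _ e2)/nbhs_ballP => -[d d0 hd].
  by exists d => // s hs; rewrite distrC; apply: hd; rewrite /ball/= distrC.
set q := complex.Re z / complex.Im z.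
have [d2 /= d20 h2] : exists2 d : R, 0 < d & forall s, `|s - q| < d -> `|atan s - atan q| < e / 2.
  have := @continuous_atan R q; move/cvgrPdist_lt/(_ _ e2)/nbhs_ballP => -[d d0 hd].
  by exists d => // s hs; rewrite distrC; apply: hd; rewrite /ball/= distrC.
(* Bounds the increment of Re / Im per unit of |h| as long as Im (z + h) > Im z / 2. *)
pose K := (complex.Im z + `|complex.Re z|) / (complex.Im z * (complex.Im z / 2)).
have K0 : 0 < K by rewrite divr_gt0 ?mulr_gt0 ?divr_gt0// ltr_pwDl.
exists (Num.min (complex.Im z / 2) (Num.min d1 (d2 / K))).
  by rewrite !lt_min d10 (divr_gt0 d20 K0) (divr_gt0 y0).
move=> h; rewrite !lt_min => /andP[n1 /andP[n2 n3]].
have hIm : complex.Im z / 2 < complex.Im (z + h).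
  have := ler_Im_normc h; rewrite ler_norml => /andP[+ _] /=.
  by move: n1; case: (z) (h) => ? ? [? ?] /=; lra.
have yh0 : 0 < complex.Im (z + h) by rewrite (lt_trans _ hIm)// divr_gt0.
split=> //.
apply: (le_trans (sqrt_sqrD_le _ _)); rewrite [e]splitr lerD//=.
  apply/ltW/h1/(le_lt_trans _ n2).
  have := le_normcD (z + h) (- h); rewrite addrK normcN; have := le_normcD z h.
  move: (normc _) (normc z) (normc h) => u v n Huv Hvu.
  by rewrite ler_norml; apply/andP; split; lra.
rewrite opprB [_ - _ + _]addrC addrA subrK distrC; apply/ltW/h2.
have -> : complex.Re (z + h) / complex.Im (z + h) - q =
   (complex.Re h * complex.Im z - complex.Re z * complex.Im h) / (complex.Im z * complex.Im (z + h)).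
  have ny : complex.Im z != 0 by rewrite gt_eqF.
  have nyh : complex.Im (z + h) != 0 by rewrite gt_eqF.
  rewrite /q; move: ny nyh; case: (z) (h) => x y [a b] /= ny nyh.
  by field; rewrite ny nyh.
have D0 : 0 < complex.Im z * complex.Im (z + h) by rewrite mulr_gt0.
rewrite normrM normfV (gtr0_norm D0) ltr_pdivrMr//.
have N1 : `|complex.Re h * complex.Im z - complex.Re z * complex.Im h| <=
   normc h * (complex.Im z + `|complex.Re z|).
  rewrite (le_trans (ler_normB _ _))// !normrM mulrDr lerD//.
    by rewrite (gtr0_norm y0) ler_wpM2r ?ler_Re_normc// ltW.
  by rewrite mulrC ler_wpM2r// ler_Im_normc.
rewrite (le_lt_trans N1)//.
move: n3; rewrite ltr_pdivlMr// => n3.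
rewrite (@le_lt_trans _ _ (normc h * K * (complex.Im z * (complex.Im z / 2))))//.
  by rewrite /K -mulrA divfK// gt_eqF// mulr_gt0// divr_gt0.
rewrite (@lt_le_trans _ _ (d2 * (complex.Im z * (complex.Im z / 2))))//.
  by rewrite ltr_pM2r// mulr_gt0// divr_gt0.
by rewrite ler_wpM2l ?(ltW d20)// ler_wpM2l ?(ltW y0)// ltW.
Qed.

(* [clog] is a continuous right inverse of [cexp], whose derivative is nonzero. *)
Lemma cdiff_clog z : upper_half_plane z -> cdiff clog z z^-1.
Proof.
move=> hz e e0; have n0 : 0 < normc z by rewrite normc_gt0 uhp_neq0.
pose e1 := Num.min (e * normc z / 2) (1 / 2).
have e10 : 0 < e1 by rewrite lt_min !divr_gt0// mulr_gt0.
have e1h : e1 <= 1 / 2 by rewrite ge_min lexx orbT.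
have e1e : e1 <= e * normc z / 2 by rewrite ge_min lexx.
have [d1 d10 h1] := cdiff_cexp0 e10.
have d12 : 0 < d1 / 2 by rewrite divr_gt0.
have [d d0 hd] := clog_continuous hz d12.
exists d => // h /hd[hzh hk].
set k := clog (z + h) - clog z in hk *.
have kd : normc k < d1 by rewrite (le_lt_trans hk)//; lra.
have := h1 _ kd; rewrite add0r cexp0 mul1r => H.
(* The increment [h] is expressed through the increment [k] of the logarithm: h / z = cexp k - 1 is
   close to [k]. *)
have hE : h = z * (cexp k - 1).
  have : cexp (clog z + k) = z + h by rewrite /k addrC subrK clogK.
  by rewrite cexpD clogK// mulrBr mulr1 => ->; rewrite addrC addKr.
have H2 : normc (k - z^-1 * h) <= e1 * normc k.
  rewrite hE mulKf ?uhp_neq0// -normcN (le_trans _ H)// le_eqVlt; apply/orP; left; apply/eqP.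
  by congr (normc _); ring.
(* The error term is at most |k| / 2 and is absorbed on the left. *)
have kb : normc k <= 2 * (normc h / normc z).
  have : normc k <= normc (k - z^-1 * h) + normc (z^-1 * h).
    by rewrite (le_trans _ (le_normcD _ _))// subrK.
  rewrite [normc (z^-1 * h)]normcM normcV (mulrC (normc z)^-1) => H3.
  have : e1 * normc k <= 1 / 2 * normc k by rewrite ler_wpM2r// normc_ge0.
  move: (normc (k - _)) (normc h / normc z) (normc k) H2 H3 => u v s H2 H3 H4; lra.
rewrite (le_trans H2)// (le_trans (ler_wpM2l (ltW e10) kb))//.
rewrite (le_trans (ler_wpM2r _ e1e))//.
  by rewrite mulr_ge0// divr_ge0// normc_ge0.
by rewrite le_eqVlt; apply/orP; left; apply/eqP; field; rewrite gt_eqF.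
Qed.

End complex_exp_log.

(** * The test functions *)

Section holomorphic_algebra.
Context {R : realType}.
Implicit Types (f g : R[i] -> R[i]) (z w l h : R[i]).
Notation normc := (@normc R).

Lemma cderivable_comp f g z :
  cderivable f z -> cderivable g (f z) -> cderivable (g \o f) z.
Proof.
move=> /derivable1_diffP hf /derivable1_diffP hg; apply/derivable1_diffP.
exact: (@differentiable_comp _ R[i]^o R[i]^o R[i]^o f g z hf hg).
Qed.

Lemma cderivable_scale (a : R[i]) f z : cderivable f z -> cderivable (fun w => a * f w) z.
Proof. exact: derivableZ. Qed.

Lemma cderivable_cexp z : cderivable cexp z.
Proof. exact/cdiff_derivable/cdiff_cexp. Qed.

Lemma cderivable_clog z : upper_half_plane z -> cderivable clog z.
Proof. by move=> hz; exact/cdiff_derivable/cdiff_clog. Qed.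

Lemma cderivable_powc (a z : R[i]) : upper_half_plane z ->
  cderivable (fun w => cexp (a * clog w)) z.
Proof.
move=> hz; apply: (@cderivable_comp (fun w => a * clog w)); last exact: cderivable_cexp.
exact/cderivable_scale/cderivable_clog.
Qed.

End holomorphic_algebra.

Section test_function.
Context {R : realType}.
Implicit Types (z w l h : R[i]).
Notation normc := (@normc R).
Variables (p e : R).
Hypothesis e0 : 0 < e.
Hypothesis e2 : e < 1 / 2.

Definition testden (u : R[i]) : R[i] := cexp (e%:C * u) + cexp ((- e)%:C * u).

(* [z ^ (- 2 / p) / (z ^ e + z ^ (- e))] *)
Definition testfun z : R[i] := cexp ((- (2 / p))%:C * clog z) * (testden (clog z))^-1.

(** This is 2 cosh (e a): [testden] is u -> 2 cosh (e u), and [growth] is its restriction to the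
    real axis. *)
Definition growth (a : R) : R := expR (e * a) + expR (- e * a).

(** Lower bound for the cosine of the angles e theta with 0 < theta < pi, positive because 0 < e < 1
    / 2; it tends to 1 as e -> 0. *)
Definition aperture : R := cos (e * pi).

Lemma aperture_gt0 : 0 < aperture.
Proof.
have pi0 := @pi_gt0 R; apply: cos_gt0_pihalf; apply/andP; split.
  by rewrite (@lt_trans _ _ 0)// ?oppr_lt0 ?divr_gt0// mulr_gt0.
by rewrite mulrC ltr_pM2l// -[X in _ < X]mul1r.
Qed.

Lemma growth_gt0 a : 0 < growth a.
Proof. by rewrite addr_gt0// expR_gt0. Qed.

Lemma Re_testden u : complex.Re (testden u) = growth (complex.Re u) * cos (e * complex.Im u).
Proof.
case: u => a b; rewrite /testden /cexp /growth/= !mul0r !subr0 !addr0.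
by rewrite !mulNr cosN mulrDl.
Qed.

(** The real part is [growth] times cos (e Im u), and the cosine decreases on [0, pi]. In particular
    the denominator of the test function has no zero. *)
Lemma testden_lower u : 0 < complex.Im u < pi ->
  aperture * growth (complex.Re u) <= complex.Re (testden u).
Proof.
move=> /andP[u0 u1]; have pi0 := @pi_gt0 R.
rewrite Re_testden mulrC ler_pM2l ?growth_gt0// /aperture.
have e1 : e <= 1 by rewrite (le_trans (ltW e2))// ler_pdivrMr// mul1r ler1n.
rewrite leNgt ltr_cos ?in_itv/= -?leNgt.
- by rewrite ler_pM2l// ltW.
- by rewrite mulr_ge0 ?(ltW e0) ?(ltW pi0)//= ler_piMl// ltW.
- by rewrite mulr_ge0 ?(ltW e0) ?(ltW u0)//= (le_trans _ (ltW u1))// ler_piMl// ltW.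
Qed.

Lemma testden_upper u : normc (testden u) <= growth (complex.Re u).
Proof.
rewrite (le_trans (le_normcD _ _))// !normc_cexp /growth.
by case: u => a b /=; rewrite !mul0r !subr0.
Qed.

Lemma testden_gt0 u : 0 < complex.Im u < pi -> 0 < normc (testden u).
Proof.
move=> hu; rewrite (lt_le_trans _ (ler_Re_normc _))// (lt_le_trans _ (ler_norm _))//.
by rewrite (lt_le_trans _ (testden_lower hu))// mulr_gt0 ?growth_gt0 ?aperture_gt0.
Qed.

Lemma testfun_holomorphic : holomorphic_on (@upper_half_plane R) testfun.
Proof.
move=> z hz.
have H1 := @cderivable_powc _ (- (2 / p))%:C z hz.
have H2 : cderivable (fun w => testden (clog w)) z.
  exact: (derivableD (@cderivable_powc _ e%:C z hz) (@cderivable_powc _ (- e)%:C z hz)).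
have H3 : cderivable (fun w => (testden (clog w))^-1) z.
  by apply: (derivableV _ H2); rewrite -normc_gt0; exact/testden_gt0/Im_clog.
exact: (derivableM H1 H3).
Qed.

Lemma normc_testfun z : normc (testfun z) =
  expR (- (2 / p) * ln (normc z)) / normc (testden (clog z)).
Proof. by rewrite /testfun normcM normcV normc_cexp /= mul0r subr0. Qed.

Lemma testfun_gt0 z : 0 < normc (testfun z).
Proof. by rewrite normc_testfun divr_gt0 ?expR_gt0 ?testden_gt0 ?Im_clog. Qed.

(** In terms of r = |z| the bound is a constant times r ^ (- 2 / p) min (r, 1 / r) ^ e; the last
    factor gives p-integrability both at 0 and at infinity. *)
Lemma testfun_upper z : normc (testfun z) <=
  aperture^-1 * expR (- (2 / p) * ln (normc z)) * expR (- e * `|ln (normc z)|).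
Proof.
rewrite normc_testfun -[leRHS]mulrA mulrCA ler_wpM2l ?expR_ge0//.
have := testden_lower (Im_clog z); rewrite [complex.Re (clog z)]/=.
set a := ln _ => H.
have g1 : expR (e * `|a|) <= growth a.
  rewrite /growth; have [a0|a0] := leP 0 a.
    by rewrite ger0_norm// lerDl expR_ge0.
  by rewrite ltr0_norm// mulrN -mulNr lerDr expR_ge0.
have P : aperture * expR (e * `|a|) <= normc (testden (clog z)).
  rewrite (le_trans _ (le_trans (ler_norm _) (ler_Re_normc _)))// (le_trans _ H)//.
  by rewrite ler_pM2l ?aperture_gt0.
rewrite mulNr expRN -invfM lef_pV2 ?posrE ?testden_gt0 ?Im_clog//.
by rewrite mulr_gt0 ?aperture_gt0 ?expR_gt0.
Qed.

(** Separates the variables: with a = ln |z| and s = ln t, the dependence on [t] becomes a factor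
    exp (e |ln t|). *)
Lemma growthB (a s : R) : growth (a - s) <= expR (e * `|s|) * growth a.
Proof.
rewrite /growth [leRHS]mulrDr -!expRD lerD// ler_expR; have := ler_norm s; have := lerNnormlW (lexx `|s|).
  by move=> H1 H2; rewrite mulrBr addrC lerD2r -mulrN ler_pM2l// lerNl.
by move=> H1 H2; rewrite mulrBr addrC lerD2r mulNr opprK ler_pM2l.
Qed.

(* The factor [z ^ (2 / p)] reduces the integrand to [hweight t / testden u] with
   [u = log (z / t)], and the argument of [testden u] is at most [e * pi]. *)
Lemma Re_integrand_testfun z (t : R) : upper_half_plane z -> half_line t ->
  aperture / growth (ln (normc z)) * (hweight p t * expR (- e * `|ln t|)) <=
  complex.Re (cexp ((2 / p)%:C * clog z) * hausdorff_integrand testfun z t).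
Proof.
move=> hz ht; have t0 := half_line_gt0 ht.
have hzt := uhp_div hz ht.
set D := testden (clog (z / t%:C)).
have E1 : cexp ((2 / p)%:C * clog z) * hausdorff_integrand testfun z t = (hweight p t)%:C * D^-1.
  have K : cexp ((2 / p)%:C * clog z) * cexp ((- (2 / p))%:C * clog (z / t%:C)) = (t `^ (2 / p))%:C.
    rewrite -cexpD clog_div// rmorphN mulNr mulrBr opprB addrCA subrr addr0 -rmorphM.
    by rewrite /cexp/= cos0 sin0 mulr0 mulr1 mulrC expRM lnK// posrE.
  have -> : (hweight p t)%:C = (t^-1)%:C * (t `^ (2 / p))%:C.
    by rewrite hweightE//; exact: rmorphM.
  by rewrite integrandE /testfun -/D -K; ring.
rewrite E1 Re_realM mulrCA ler_wpM2l ?hweight_ge0//.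
have DL : aperture * growth (ln (normc z) - ln t) <= complex.Re D.
  have := testden_lower (Im_clog (z / t%:C)); rewrite -/D.
  by rewrite [X in complex.Re X](clog_div hz t0).
have DU : normc D <= growth (ln (normc z) - ln t).
  have := testden_upper (clog (z / t%:C)); rewrite -/D.
  by rewrite [X in complex.Re X](clog_div hz t0).
have GB := growthB (ln (normc z)) (ln t).
have D0 : 0 < normc D by exact/testden_gt0/Im_clog.
(* The lower bound on Re D and the upper bound on |D| involve the same value of [growth], so Re D /
   |D| ^ 2 is at least [aperture] divided by that value. *)
have ReV : complex.Re D^-1 = complex.Re D / normc D ^+ 2.
  by case: (D) D0 => x y /= D0; rewrite sqr_sqrtr// addr_ge0// sqr_ge0.
rewrite ReV ler_pdivlMr ?exprn_gt0//.
apply: (le_trans _ DL).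
rewrite -mulrA -mulrA ler_pM2l ?aperture_gt0//.
have G0 := growth_gt0 (ln (normc z)).
move: (growth_gt0 (ln (normc z) - ln t)) => G1.
rewrite ler_pdivrMl//.
apply: (@le_trans _ _ (expR (- e * `|ln t|) * growth (ln (normc z) - ln t) ^+ 2)).
  by rewrite ler_pM2l ?expR_gt0// ler_pXn2r ?nnegrE ?normc_ge0 ?(ltW G1).
rewrite expr2 mulrA ler_pM2r// mulrC mulNr expRN ler_pdivrMr ?expR_gt0// mulrC.
exact: GB.
Qed.

End test_function.

(** * Integrability of the radial majorant *)

Section radial.
Context {R : realType}.
Notation mR := (measurableTypeR R).
Notation leb := (@lebesgue_measure R).
Notation area := ((leb \x leb)%E).
Notation normc := (@normc R).

Lemma dyadic (r : R) : 1 <= r -> exists n, 2 ^+ n <= r < 2 ^+ n.+1.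
Proof.
move=> r1; have ex : exists n, r < 2 ^+ n by exists (Num.bound r); apply: upper_nthrootP.
case: (ex_minnP ex) => -[|n] hn hmin.
  by move: hn; rewrite expr0 ltNge r1.
exists n; rewrite hn andbT leNgt; apply/negP => /hmin.
by rewrite ltnn.
Qed.

Lemma geometric_partial (q : R) n : 0 <= q < 1 -> \sum_(0 <= i < n) q ^+ i <= (1 - q)^-1.
Proof.
move=> /andP[q0 q1]; have h : 0 < 1 - q by rewrite subr_gt0.
rewrite -[leRHS]mul1r ler_pdivlMr// mulrC.
have -> : (1 - q) * (\sum_(0 <= i < n) q ^+ i) = 1 - q ^+ n.
  by apply: oppr_inj; rewrite -mulNr !opprB big_mkord subrX1.
by rewrite gerBl exprn_ge0.
Qed.

Variable d : R.
Hypothesis d0 : 0 < d.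

(** q = 2 ^ (- d), the decay gained from one dyadic shell to the next. *)
Let q := expR (- d * ln 2).

Let q01 : 0 <= q < 1.
Proof.
by rewrite expR_ge0 -expR0 ltr_expR mulNr oppr_lt0 mulr_gt0// ln_gt0// ltr1n.
Qed.

(** The first square serves moduli of order 2 ^ n, the second those of order 2 ^ (- n). The factors
    4 ^ (- n) and 4 ^ n are of the order of |z| ^ (- 2) there and cancel against the areas, so the
    integrals form a geometric series. The constant 4 / q absorbs the passage from a shell to a
    square containing it. *)
Definition dyadic_term (n : nat) (w : mR * mR) : R :=
  4 / q * q ^+ n * (4 ^- n * \1_[set w | box (2 ^+ n) w] w + 4 ^+ n * \1_[set w | box (2 ^- n) w] w).

Lemma dyadic_term_ge0 n w : 0 <= dyadic_term n w.
Proof.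
have q0 := expR_ge0 (- d * ln 2).
rewrite /dyadic_term; apply: mulr_ge0; first by rewrite mulr_ge0 ?divr_ge0 ?exprn_ge0.
by rewrite addr_ge0// mulr_ge0// ?invr_ge0 exprn_ge0.
Qed.

Lemma measurable_dyadic_term n : measurable_fun [set: mR * mR] (fun w => (dyadic_term n w)%:E).
Proof.
apply/measurable_EFinP; apply: measurable_funM => //.
by apply: measurable_funD; apply: measurable_funM => //; apply: measurable_indic; exact: measurable_box.
Qed.

Lemma dyadic_term_area n : (\int[area]_w (dyadic_term n w)%:E = (32 / q * q ^+ n)%:E)%E.
Proof.
have q0 := expR_gt0 (- d * ln 2).
have K0 : 0 <= 4 / q * q ^+ n by rewrite mulr_ge0 ?exprn_ge0 ?divr_ge0 ?(ltW q0).
have mi (r : R) : measurable_fun [set: mR * mR] (fun w : mR * mR => (\1_[set w | box r w] w)%:E).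
  by apply/measurable_EFinP; apply: measurable_indic; exact: measurable_box.
have mf (a r : R) : measurable_fun [set: mR * mR] (fun w : mR * mR => a%:E * (\1_[set w | box r w] w)%:E)%E.
  exact: emeasurable_funM.
have f0 (a r : R) (w : mR * mR) : 0 <= a -> (0 <= a%:E * (\1_[set w | box r w] w)%:E)%E.
  by move=> a0; rewrite mule_ge0.
have a0 : (0 : R) <= 4 ^- n by rewrite invr_ge0 exprn_ge0.
have b0 : (0 : R) <= 4 ^+ n by rewrite exprn_ge0.
transitivity (\int[area]_w ((4 / q * q ^+ n)%:E * ((4 ^- n)%:E * (\1_[set w | box (2 ^+ n) w] w)%:E +
   (4 ^+ n)%:E * (\1_[set w | box (2 ^- n) w] w)%:E)))%E.
  by apply: eq_integral => w _; rewrite -!EFinM.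
rewrite ge0_integralZl//; last 2 first.
- exact: emeasurable_funD.
- by move=> w _; rewrite adde_ge0// f0.
rewrite (ge0_integralD _ measurableT (fun w _ => f0 _ _ w a0) (mf _ _) (fun w _ => f0 _ _ w b0) (mf _ _)).
rewrite !ge0_integralZl ?lee_fin ?invr_ge0 ?exprn_ge0//.
have ib (r : R) : 0 < r -> (\int[area]_w (\1_[set w | box r w] w)%:E = (4 * r ^+ 2)%:E)%E.
  move=> r0; have mb := @measurable_box R r.
  by rewrite integral_indic// setIT; exact: area_box.
have two (m : nat) : (0 : R) < 2 ^+ m by rewrite exprn_gt0.
have p4 : (2 : R) ^+ n ^+ 2 = 4 ^+ n by rewrite -exprM mulnC exprM -natrX.
have n4 : (4 : R) ^+ n != 0 by rewrite expf_neq0.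
have q1 : q != 0 by rewrite gt_eqF.
rewrite !ib ?invr_gt0//.
rewrite -!EFinM; congr (_%:E).
rewrite exprVn p4; move: (4 ^+ n) (q ^+ n) n4 => a b n4.
by field; rewrite n4 q1.
Qed.

Let decay (s : R) n : 2 ^+ n <= s -> expR (- d * ln s) <= q ^+ n.
Proof.
have two : (0 : R) < 2 ^+ n by rewrite exprn_gt0.
move=> hs; rewrite /q -expRM_natl ler_expR !mulNr mulrN lerN2 mulrCA ler_pM2l//.
rewrite mulr_natl -lnXn// ler_ln ?posrE//.
exact: lt_le_trans hs.
Qed.

Lemma radial_dyadic (w : mR * mR) : half_plane2 w -> exists n,
  expR (- 2 * ln (normc (w.1 +i* w.2))) * expR (- d * `|ln (normc (w.1 +i* w.2))|) <=
  dyadic_term n w.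
Proof.
move=> hw; have r0 : 0 < normc (w.1 +i* w.2) by rewrite normc_gt0 uhp_neq0.
have h1 := ler_Re_normc (w.1 +i* w.2); have h2 := ler_Im_normc (w.1 +i* w.2).
move: (normc _) h1 h2 r0 => r /= h1 h2 r0.
have q0 : 0 < q := expR_gt0 (- d * ln 2).
have two (m : nat) : (0 : R) < 2 ^+ m by rewrite exprn_gt0.
have p4 m : (2 : R) ^+ m ^+ 2 = 4 ^+ m by rewrite -exprM mulnC exprM -natrX.
have four (m : nat) : (0 : R) < 4 ^+ m by rewrite exprn_gt0.
have -> : expR (- 2 * ln r) = r ^- 2 by rewrite mulNr expRN expRM_natl lnK// posrE.
have inbox (s : R) : r <= s -> w \in [set w | box s w].
  by move=> rs; rewrite inE /= /box (le_trans h1 rs) (le_trans h2 rs).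
have [r1|r1] := leP 1 r.
  (* The shell reaches up to 2 ^ (n + 1), so the square of index n + 1 is taken; 4 / q pays for the
     shift exactly. *)
  have [n /andP[n1 n2]] := dyadic r1; exists n.+1.
  rewrite ger0_norm ?ln_ge0// /dyadic_term indicE inbox ?(ltW n2)// mulr1.
  apply: (@le_trans _ _ (4 ^- n * q ^+ n)).
    rewrite ler_pM ?expR_ge0 ?invr_ge0 ?exprn_ge0 ?(ltW r0) ?decay//.
    rewrite lef_pV2 ?posrE ?exprn_gt0// -p4 ler_pXn2r ?nnegrE ?(ltW r0) ?(ltW (two n))//.
  apply: (@le_trans _ _ (4 / q * q ^+ n.+1 * 4 ^- n.+1)).
    rewrite !exprS le_eqVlt; apply/orP; left; apply/eqP; field.
    by rewrite !gt_eqF ?four ?q0.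
  by rewrite ler_wpM2l ?lerDl ?mulr_ge0 ?invr_ge0 ?exprn_ge0 ?divr_ge0 ?(ltW q0).
have s1 : 1 <= r^-1 by rewrite invf_ge1// ltW.
(* Here 1 / |z| >= 2 ^ n already puts the point in the square of index n; only the factor 4 is
   lost. *)
have [n /andP[n1 n2]] := dyadic s1; exists n.
have rn : r <= 2 ^- n by rewrite -[r]invrK lef_pV2 ?posrE ?invr_gt0.
rewrite ltr0_norm ?ln_lt0 ?r0// -lnV ?posrE//.
rewrite /dyadic_term [X in _ + _ * X]indicE inbox// mulr1.
apply: (@le_trans _ _ (4 ^+ n.+1 * q ^+ n)).
  rewrite ler_pM ?expR_ge0 ?invr_ge0 ?exprn_ge0 ?(ltW r0) ?decay//.
  by rewrite -exprVn -p4 ler_pXn2r ?nnegrE ?invr_ge0 ?(ltW r0) ?(ltW (two _)) ?(ltW n2).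
apply: (@le_trans _ _ (4 / q * q ^+ n * 4 ^+ n)).
  rewrite exprS mulrAC ler_pM2r ?exprn_gt0// ler_pM2r ?exprn_gt0//.
  by rewrite ler_pMr// invf_ge1// ltW//; case/andP: q01.
by rewrite ler_wpM2l ?lerDr ?mulr_ge0 ?invr_ge0 ?exprn_ge0 ?divr_ge0 ?(ltW q0).
Qed.

Lemma dyadic_sum_integral : (\int[area]_w (\sum_(0 <= n <oo) (dyadic_term n w)%:E) < +oo)%E.
Proof.
rewrite integral_nneseries//; last 2 first.
- exact: measurable_dyadic_term.
- by move=> n w _; rewrite lee_fin dyadic_term_ge0.
have q0 : 0 < q := expR_gt0 (- d * ln 2).
rewrite (@le_lt_trans _ _ (32 / q * (1 - q)^-1)%:E) ?ltry//.
apply: lime_le.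
  by apply: is_cvg_nneseries => n _ _; rewrite integral_ge0// => w _; rewrite lee_fin dyadic_term_ge0.
apply: nearW => n; under eq_bigr do rewrite dyadic_term_area.
rewrite sumEFin lee_fin -mulr_sumr ler_wpM2l ?geometric_partial//.
by rewrite divr_ge0// ltW.
Qed.

Lemma measurable_radial : measurable_fun half_plane2 (fun w : mR * mR =>
  expR (- 2 * ln (normc (w.1 +i* w.2))) * expR (- d * `|ln (normc (w.1 +i* w.2))|)).
Proof.
have idh : holomorphic_on (@upper_half_plane R) (fun z => z) by move=> z _; exact: derivable_id.
have [cn _ _] := holomorphic_continuous idh.
have mn := continuous_on_uhp_measurable cn.
have ml : measurable_fun half_plane2 (fun w : mR * mR => ln (normc (w.1 +i* w.2)) : mR).
  apply: (measurableT_comp _ mn); exact: measurable_ln.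
apply: measurable_funM; apply: (measurableT_comp (@measurable_expR R)); apply: measurable_funM => //.
exact: (measurableT_comp _ ml).
Qed.

Lemma radial_integral : (\int[area]_(w in half_plane2)
  (expR (- 2 * ln (normc (w.1 +i* w.2))) * expR (- d * `|ln (normc (w.1 +i* w.2))|))%:E < +oo)%E.
Proof.
apply: (le_lt_trans _ dyadic_sum_integral).
have ms : measurable_fun [set: mR * mR] (fun w => \sum_(0 <= n <oo) (dyadic_term n w)%:E)%E.
  apply: ge0_emeasurable_sum.
    by move=> n w _ _; rewrite lee_fin dyadic_term_ge0.
  by move=> n _; exact: measurable_dyadic_term.
have s0 w : (0 <= \sum_(0 <= n <oo) (dyadic_term n w)%:E)%E.
  by apply: nneseries_ge0 => n _ _; rewrite lee_fin dyadic_term_ge0.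
apply: (@le_trans _ _ (\int[area]_(w in half_plane2) \sum_(0 <= n <oo) (dyadic_term n w)%:E)%E).
  apply: ge0_le_integral.
  - exact: measurable_half_plane2.
  - by move=> w _; rewrite lee_fin mulr_ge0// expR_ge0.
  - by apply/measurable_EFinP; exact: measurable_radial.
  - exact: measurable_funTS.
  move=> w /radial_dyadic[n hn].
  apply: (@le_trans _ _ (dyadic_term n w)%:E); first by rewrite lee_fin.
  apply: le_trans (nneseries_lim_ge n.+1 _); last by move=> k _ _; rewrite lee_fin dyadic_term_ge0.
  rewrite big_nat_recr//= leeDr// sume_ge0// => k _; by rewrite lee_fin dyadic_term_ge0.
apply: ge0_subset_integral => //; exact: measurable_half_plane2.
Qed.

End radial.

(** * Necessity and the norm *)

Section necessity.
Context {R : realType}.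
Implicit Types (f : R[i] -> R[i]) (z : R[i]).
Notation normc := (@normc R).
Notation mR := (measurableTypeR R).
Notation leb := (@lebesgue_measure R).
Notation area := ((leb \x leb)%E).
Variables (p : R) (p1 : 1 <= p).

Let p0 : 0 < p. Proof. exact: lt_le_trans p1. Qed.

Let measurable_pow f : holomorphic_on (@upper_half_plane R) f ->
  measurable_fun half_plane2 (fun w : mR * mR => (normc (f (w.1 +i* w.2)) `^ p)%:E).
Proof.
move=> /holomorphic_continuous[cf _ _]; apply/measurable_EFinP.
by apply: (measurableT_comp (measurable_powR _)); exact: (continuous_on_uhp_measurable cf).
Qed.

Lemma bergman_int_le f g : holomorphic_on (@upper_half_plane R) f ->
  holomorphic_on (@upper_half_plane R) g -> forall c : R, 0 <= c ->
  (forall z, upper_half_plane z -> c * normc (f z) <= normc (g z)) ->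
  ((c `^ p)%:E * bergman_int p f <= bergman_int p g)%E.
Proof.
move=> hf hg c c0 h; rewrite /bergman_int -ge0_integralZl; last 4 first.
- exact: measurable_half_plane2.
- exact: measurable_pow.
- by move=> w _; rewrite lee_fin powR_ge0.
- by rewrite lee_fin powR_ge0.
apply: ge0_le_integral.
- exact: measurable_half_plane2.
- by move=> w _; rewrite mule_ge0// lee_fin powR_ge0.
- by apply: emeasurable_funM => //; exact: measurable_pow.
- exact: measurable_pow.
move=> w hw; rewrite -EFinM lee_fin -powRM ?normc_ge0//.
by rewrite ge0_ler_powR ?(ltW p0) ?nnegrE ?mulr_ge0 ?normc_ge0//; exact: h.
Qed.

Lemma unbounded_multiples (n X : R) : 0 < n -> (forall a, 0 < a -> a * n <= X) -> False.
Proof.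
move=> n0 H; have X0 : 0 < X by rewrite (lt_le_trans _ (H 1 ltr01))// mul1r.
have := H (X / n + 1) (addr_gt0 (divr_gt0 X0 n0) ltr01).
by rewrite mulrDl mul1r divfK ?gt_eqF// gerDl leNgt n0.
Qed.

Lemma bergman_int_gt0 f z : holomorphic_on (@upper_half_plane R) f ->
  upper_half_plane z -> f z != 0 -> (0 < bergman_int p f)%E.
Proof.
move=> hf hz fz; rewrite lt_def bergman_int_ge0 andbT; apply/eqP => f0.
have nf : 0 < normc (f z) by rewrite normc_gt0.
have y0 : 0 < complex.Im z by [].
set rho := complex.Im z / 2.
have hrho : 0 < rho < complex.Im z by rewrite /rho; apply/andP; split; lra.
(* The pointwise bound for a vanishing integral applies to every multiple [a * f]. *)
have H (a : R) : 0 < a -> a * normc (f z) <= 16 * rho `^ (- (2 / p)).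
  move=> a0.
  have hol : holomorphic_on (@upper_half_plane R) (fun w => a%:C * f w).
    by move=> w hw; exact/cderivable_scale/hf.
  have i0 : bergman_int p (fun w => a%:C * f w) = 0%E.
    have a1 : 0 <= a^-1 by rewrite invr_ge0 ltW.
    have h w : upper_half_plane w -> a^-1 * normc (a%:C * f w) <= normc (f w).
      by move=> hw; rewrite normcM normc_real gtr0_norm// mulKf// gt_eqF.
    apply/eqP; rewrite eq_le bergman_int_ge0 andbT.
    have c0 : 0 < a^-1 `^ p by rewrite powR_gt0// invr_gt0.
    rewrite -(@lee_pmul2l _ (a^-1 `^ p)%:E)// mule0 -f0.
    exact: bergman_int_le hol hf _ a1 h.
  have := @bergman_pointwise R p p1 _ (complex.Re z) (complex.Im z) rho 0 hrho hol i0.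
  rewrite mulr0 addr0; case: (z) => x y /=.
  by rewrite normc_realM// ltW.
exact: unbounded_multiples nf H.
Qed.

Section one_exponent.
Variable e : R.
Hypothesis e0 : 0 < e.
Hypothesis e2 : e < 1 / 2.

(** The p-th power of [testfun_upper] is a constant times the radial majorant with d = e p. *)
Lemma testfun_bergman : bergman_space p (testfun p e).
Proof.
have hol := @testfun_holomorphic R p e e0 e2.
have d0 : 0 < e * p by rewrite mulr_gt0.
split=> //; apply/(bergman_norm_lty p1).
have a0 : 0 < (aperture e)^-1 by rewrite invr_gt0 aperture_gt0.
pose g (w : mR * mR) : R :=
  expR (- 2 * ln (normc (w.1 +i* w.2))) * expR (- (e * p) * `|ln (normc (w.1 +i* w.2))|).
have mg := @measurable_radial R (e * p).
apply: (@le_lt_trans _ _ (\int[area]_(w in half_plane2) (((aperture e)^-1 `^ p)%:E * (g w)%:E))%E).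
  apply: ge0_le_integral.
  - exact: measurable_half_plane2.
  - by move=> w _; rewrite lee_fin powR_ge0.
  - exact: measurable_pow.
  - by apply: emeasurable_funM => //; apply/measurable_EFinP; exact: mg.
  move=> w hw; rewrite -EFinM lee_fin.
  have U := @testfun_upper R p e e0 e2 (w.1 +i* w.2).
  apply: (le_trans (ge0_ler_powR (ltW p0) _ _ U)); rewrite ?nnegrE ?normc_ge0//.
    by rewrite !mulr_ge0 ?expR_ge0 ?(ltW a0).
  rewrite -mulrA powRM ?mulr_ge0 ?expR_ge0 ?(ltW a0)// powRM ?expR_ge0//.
  rewrite -!expRM /g le_eqVlt; apply/orP; left; apply/eqP; congr (_ * (expR _ * expR _)).
    by move: (ln _) => L; field; rewrite gt_eqF.
  by rewrite mulrAC mulNr.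
rewrite ge0_integralZl; last 4 first.
- exact: measurable_half_plane2.
- by apply/measurable_EFinP; exact: mg.
- by move=> w _; rewrite lee_fin mulr_ge0// expR_ge0.
- by rewrite lee_fin powR_ge0.
apply: lte_mul_pinfty; rewrite ?lee_fin ?powR_ge0//.
exact: radial_integral.
Qed.

Variable mu : {measure set mR -> \bar R}.

(** The weight that the test function of exponent [e] detects; it increases to [hweight] as e
    decreases to 0. *)
Definition tempered_weight (t : R) : R := hweight p t * expR (- e * `|ln t|).

Lemma tempered_weight_ge0 t : 0 <= tempered_weight t.
Proof. by rewrite mulr_ge0 ?hweight_ge0 ?expR_ge0. Qed.

Lemma measurable_tempered_weight : measurable_fun (@half_line R) (fun t : mR => (tempered_weight t)%:E).
Proof.
apply/measurable_EFinP; apply: measurable_funM; first exact: measurable_hweight.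
apply: (measurableT_comp (@measurable_expR R)); apply: measurable_funM => //.
have ml : measurable_fun (@half_line R) (@ln R : mR -> mR) := measurable_funTS (@measurable_ln R).
exact: (measurableT_comp _ ml).
Qed.

(** After multiplication by B = z ^ (2 / p) the real part of the integrand is at least a multiple of
    the tempered weight, so convergence at a single [z] already makes the tempered integral finite.
    The second factor [aperture] pays for comparing [growth] with |testden| in the test function
    itself. *)
Lemma hausdorff_testfun_lower z : upper_half_plane z ->
  cintegrable mu half_line (hausdorff_integrand (testfun p e) z) ->
  exists2 j : R, (\int[mu]_(t in half_line) (tempered_weight t)%:E)%E = j%:E &
    aperture e ^+ 2 * j * normc (testfun p e z) <= normc (hausdorff mu (testfun p e) z).
Proof.
move=> hz hint; set W := (\int[mu]_(_ in _) _)%E.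
pose B := cexp ((2 / p)%:C * clog z); pose c := aperture e / growth e (ln (normc z)).
have g0 := growth_gt0 e (ln (normc z)).
have k0 := aperture_gt0 e0 e2.
have c0 : 0 < c by rewrite divr_gt0.
have [Ri Re_] := cintegrable_linear (@measurable_half_line R) (complex.Re B) (- complex.Im B) hint.
have ReE (w : R[i]) : complex.Re B * complex.Re w + - complex.Im B * complex.Im w = complex.Re (B * w).
  by case: (B) (w) => ? ? [? ?] /=; rewrite mulNr.
have W0 : (0 <= W)%E by apply: integral_ge0 => t _; rewrite lee_fin tempered_weight_ge0.
have main : (c%:E * W <= (complex.Re (B * hausdorff mu (testfun p e) z))%:E)%E.
  rewrite -[X in (_ <= X%:E)%E]ReE -Re_ /Rintegral fineK; last exact: (integrable_fin_num (@measurable_half_line R) Ri).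
  rewrite /W -ge0_integralZl; last 4 first.
  - exact: measurable_half_line.
  - exact: measurable_tempered_weight.
  - by move=> t _; rewrite lee_fin tempered_weight_ge0.
  - by rewrite lee_fin ltW.
  have low (t : mR) : half_line t -> c * tempered_weight t <=
    complex.Re B * complex.Re (hausdorff_integrand (testfun p e) z t) +
    - complex.Im B * complex.Im (hausdorff_integrand (testfun p e) z t).
    by move=> ht; rewrite ReE; exact: Re_integrand_testfun.
  apply: ge0_le_integral.
  - exact: measurable_half_line.
  - by move=> t _; rewrite mule_ge0// lee_fin ?(ltW c0) ?tempered_weight_ge0.
  - by apply: emeasurable_funM => //; exact: measurable_tempered_weight.
  - exact: measurable_int Ri.
  by move=> t ht; rewrite -EFinM lee_fin low.
have Wfin : W \is a fin_num.
  rewrite ge0_fin_numE//; move: main; rewrite -lee_pdivlMl// => /le_lt_trans; apply.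
  by rewrite -EFinM ltry.
exists (fine W); first by rewrite fineK.
have {}main : c * fine W <= complex.Re (B * hausdorff mu (testfun p e) z).
  by rewrite -lee_fin EFinM fineK.
move: (fine W) (fine_ge0 W0) main => j j0 main.
have H1 : c * j <= normc B * normc (hausdorff mu (testfun p e) z).
  by rewrite (le_trans main)// -normcM (le_trans (ler_norm _))// ler_Re_normc.
have B0 : 0 < normc B by rewrite normc_gt0 cexp_neq0.
have D0 := testden_gt0 e0 e2 (Im_clog z).
have DL : aperture e * growth e (ln (normc z)) <= normc (testden e (clog z)).
  rewrite (le_trans _ (le_trans (ler_norm _) (ler_Re_normc _)))//.
  exact: (testden_lower e0 e2 (Im_clog z)).
have BE : normc B * expR (- (2 / p) * ln (normc z)) = 1.
  rewrite /B normc_cexp /= mul0r subr0 -expRD mulNr subrr expR0//.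
rewrite -(ler_pM2l B0); apply: le_trans H1.
rewrite normc_testfun [leLHS]mulrCA [normc B * _]mulrA BE mul1r.
rewrite ler_pdivrMr// /c expr2.
apply: (@le_trans _ _ (aperture e / growth e (ln (normc z)) * j * (aperture e * growth e (ln (normc z))))).
  by rewrite le_eqVlt; apply/orP; left; apply/eqP; field; rewrite gt_eqF.
by rewrite ler_wpM2l// mulr_ge0// ltW.
Qed.

(** The factor in the pointwise lower bound is the same for all [z], so it passes to norms; the norm
    of the test function is finite and positive and can be divided out. The point ['i] supplies the
    value [j]. *)
Lemma hausdorff_norm_lower (C : R) :
  (forall z, upper_half_plane z -> cintegrable mu half_line (hausdorff_integrand (testfun p e) z)) ->
  bergman_space p (hausdorff mu (testfun p e)) -> hausdorff_bound mu p C ->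
  exists2 j : R, (\int[mu]_(t in half_line) (tempered_weight t)%:E)%E = j%:E &
    aperture e ^+ 2 * j <= C.
Proof.
move=> hint hH [C0 hC].
have tb := testfun_bergman.
have hi : upper_half_plane ('i : R[i]) by rewrite /upper_half_plane/= ltr01.
have [j jE _] := hausdorff_testfun_lower hi (hint _ hi); exists j => //.
have j0 : 0 <= j.
  by rewrite -lee_fin -jE integral_ge0// => t _; rewrite lee_fin tempered_weight_ge0.
set k := aperture e ^+ 2 * j.
have k0 : 0 <= k by rewrite mulr_ge0// sqr_ge0.
have lower z : upper_half_plane z -> k * normc (testfun p e z) <= normc (hausdorff mu (testfun p e) z).
  move=> hz; have [j' j'E] := hausdorff_testfun_lower hz (hint _ hz).
  by have -> : j' = j by apply: EFin_inj; rewrite -j'E.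
have := bergman_int_le tb.1 hH.1 k0 lower.
have := hC _ tb; rewrite !bergman_normE.
have f0 : (0 < bergman_int p (testfun p e))%E.
  by apply: (bergman_int_gt0 tb.1 hi); rewrite -normc_gt0 testfun_gt0.
have fF : bergman_int p (testfun p e) \is a fin_num.
  by rewrite ge0_fin_numE ?bergman_int_ge0//; exact/(bergman_norm_lty p1)/tb.2.
have gF : bergman_int p (hausdorff mu (testfun p e)) \is a fin_num.
  by rewrite ge0_fin_numE ?bergman_int_ge0//; exact/(bergman_norm_lty p1)/hH.2.
have g0 := bergman_int_ge0 p (hausdorff mu (testfun p e)).
move: (bergman_int p (testfun p e)) (bergman_int p (hausdorff mu (testfun p e))) f0 fF gF g0.
move=> [N| |] [M| |] //; rewrite lte_fin lee_fin => N0 _ _ M0.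
rewrite -!EFinM !poweR_EFin !lee_fin => H1 H2.
have pi0 : (0 : R) < pi^-1 by rewrite invr_gt0 pi_gt0.
have P0 : 0 < (pi^-1 * N) `^ p^-1 by rewrite powR_gt0// mulr_gt0.
rewrite -(ler_pM2r P0); apply: (le_trans _ H1).
have -> : k = (k `^ p) `^ p^-1 by rewrite -powRrM divff ?powRr1// gt_eqF.
rewrite -powRM ?powR_ge0 ?mulr_ge0 ?(ltW pi0) ?(ltW N0)//.
apply: ge0_ler_powR; rewrite ?invr_ge0 ?(ltW p0)// ?nnegrE.
- by rewrite !mulr_ge0 ?powR_ge0 ?(ltW pi0) ?(ltW N0).
- by rewrite mulr_ge0// ltW.
by rewrite mulrCA ler_wpM2l// ltW.
Qed.

End one_exponent.

Variable mu : {measure set mR -> \bar R}.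

Lemma tempered_weight_cvg (t : R) :
  (tempered_weight (harmonic n.+2) t)%:E @[n --> \oo] --> (hweight p t)%:E.
Proof.
apply: cvg_EFin; first by near=> n.
rewrite [X in _ --> X](_ : _ = hweight p t * expR (- 0 * `|ln t|)); last first.
  by rewrite oppr0 mul0r expR0 mulr1.
apply: cvgMr; apply: continuous_cvg; first exact: continuous_expR.
apply: cvgMl; apply: cvgN.
have := @cvg_harmonic R; rewrite -(cvg_shiftn 2).
by under eq_fun do rewrite addn2.
Unshelve. all: by end_near. Qed.

(** [C] is any admissible bound, so the estimate yields both necessity and the minimality of [I]. *)
Lemma hweight_integral_le (C : R) :
  (forall f, bergman_space p f -> forall z, upper_half_plane z ->
     cintegrable mu half_line (hausdorff_integrand f z)) ->
  (forall f, bergman_space p f -> bergman_space p (hausdorff mu f)) ->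
  hausdorff_bound mu p C ->
  (\int[mu]_(t in half_line) (hweight p t)%:E <= C%:E)%E.
Proof.
move=> hint hH hC.
(* This is 1 / (n + 3), which lies below 1 / 2 from the start. *)
pose e n : R := harmonic n.+2.
have e0 n : 0 < e n by rewrite invr_gt0.
have e2 n : e n < 1 / 2 by rewrite div1r ltf_pV2 ?posrE// ltr_nat.
have emono n m : (n <= m)%N -> e m <= e n by move=> nm; rewrite lef_pV2 ?posrE// ler_nat.
have ecvg : e n @[n --> \oo] --> (0 : R).
  have := @cvg_harmonic R; rewrite -(cvg_shiftn 2).
  by under eq_fun do rewrite addn2.
have wmono (t : R) n m : (n <= m)%N -> tempered_weight (e n) t <= tempered_weight (e m) t.
  move=> nm; rewrite ler_wpM2l ?hweight_ge0// ler_expR !mulNr lerN2 ler_wpM2r//.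
  exact: emono.
(* The two limits are decoupled: for m >= n the tempered integral at [e m] dominates the one at
   [e n], so the latter can be kept fixed while the aperture tends to 1. The limit in n is left to
   monotone convergence. *)
have Jn n : (\int[mu]_(t in half_line) (tempered_weight (e n) t)%:E <= C%:E)%E.
  have J m := hausdorff_norm_lower (e0 m) (e2 m) (hint _ (testfun_bergman (e0 m) (e2 m)))
    (hH _ (testfun_bergman (e0 m) (e2 m))) hC.
  have [j jE _] := J n; rewrite jE lee_fin.
  have low m : (n <= m)%N -> aperture (e m) ^+ 2 * j <= C.
    move=> nm; have [j' j'E] := J m; apply: le_trans.
    rewrite ler_wpM2l ?sqr_ge0// -lee_fin -jE -j'E.
    apply: ge0_le_integral.
    - exact: measurable_half_line.
    - by move=> t _; rewrite lee_fin tempered_weight_ge0.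
    - exact: measurable_tempered_weight.
    - exact: measurable_tempered_weight.
    by move=> t _; rewrite lee_fin wmono.
  have cv : aperture (e m) ^+ 2 * j @[m --> \oo] --> j.
    rewrite [X in _ --> X](_ : _ = cos (0 * pi) ^+ 2 * j); last first.
      by rewrite mul0r cos0 expr1n mul1r.
    apply: cvgMl; apply: (@cvg_comp _ _ _ _ (fun x : R => x ^+ 2)); last exact: exprn_continuous.
    have c1 : e m * pi @[m --> \oo] --> 0 * pi by apply: cvgMl; exact: ecvg.
    exact: cvg_comp c1 (@continuous_cos R (0 * pi)).
  rewrite -(cvg_lim _ cv)//; apply: limr_le; first by apply/cvg_ex; eexists; exact: cv.
  by exists n => // m /= nm; exact: low.
have := @cvg_monotone_convergence _ _ _ mu _ (@measurable_half_line R)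
  (fun n t => (tempered_weight (e n) t)%:E)
  (fun n => measurable_tempered_weight (e n))
  (fun n t _ => tempered_weight_ge0 (e n) t)
  (fun t _ n m nm => wmono t n m nm).
have -> : (\int[mu]_(t in half_line) limn (fun n => (tempered_weight (e n) t)%:E) =
   \int[mu]_(t in half_line) (hweight p t)%:E)%E.
  apply: eq_integral => t _; apply: cvg_lim => //; exact: tempered_weight_cvg.
move=> cv; rewrite -(cvg_lim _ cv)//; apply: lime_le; first by apply/cvg_ex; eexists; exact: cv.
by apply: nearW => n; exact: Jn.
Qed.

End necessity.

Theorem theorem1p1 (R : realType) (p : R) (hp : 1 <= p)
    (mu : {measure set (measurableTypeR R) -> \bar R})
    (hmu : sigma_finite half_line mu) :
  (hausdorff_bounded mu p <->
     (\int[mu]_(t in half_line) (1 / t `^ (1 - 2 / p))%:E < +oo)%E) /\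
  ((\int[mu]_(t in half_line) (1 / t `^ (1 - 2 / p))%:E < +oo)%E ->
   exists2 C : R, is_hausdorff_norm mu p C &
     C%:E = (\int[mu]_(t in half_line) (1 / t `^ (1 - 2 / p))%:E)%E).
Proof.
have W0 : (0 <= \int[mu]_(t in half_line) (hweight p t)%:E)%E.
  by apply: integral_ge0 => t _; rewrite lee_fin hweight_ge0.
have sufficient : (\int[mu]_(t in half_line) (hweight p t)%:E < +oo)%E ->
    exists2 I : R, (\int[mu]_(t in half_line) (hweight p t)%:E = I%:E)%E & hausdorff_bounded mu p.
  move=> hW; exists (fine (\int[mu]_(t in half_line) (hweight p t)%:E)%E).
    by rewrite fineK// ge0_fin_numE.
  apply: (@hausdorff_bounded_integral R p hp mu hmu (fine (\int[mu]_(t in half_line) (hweight p t)%:E)%E)).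
  by rewrite fineK// ge0_fin_numE.
split; first split.
- move=> [hint hH [C hC]].
  by rewrite (le_lt_trans (hweight_integral_le hp hint hH hC))// ltry.
- by move=> /sufficient[].
move=> hW; have [I hI [hint hH _]] := sufficient hW; exists I; last by rewrite -hI.
split; first split.
- by rewrite -lee_fin -hI.
- by move=> f hf; exact: hausdorff_norm_bound.
move=> C hC; rewrite -lee_fin -hI.
exact: hweight_integral_le.
Qed.
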